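(* Let $G$ be a locally compact group and let $p\in(1,\infty)$. Let $U\in\mathcal{B}(L^p(G))$ be the self-inverse invertible isometry $Uf(t)=\Delta(t^{-1})^{1/p}f(t^{-1})$. Then $$PM_p(G)'=U\,CV_p(G)\,U\quad\text{and}\quad (U\,CV_p(G)\,U)'=CV_p(G).$$ In particular, the bicommutant satisfies $PM_p(G)''=CV_p(G)$.
   Context: $G$ is a locally compact group with left Haar measure $dt$ and Haar modular function $\Delta$ (so $\int_G f(ts)\,dt=\Delta(s)^{-1}\int_G f(t)\,dt$); $L^p(G)$ is taken with respect to left Haar measure, and $\frac1p+\frac1{p'}=1$. The left and right regular representations on $L^p(G)$ are $\lambda_p(s)f(t)=f(s^{-1}t)$ and $\rho_p(s)f(t)=\Delta(s)^{1/p}f(ts)$. $\mathcal{B}(L^p(G))$ is the algebra of bounded operators; it is the dual of the projective tensor product $L^{p'}(G)\hat\otimes L^p(G)$ via $\langle T,\xi\otimes f\rangle=\int_G\xi(t)[Tf](t)\,dt$, which gives its weak* topology. $PM_p(G)$ is the weak*-closed linear span of $\lambda_p(G)=\{\lambda_p(s):s\in G\}$ in $\mathcal{B}(L^p(G))$, and $CV_p(G)=\rho_p(G)'$. For $S\subseteq\mathcal{B}(L^p(G))$, $S'$ denotes the commutant of $S$ in $\mathcal{B}(L^p(G))$ and $S''=(S')'$. *)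

(* Defs.v *)
From HB Require Import structures.
From mathcomp Require Import all_boot all_order all_algebra.
From mathcomp Require Import ring_quotient.
From mathcomp Require Import all_classical all_reals all_analysis.
From mathcomp Require Import measurable_realfun complex.

Set Implicit Arguments.
Unset Strict Implicit.
Unset Printing Implicit Defensive.

Import Order.TTheory GRing.Theory Num.Theory.
Import numFieldNormedType.Exports.
Import ComplexField.

Local Open Scope classical_set_scope.
Local Open Scope ring_scope.
Local Open Scope quotient_scope.

(* The base point is needed only because [measurableType] extends pointed types. *)
HB.mixin Record PreTopologicalGroup_isTopologicalGroup G of
    PointedTopological G & Group G := {
  mulg_continuous : continuous (fun x : G * G => (x.1 * x.2)%g : G) ;
  invg_continuous : continuous (fun x : G => (x^-1)%g : G)
}.

#[short(type="topologicalGroupType")]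
HB.structure Definition TopologicalGroup :=
  {G of PointedTopological G & Group G & PreTopologicalGroup_isTopologicalGroup G}.

Notation borel G := (g_sigma_algebraType (@open G)).

Section Haar.
Context {R : realType} {G : topologicalGroupType}.
Implicit Types (mu : {measure set (borel G) -> \bar R}) (Delta : G -> R).
Local Open Scope ereal_scope.

(* Compact sets are Borel when [G] is Hausdorff. *)
Definition radon mu :=
  [/\ forall K : set G, compact K -> mu K < +oo,
      forall A : set (borel G), measurable A ->
        mu A = ereal_inf [set mu V | V in [set V : set G | open V /\ A `<=` V]]
    & forall V : set G, open V ->
        mu V = ereal_sup [set mu K | K in [set K : set G | compact K /\ K `<=` V]]].

Definition left_haar mu :=
  [/\ radon mu, mu setT != 0
    & forall (s : G) (A : set (borel G)), measurable A ->
        mu [set (s * t)%g | t in A] = mu A].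

(* [mu (A s) = Delta s * mu A], in integrated form. *)
Definition modular_function mu Delta :=
  forall s : G, (0 < Delta s)%R /\
    forall f : borel G -> \bar R, measurable_fun setT f -> (forall t, 0 <= f t) ->
      \int[mu]_t f (t * s)%g = (Delta s)^-1%:E * \int[mu]_t f t.

End Haar.

Section translations.
Context {G : topologicalGroupType}.

Lemma continuous_borel_measurable (f : G -> G) :
  continuous f -> measurable_fun setT (f : borel G -> borel G).
Proof.
move=> /continuousP cf.
apply: measurability; first exact: erefl.
move=> _ [B oB <-].
rewrite setTI; apply: sub_sigma_algebra; exact: cf.
Qed.

Lemma mulgl_continuous (s : G) : continuous (fun t : G => (s * t)%g : G).
Proof.
move=> t; apply: (@continuous_comp _ _ _ (fun t : G => (s, t))
  (fun x : G * G => (x.1 * x.2)%g : G)); last exact: mulg_continuous.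
by apply: (@cvg_pair _ _ _ _ (nbhs s)); [exact: cvg_cst|exact: cvg_id].
Qed.

Lemma mulgr_continuous (s : G) : continuous (fun t : G => (t * s)%g : G).
Proof.
move=> t; apply: (@continuous_comp _ _ _ (fun t : G => (t, s))
  (fun x : G * G => (x.1 * x.2)%g : G)); last exact: mulg_continuous.
by apply: (@cvg_pair _ _ _ _ _ (nbhs s)); [exact: cvg_id|exact: cvg_cst].
Qed.

End translations.

Section complex_functions.
Context d (T : measurableType d) (R : realType).

Definition cmeasurable (f : T -> R[i]) :=
  measurable_fun setT (@complex.Re R \o f) /\ measurable_fun setT (@complex.Im R \o f).

Definition cintegral (mu : {measure set T -> \bar R}) (f : T -> R[i]) : R[i] :=
  Complex (\int[mu]_t complex.Re (f t))%R (\int[mu]_t complex.Im (f t))%R.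

Lemma cmeasurable_normc f : cmeasurable f ->
  measurable_fun setT (@Normc.normc R \o f).
Proof.
move=> [mr mi].
have -> : @Normc.normc R \o f = (@Num.sqrt R) \o
    (fun t => (complex.Re (f t)) ^+ 2 + (complex.Im (f t)) ^+ 2).
  by apply/funext => t /=; case: (f t).
apply: measurableT_comp.
  by apply: continuous_measurable_fun; exact: sqrt_continuous.
by apply: measurable_funD; apply: measurable_funX.
Qed.

Lemma cmeasurable0 : cmeasurable 0.
Proof. by split; exact: measurable_cst. Qed.

Lemma cmeasurableD f g : cmeasurable f -> cmeasurable g -> cmeasurable (f + g).
Proof.
move=> [fr fi] [gr gi]; split.
  rewrite (_ : _ \o _ = (@complex.Re R \o f) \+ (@complex.Re R \o g)); first exact: measurable_funD.
  by apply/funext => t /=; rewrite fctE; case: (f t); case: (g t).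
rewrite (_ : _ \o _ = (@complex.Im R \o f) \+ (@complex.Im R \o g)); first exact: measurable_funD.
by apply/funext => t /=; rewrite fctE; case: (f t); case: (g t).
Qed.

Lemma cmeasurableZ (a : R[i]) f : cmeasurable f -> cmeasurable (a *: f).
Proof.
case: a => a b [fr fi]; split.
  rewrite (_ : _ \o _ = (fun t => a * complex.Re (f t)) \- (fun t => b * complex.Im (f t))).
    by apply: measurable_funB; apply: measurable_funM => //; exact: measurable_cst.
  by apply/funext => t /=; rewrite fctE; case: (f t).
rewrite (_ : _ \o _ = (fun t => a * complex.Im (f t)) \+ (fun t => b * complex.Re (f t))).
  by apply: measurable_funD; apply: measurable_funM => //; exact: measurable_cst.
by apply/funext => t /=; rewrite fctE; case: (f t).
Qed.

End complex_functions.

Section Lp_functions.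
Context d (T : measurableType d) (R : realType).
Variables (mu : {measure set T -> \bar R}) (p : R) (p1 : 1 <= p).

Implicit Types f g : T -> R[i].

Definition cLnorm (f : T -> R[i]) : \bar R :=
  @Lnorm d T R mu p%:E (EFin \o (@Normc.normc R \o f)).

(* The unused proof argument carries the hypothesis of [Lp_pred_submod_closed]. *)
Definition Lp_pred of 1 <= p : {pred T -> R[i]} :=
  mem [set f : T -> R[i] | cmeasurable f /\ (cLnorm f < +oo)%E].

Lemma Lp_predP f : reflect (cmeasurable f /\ (cLnorm f < +oo)%E) (f \in Lp_pred p1).
Proof. by apply: (iffP idP) => [/set_mem|] //; exact: mem_set. Qed.

Lemma measurable_EFin_normc f : cmeasurable f ->
  measurable_fun setT (EFin \o (@Normc.normc R \o f)).
Proof. by move=> mf; apply/measurable_EFinP; exact: cmeasurable_normc. Qed.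

Lemma normc_fct_ge0 (f : T -> R[i]) t : 0 <= Normc.normc (f t).
Proof. by case: (f t) => a b /=; exact: sqrtr_ge0. Qed.

Lemma cLnorm_ge0 f : (0 <= cLnorm f)%E.
Proof. exact: Lnorm_ge0. Qed.

Let p0 : 0 < p. Proof. exact: lt_le_trans ltr01 p1. Qed.

Lemma measurable_normc_powR f : cmeasurable f ->
  measurable_fun setT (fun t => (Normc.normc (f t) `^ p)%:E).
Proof.
move=> mf; apply/measurable_EFinP.
apply: (@measurableT_comp _ _ _ _ _ _ (fun x : R => x `^ p)).
  exact: measurable_powR.
exact: cmeasurable_normc.
Qed.

Lemma cLnormE f :
  cLnorm f = ((\int[mu]_t (Normc.normc (f t) `^ p)%:E) `^ p^-1)%E.
Proof.
rewrite /cLnorm unlock; congr poweR; apply: eq_integral => t _ /=.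
by rewrite ger0_norm// normc_fct_ge0.
Qed.

Lemma le_Lnorm (f g : T -> R) :
  measurable_fun setT f -> measurable_fun setT g ->
  (forall t, 0 <= f t <= g t) ->
  (@Lnorm d T R mu p%:E (EFin \o f) <= @Lnorm d T R mu p%:E (EFin \o g))%E.
Proof.
move=> mf mg fg.
have mp (h : T -> R) : measurable_fun setT h ->
    measurable_fun setT (fun t => (`|(EFin \o h) t| `^ p)%E).
  move=> mh; apply/measurable_EFinP.
  apply: (@measurableT_comp _ _ _ _ _ _ (fun x : R => x `^ p)).
    exact: measurable_powR.
  exact: measurableT_comp.
rewrite unlock; apply: gt0_ler_poweR.
- by rewrite invr_ge0 ltW.
- by rewrite in_itv/= leey andbT integral_ge0// => t _; exact: poweR_ge0.
- by rewrite in_itv/= leey andbT integral_ge0// => t _; exact: poweR_ge0.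
apply: ge0_le_integral => // [t _|||t _].
- exact: poweR_ge0.
- exact: mp.
- exact: mp.
have /andP[f0 fgt] := fg t; rewrite lee_fin ge0_ler_powR ?nnegrE//; first exact: ltW.
by rewrite !ger0_norm// (le_trans f0).
Qed.

Lemma cLnormD f g : cmeasurable f -> cmeasurable g ->
  (cLnorm (f + g)%R <= cLnorm f + cLnorm g)%E.
Proof.
move=> mf mg; have mnf := cmeasurable_normc mf; have mng := cmeasurable_normc mg.
apply: le_trans (minkowski_EFin mu mnf mng p1).
apply: le_Lnorm => [||t].
- exact/cmeasurable_normc/cmeasurableD.
- exact: measurable_funD.
- by rewrite normc_fct_ge0/=; exact: le_normcD.
Qed.

Lemma cLnormZ a f : cmeasurable f ->
  (cLnorm (a *: f)%R = (Normc.normc a)%:E * cLnorm f)%E.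
Proof.
move=> mf; have a0 : 0 <= Normc.normc a by case: a => a b; exact: sqrtr_ge0.
rewrite !cLnormE.
under eq_integral => t _ do
  rewrite fctE Normc.normcM powRM ?normc_fct_ge0// EFinM.
rewrite ge0_integralZl//; last 3 first.
- exact: measurable_normc_powR.
- by move=> t _; rewrite lee_fin powR_ge0.
- by rewrite lee_fin powR_ge0.
rewrite poweRM ?lee_fin ?powR_ge0//; last first.
  by apply: integral_ge0 => t _; rewrite lee_fin powR_ge0.
by rewrite poweR_EFin -powRrM mulfV ?gt_eqF// powRr1.
Qed.

Lemma cLnorm0 : cLnorm 0%R = 0%E.
Proof.
rewrite /cLnorm (_ : _ \o _ = cst 0%E) ?Lnorm0//.
  by rewrite eqe gt_eqF.
by apply/funext => t; congr EFin; exact: Normc.normc0.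
Qed.

Lemma Lp_pred_submod_closed : submod_closed (Lp_pred p1).
Proof.
split=> [|a f g /Lp_predP[mf fy] /Lp_predP[mg gy]].
  by apply/Lp_predP; split; [exact: cmeasurable0|rewrite cLnorm0].
apply/Lp_predP; split; first by apply: cmeasurableD => //; exact: cmeasurableZ.
apply: le_lt_trans (cLnormD (cmeasurableZ a mf) mg) _.
rewrite lte_add_pinfty// cLnormZ// lte_mul_pinfty// ?lee_fin//.
by case: a => a b; exact: sqrtr_ge0.
Qed.

HB.instance Definition _ := GRing.isSubmodClosed.Build _ _ (Lp_pred p1)
  Lp_pred_submod_closed.

Record LpFun := MkLpFun { Lp_fun :> T -> R[i] ; _ : Lp_fun \in Lp_pred p1 }.

HB.instance Definition _ := [isSub for Lp_fun].
HB.instance Definition _ := [Choice of LpFun by <:].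
HB.instance Definition _ := [SubChoice_isSubLmodule of LpFun by <:].

Definition null_fun : {pred LpFun} :=
  mem [set f : LpFun | (f : T -> R[i]) = 0 %[ae mu]].

Lemma null_funP (f : LpFun) : reflect ((f : T -> R[i]) = 0 %[ae mu]) (f \in null_fun).
Proof. by apply: (iffP idP) => [/set_mem|] //; exact: mem_set. Qed.

Lemma null_fun_zmod_closed : zmod_closed null_fun.
Proof.
split=> [|f g /null_funP f0 /null_funP g0]; apply/null_funP.
  by apply: aeW => t.
apply: filterS2 f0 g0 => t ft gt _.
by have -> : (f - g : LpFun) t = f t - g t by []; rewrite ft// gt// subr0.
Qed.

HB.instance Definition _ := GRing.isZmodClosed.Build _ null_fun
  null_fun_zmod_closed.

Definition Lp : Type := Quotient.quot null_fun.
HB.instance Definition _ := GRing.Zmodule.on Lp.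
HB.instance Definition _ := EqQuotient.on Lp.

Definition Lp_class (f : LpFun) : Lp := \pi_Lp f.

Lemma Lp_class_eq (f g : LpFun) :
  Lp_class f = Lp_class g <-> (f : T -> R[i]) = g %[ae mu].
Proof.
have -> : (Lp_class f = Lp_class g) <-> f - g \in null_fun.
  by split=> [/eqP|fg]; [|apply/eqP]; rewrite /Lp_class eqmodE /= Quotient.equivE.
split=> [/null_funP|fg]; last apply/null_funP.
  apply: filterS => t /(_ I) fg _; apply/eqP; rewrite -subr_eq0; exact/eqP.
apply: filterS fg => t /(_ I) fg _.
have -> : (f - g : LpFun) t = f t - g t by [].
by rewrite fg subrr.
Qed.

Definition Lp_repr (u : Lp) : LpFun := repr u.

Lemma Lp_reprK (u : Lp) : Lp_class (Lp_repr u) = u.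
Proof. exact: reprK. Qed.

Lemma Lp_classK (f : LpFun) : (Lp_repr (Lp_class f) : T -> R[i]) = f %[ae mu].
Proof. by apply/Lp_class_eq; rewrite Lp_reprK. Qed.

Lemma Lp_classD (f g : LpFun) : Lp_class (f + g) = Lp_class f + Lp_class g.
Proof. exact: (raddfD (\pi_Lp)). Qed.

Definition Lp_scale (a : R[i]) (u : Lp) : Lp := Lp_class (a *: Lp_repr u).

Lemma Lp_scale_class a (f : LpFun) : Lp_scale a (Lp_class f) = Lp_class (a *: f).
Proof.
apply/Lp_class_eq; apply: filterS (Lp_classK f) => t /(_ I) ft _.
by have -> (h : LpFun) : (a *: h) t = a * h t by []; rewrite ft.
Qed.

Lemma Lp_scaleA a b u : Lp_scale a (Lp_scale b u) = Lp_scale (a * b) u.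
Proof. by rewrite -[u]Lp_reprK !Lp_scale_class scalerA. Qed.

Lemma Lp_scale1 : left_id 1 Lp_scale.
Proof. by move=> u; rewrite -[u]Lp_reprK Lp_scale_class scale1r. Qed.

Lemma Lp_scaleDr : right_distributive Lp_scale +%R.
Proof.
move=> a u v; rewrite -[u]Lp_reprK -[v]Lp_reprK.
by rewrite -Lp_classD !Lp_scale_class -Lp_classD scalerDr.
Qed.

Lemma Lp_scaleDl u : {morph Lp_scale^~ u : a b / a + b}.
Proof.
move=> a b; rewrite -[u]Lp_reprK !Lp_scale_class -Lp_classD.
by rewrite scalerDl.
Qed.

HB.instance Definition _ := GRing.Zmodule_isLmodule.Build R[i] Lp
  Lp_scaleA Lp_scale1 Lp_scaleDr Lp_scaleDl.

Lemma Lp_classZ a (f : LpFun) : Lp_class (a *: f) = a *: Lp_class f.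
Proof. by rewrite -Lp_scale_class. Qed.

Definition Lp_norm (u : Lp) : R := fine (cLnorm (Lp_repr u)).

Lemma LpFun_cmeasurable (f : LpFun) : cmeasurable f.
Proof. by case: f => f /= /Lp_predP[]. Qed.

Lemma LpFun_cLnorm (f : LpFun) : cLnorm f \is a fin_num.
Proof. by rewrite ge0_fin_numE ?cLnorm_ge0//; case: f => f /= /Lp_predP[]. Qed.

Lemma ae_eq_cLnorm f g : cmeasurable f -> cmeasurable g ->
  f = g %[ae mu] -> cLnorm f = cLnorm g.
Proof.
move=> mf mg fg; rewrite !cLnormE; congr poweR.
apply: ae_eq_integral => //; [exact: measurable_normc_powR|
  exact: measurable_normc_powR|].
by apply: filterS fg => t /[apply] ->.
Qed.

Lemma Lp_norm_class (f : LpFun) : Lp_norm (Lp_class f) = fine (cLnorm f).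
Proof.
congr fine; apply: ae_eq_cLnorm; [exact: LpFun_cmeasurable|
  exact: LpFun_cmeasurable|exact: Lp_classK].
Qed.

Lemma Lp_norm_ge0 u : 0 <= Lp_norm u.
Proof. by rewrite fine_ge0// cLnorm_ge0. Qed.

Lemma Lp_normD u v : Lp_norm (u + v) <= Lp_norm u + Lp_norm v.
Proof.
rewrite -[u]Lp_reprK -[v]Lp_reprK -Lp_classD !Lp_norm_class.
rewrite -fineD ?LpFun_cLnorm// fine_le ?fin_numD ?LpFun_cLnorm//.
by apply: cLnormD; exact: LpFun_cmeasurable.
Qed.

Lemma Lp_normZ a u : Lp_norm (a *: u) = Normc.normc a * Lp_norm u.
Proof.
rewrite -[u]Lp_reprK -Lp_classZ !Lp_norm_class.
by rewrite cLnormZ ?fineM ?LpFun_cLnorm//; exact: LpFun_cmeasurable.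
Qed.

Lemma Lp_norm_eq0 u : Lp_norm u = 0 -> u = 0.
Proof.
rewrite -[u]Lp_reprK Lp_norm_class => /eqP.
rewrite fine_eq0 ?LpFun_cLnorm// => /eqP u0.
have mu_ := measurable_EFin_normc (LpFun_cmeasurable (Lp_repr u)).
have h : (Lp_repr u : T -> R[i]) = (0 : LpFun) %[ae mu].
  have := Lnorm_eq0_eq0 mu_ _ u0.
  rewrite lte_fin => /(_ p0); apply: filterS => t /(_ I) /= [] /Normc.eq0_normc ut _.
  exact: ut.
by move/Lp_class_eq: h => ->; exact: (raddf0 (\pi_Lp)).
Qed.

Let norm (u : Lp) : R[i] := (Lp_norm u)%:C%C.

Let normD u v : norm (u + v) <= norm u + norm v.
Proof. by rewrite /norm -raddfD lecR Lp_normD. Qed.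

Let normZ a u : norm (a *: u) = `|a| * norm u.
Proof. by rewrite /norm Lp_normZ rmorphM; congr (_ * _); case: a. Qed.

Let norm_eq0 u : norm u = 0 -> u = 0.
Proof. by move=> [] /Lp_norm_eq0. Qed.

HB.instance Definition _ := Lmodule_isNormed.Build R[i] Lp normD normZ norm_eq0.

Lemma Lp_normE (u : Lp) : `|u| = (Lp_norm u)%:C%C.
Proof. by []. Qed.

End Lp_functions.

Section bounded_operators.
Context {K : numFieldType} {V : normedModType K}.

Definition bounded_map (f : V -> V) := exists M : K, forall u, `|f u| <= M * `|u|.

Definition bop_pred : {pred V -> V} :=
  mem [set f : V -> V | linear f /\ bounded_map f].

Lemma bop_predP (f : V -> V) : reflect (linear f /\ bounded_map f) (f \in bop_pred).
Proof. by apply: (iffP idP) => [/set_mem|] //; exact: mem_set. Qed.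

Lemma bounded_map_ge0 f : bounded_map f ->
  exists2 M : K, 0 <= M & forall u, `|f u| <= M * `|u|.
Proof.
move=> [M fM]; exists `|M| => // u; have Mu := le_trans (normr_ge0 _) (fM u).
by rewrite -[X in _ * X]normr_id -normrM ger0_norm.
Qed.

Lemma bop_pred_submod_closed : submod_closed bop_pred.
Proof.
split=> [|a f g /bop_predP[lf [M bf]] /bop_predP[lg [N bg]]]; apply/bop_predP; split.
- by move=> b u v; rewrite /= scaler0 addr0.
- by exists 0 => u; rewrite mul0r normr0.
- move=> b u v; have E w : (a *: f + g) w = a *: f w + g w by [].
  by rewrite !E lf lg !scalerDr !scalerA addrACA mulrC.
- exists (`|a| * M + N) => u; rewrite mulrDl -mulrA.
  by rewrite (le_trans (ler_normD _ _))// lerD// normrZ ler_wpM2l.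
Qed.

HB.instance Definition _ := GRing.isSubmodClosed.Build _ _ bop_pred
  bop_pred_submod_closed.
End bounded_operators.

Section bounded_operators_type.
Context {K : numFieldType} (V : normedModType K).

Record bop := MkBop { bop_fun :> V -> V ; _ : bop_fun \in bop_pred }.

HB.instance Definition _ := [isSub for bop_fun].
HB.instance Definition _ := [Choice of bop by <:].
HB.instance Definition _ := [SubChoice_isSubLmodule of bop by <:].

End bounded_operators_type.

Section bop_theory.
Context {K : numFieldType} {V : normedModType K}.
Implicit Types (S T : bop V) (A : set (bop V)).

Lemma bop_linear T : linear T.
Proof. by case: T => T /= /bop_predP[]. Qed.

Lemma bop_bounded T : bounded_map T.
Proof. by case: T => T /= /bop_predP[]. Qed.

Lemma bop_ext S T : S =1 T -> S = T.
Proof. by move=> ST; apply/val_inj/funext. Qed.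

Lemma bop_comp_subproof S T : S \o T \in bop_pred.
Proof.
apply/bop_predP; split=> [a u v|] /=; first by rewrite !bop_linear.
have [M M0 SM] := bounded_map_ge0 (bop_bounded S).
have [N TN] := bop_bounded T.
by exists (M * N) => u; rewrite -mulrA (le_trans (SM _))// ler_wpM2l.
Qed.

Definition bop_comp S T : bop V := MkBop (bop_comp_subproof S T).

Definition commutant A : set (bop V) :=
  [set T | forall S, A S -> bop_comp T S = bop_comp S T].

Definition linear_span A : set (bop V) :=
  [set T | exists n (c : 'I_n -> K) (S : 'I_n -> bop V),
     (forall i, A (S i)) /\ T = \sum_i c i *: S i].

End bop_theory.

(* The bounded operator [f |-> w f(phi t)], for [w > 0] and a measurable [phi]
   such that the image of [w^p mu] under [phi] is [mu]; it is an isometry. *)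
Section weighted_composition.
Context d (T : measurableType d) (R : realType).
Variables (mu : {measure set T -> \bar R}) (p : R) (p1 : 1 <= p).
Variables (w : R) (phi : T -> T).

Definition weighted_measure_preserving := [/\ 0 < w, measurable_fun setT phi &
  forall h : T -> \bar R, measurable_fun setT h -> (forall t, (0 <= h t)%E) ->
    (\int[mu]_t h (phi t) = (w `^ p)^-1%:E * \int[mu]_t h t)%E].

Hypothesis wphi : weighted_measure_preserving.

Let w0 : 0 < w. Proof. by case: wphi. Qed.
Let mphi : measurable_fun setT phi. Proof. by case: wphi. Qed.
Let p0 : 0 < p. Proof. exact: lt_le_trans ltr01 p1. Qed.

Definition wcomp (f : T -> R[i]) : T -> R[i] := fun t => w%:C%C * f (phi t).

Lemma cmeasurable_wcomp f : cmeasurable f -> cmeasurable (wcomp f).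
Proof.
move=> [fr fi]; apply: (@cmeasurableZ _ _ _ w%:C%C (f \o phi)).
by split; [exact: (measurableT_comp fr)|exact: (measurableT_comp fi)].
Qed.

Lemma cLnorm_wcomp f : cmeasurable f -> cLnorm mu p (wcomp f) = cLnorm mu p f.
Proof.
move=> mf; rewrite !cLnormE; congr poweR.
have [_ _ /(_ (fun t => (Normc.normc (f t) `^ p)%:E))] := wphi.
move=> /(_ (measurable_normc_powR p mf)) H.
under eq_integral => t _ do rewrite Normc.normcM powRM ?normc_fct_ge0 ?sqrtr_ge0// EFinM.
rewrite ge0_integralZl//; last 3 first.
- have -> : (fun t => (Normc.normc (f (phi t)) `^ p)%:E) =
    (fun t => (Normc.normc (f t) `^ p)%:E) \o phi by [].
  exact: measurableT_comp (measurable_normc_powR p mf) mphi.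
- by move=> t _; rewrite lee_fin powR_ge0.
- by rewrite lee_fin powR_ge0.
rewrite H; last by move=> t; rewrite lee_fin powR_ge0.
rewrite /= expr0n/= addr0 sqrtr_sqr gtr0_norm// muleA -EFinM mulfV ?mul1e//.
by rewrite gt_eqF// powR_gt0.
Qed.

Lemma wcomp_subproof (f : LpFun mu p1) : wcomp f \in Lp_pred mu p1.
Proof.
have mf := LpFun_cmeasurable f.
apply/Lp_predP; split; first exact: cmeasurable_wcomp.
by rewrite cLnorm_wcomp// -ge0_fin_numE ?cLnorm_ge0// LpFun_cLnorm.
Qed.

Definition wcomp_LpFun (f : LpFun mu p1) : LpFun mu p1 := MkLpFun (wcomp_subproof f).

Definition wcomp_Lp (u : Lp mu p1) : Lp mu p1 := Lp_class (wcomp_LpFun (Lp_repr u)).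

Lemma wcomp_ae (f g : T -> R[i]) : f = g %[ae mu] -> wcomp f = wcomp g %[ae mu].
Proof.
move=> [N [mN N0 fgN]]; exists (phi @^-1` N); split.
- by rewrite -[X in measurable X]setTI; exact: mphi.
- have [_ _ /(_ (EFin \o \1_N))] := wphi.
  have mI : measurable_fun setT (EFin \o \1_N : T -> \bar R).
    by apply/measurable_EFinP; exact: measurable_indic.
  move=> /(_ mI) H.
  have -> : mu (phi @^-1` N) = (\int[mu]_t (EFin \o \1_N) (phi t))%E.
    have -> : (fun t => (EFin \o \1_N) (phi t)) = EFin \o \1_(phi @^-1` N).
      by [].
    by rewrite integral_indic ?setIT// -[X in measurable X]setTI; exact: mphi.
  rewrite H; last by move=> t; rewrite lee_fin.
  by rewrite integral_indic ?setIT// N0 mule0.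
- move=> t /= nt; apply: fgN => /= fg; apply: nt => _.
  by rewrite /wcomp fg.
Qed.

Lemma wcomp_LpE (f : LpFun mu p1) : wcomp_Lp (Lp_class f) = Lp_class (wcomp_LpFun f).
Proof. by apply/Lp_class_eq; apply: wcomp_ae; exact: Lp_classK. Qed.

Lemma wcomp_Lp_subproof : wcomp_Lp \in bop_pred.
Proof.
apply/bop_predP; split.
  move=> a u v; rewrite -[u]Lp_reprK -[v]Lp_reprK.
  rewrite -Lp_classZ -Lp_classD !wcomp_LpE -Lp_classZ -Lp_classD.
  congr Lp_class; apply: val_inj; apply: funext => t.
  have wcompD (f g : T -> R[i]) s :
      wcomp (fun s => a * f s + g s) s = a * wcomp f s + wcomp g s.
    by rewrite /wcomp mulrDr mulrCA.
  exact: wcompD.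
exists 1 => u; rewrite mul1r -[u]Lp_reprK wcomp_LpE !Lp_normE lecR !Lp_norm_class.
by rewrite cLnorm_wcomp//; exact: LpFun_cmeasurable.
Qed.

Definition wcomp_bop : bop (Lp mu p1) := MkBop wcomp_Lp_subproof.

Lemma wcomp_bopE (u : Lp mu p1) :
  (Lp_repr (wcomp_bop u) : T -> R[i]) = (fun t => w%:C%C * Lp_repr u (phi t)) %[ae mu].
Proof. exact: Lp_classK. Qed.

End weighted_composition.

Section conjugate_exponent.
Context {R : realType} {p : R} (p1 : 1 < p).

Definition conjugate : R := (1 - p^-1)^-1.

Lemma conjugateE : p^-1 + conjugate^-1 = 1.
Proof. by rewrite /conjugate invrK subrKC. Qed.

Lemma conjugate_ge1 : 1 <= conjugate.
Proof.
have p0 : 0 < p := lt_trans ltr01 p1.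
by rewrite invf_ge1 ?subr_gt0 ?invf_lt1// gerBl invr_ge0 ltW.
Qed.

End conjugate_exponent.

Section weak_star_topology.
Context d (T : measurableType d) (R : realType).
Variables (mu : {measure set T -> \bar R}) (p : R) (p1 : 1 < p).

Local Notation E := (Lp mu (ltW p1)).
Local Notation E' := (Lp mu (conjugate_ge1 p1)).

Definition Lp_pairing (xi : E') (f : E) : R[i] :=
  cintegral mu (fun t => Lp_repr xi t * Lp_repr f t).

(* A representation [\sum_n xi_n (x) f_n], with
   [\sum_n `|xi_n| * `|f_n| < +oo], of an element of the projective tensor
   product of [E'] and [E]; every element has one. *)
Record projective_tensor := ProjectiveTensor {
  tensor_left : nat -> E' ;
  tensor_right : nat -> E ;
  tensor_summable :
    cvgn (series (fun n => Lp_norm (tensor_left n) * Lp_norm (tensor_right n))) }.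

HB.instance Definition _ := gen_eqMixin projective_tensor.
HB.instance Definition _ := gen_choiceMixin projective_tensor.

Definition tensor_pairing (A : bop E) (om : projective_tensor) : R[i]^o :=
  limn (series (fun n =>
    Lp_pairing (tensor_left om n) (A (tensor_right om n)) : R[i]^o)).

Definition weak_star : Type :=
  initial_topology (tensor_pairing : bop E -> {ptws projective_tensor -> R[i]^o}).

Definition weak_star_closure (A : set (bop E)) : set (bop E) :=
  closure (A : set weak_star).

End weak_star_topology.

Section regular_representations.
Context {R : realType} {G : topologicalGroupType}.
Variables (mu : {measure set (borel G) -> \bar R}) (Delta : G -> R).
Hypotheses (haar : left_haar mu) (modular : modular_function mu Delta).
Context {p : R} (p1 : 1 < p).

Local Notation LpG := (Lp mu (ltW p1)).

Lemma lambda_subproof (s : G) :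
  weighted_measure_preserving mu p 1 (fun t : borel G => (s^-1 * t)%g : borel G).
Proof.
have mphi : measurable_fun setT (fun t : borel G => (s^-1 * t)%g : borel G).
  by apply: continuous_borel_measurable; exact: mulgl_continuous.
split=> // h mh h0; rewrite powR1 invr1 mul1e.
have [_ _ inv] := haar.
rewrite -[LHS](@ge0_integral_pushforward _ _ _ _ _ _ mphi mu setT)//.
apply: eq_measure_integral => A mA _; rewrite /pushforward/= -[RHS](inv s)//.
congr (mu _); apply/seteqP; split=> [t At|_ [t At <-]] /=.
  by exists (s^-1 * t)%g => //; rewrite mulgA mulgV mul1g.
by rewrite mulgA mulVg mul1g.
Qed.

Definition lambda (s : G) : bop LpG := wcomp_bop (ltW p1) (lambda_subproof s).

Lemma rho_subproof (s : G) :
  weighted_measure_preserving mu p (Delta s `^ p^-1)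
    (fun t : borel G => (t * s)%g : borel G).
Proof.
have [D0 Ds] := modular s; split.
- exact: powR_gt0.
- by apply: continuous_borel_measurable; exact: mulgr_continuous.
have p0 : p != 0 by rewrite gt_eqF// (lt_trans ltr01).
by move=> h mh h0; rewrite -powRrM mulVf// powRr1 ?ltW// Ds.
Qed.

Definition rho (s : G) : bop LpG := wcomp_bop (ltW p1) (rho_subproof s).

Lemma lambdaE s (f : LpG) :
  (Lp_repr (lambda s f) : G -> R[i]) = (fun t => Lp_repr f (s^-1 * t)%g) %[ae mu].
Proof.
have := wcomp_bopE (lambda_subproof s) f.
apply: filterS => t ft _; exact: etrans (ft I) (mul1r _).
Qed.

Lemma rhoE s (f : LpG) : (Lp_repr (rho s f) : G -> R[i]) =
  (fun t => (Delta s `^ p^-1)%:C%C * Lp_repr f (t * s)%g) %[ae mu].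
Proof. exact: wcomp_bopE. Qed.

Definition PM : set (bop LpG) := weak_star_closure (linear_span (range lambda)).

Definition CV : set (bop LpG) := commutant (range rho).

End regular_representations.

Arguments lambda {R G mu} haar {p} p1 s.
Arguments rho {R G mu Delta} modular {p} p1 s.
Arguments PM {R G mu} haar {p} p1 _.
Arguments CV {R G mu Delta} modular {p} p1 _.

(* Main.v *)
Require Import Defs.
From HB Require Import structures.
From mathcomp Require Import all_boot all_order all_algebra.
From mathcomp Require Import finmap all_classical all_reals all_analysis.
From mathcomp Require Import measurable_realfun complex.
From mathcomp Require Import ring lra.

Set Implicit Arguments.
Unset Strict Implicit.
Unset Printing Implicit Defensive.

Import Order.TTheory GRing.Theory Num.Theory.
Import numFieldNormedType.Exports.

Local Open Scope classical_set_scope.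
Local Open Scope ring_scope.

(** Both equalities reduce to [left_right_commute]: an operator [S] that
    commutes with the right translations and an operator [T] that commutes with
    the left translations commute with each other.

    The flip [U] conjugates [lambda s] into [rho s] ([rho_flip_lambda]), so that
    [U CV U] is the commutant of the left translations. Moreover [PM] is
    contained in [CV] ([PM_rho]): the transpose of [rho s] maps indicators to
    multiples of indicators, hence for [A] in [PM] the equation
    [<xi, A (rho s u)> = <xi, rho s (A u)>] is an equality of two weak*
    continuous functionals of [A], and it holds for [A = lambda t]. What then
    remains of the theorem is [left_right_commute] and the fact that [lambda s]
    is in [PM] and in [CV].

    For [left_right_commute], convolve with indicators. For an open set [E]
    contained in a compact set, [u * 1_(E^-1)] is a continuous function, with
    value [\int_E u(t s) ds] at [t]; it is an integral of right translates of
    [u]. So right convolution with an indicator commutes with [S] and with the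
    left translations. On the other hand [k * 1_B], for [k] an indicator, is
    also an integral of left translates of [1_B], so that [T (k * 1_B)] is
    [k * h] with [h = T 1_B], and [T (k * 1_B) * 1_(E^-1)] is [k * v] with
    [v = h * 1_(E^-1)]. If [v] were an indicator then [S (k * v) = S k * v]
    would follow, and the general case should follow by approximating [v] by
    step functions. But [S k] and [v] are two functions in [L^p], whose
    convolution need not make sense: in weak form it is the integral of
    [<g, lambda_(t^-1) (S k)>], where [g s = v (s^-1)] would have to be in
    [L^q], for the conjugate exponent [q].

    The crucial point is that [g] is in [L^q] ([convol_inv_in]). Since [T]
    commutes with the left translations, [<g, k>] is equal to
    [<1_E, T (k * 1_B)>], first for step functions [k], and this is a bounded
    functional of [k] in [L^p]; the converse of the inequality of Hoelder
    ([converse_hoelder], [representation]) applies. The same formula shows that [S k * v] is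
    [T (S k * 1_B) * 1_(E^-1)]. As step functions approximate [v] in [L^p] and
    simultaneously, after inversion, [g] in [L^q] ([step_dense] with
    [rc_approx_borel_inv]), one obtains
    [S (T (k * 1_B) * 1_(E^-1)) = T (S k * 1_B) * 1_(E^-1)] ([sandwich]), that is
    [(S T - T S) (k * 1_B) * 1_(E^-1) = 0]. Convolution with the normalised
    indicators of small neighbourhoods of the unit is an approximate identity
    ([convolLp_approx]), so that [S T = T S].

    If the group is not sigma-compact, Haar measure is not sigma-finite; and open
    subsets of [G * G] may fail to be measurable for the product of the Borel
    sigma-algebras. Every double integral is therefore
    brought to the measures of the sections of an open set, which are lower
    semicontinuous; there the order of integration can be exchanged
    ([open_tonelli]). Integrals of [L^p]-valued functions are taken weakly. *)

(** * Open sets contained in a compact set *)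

Section relatively_compact.
Context {G : topologicalGroupType}.
Implicit Types (s t : G) (A U V W K : set G).

(** These sets have finite measure, are stable under translations and inversion,
    and exhaust every open set in measure. *)
Definition rc W := open W /\ exists2 K, compact K & W `<=` K.

Lemma open_borel A : open A -> measurable (A : set (borel G)).
Proof. exact: sub_sigma_algebra. Qed.

Lemma continuous_mulg (f g : G * G -> G) : continuous f -> continuous g ->
  continuous (fun x => (f x * g x)%g : G).
Proof.
move=> cf cg x; apply: (@continuous_comp _ _ _ (fun x => (f x, g x))
  (fun x : G * G => (x.1 * x.2)%g : G)); last exact: mulg_continuous.
exact: cvg_pair (cf x) (cg x).
Qed.

Lemma continuous_invg (f : G * G -> G) : continuous f -> continuous (fun x => (f x)^-1%g : G).
Proof.
move=> cf x; apply: (@continuous_comp _ _ _ f (fun t : G => (t^-1)%g : G)); first exact: cf.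
exact: invg_continuous.
Qed.

Lemma continuous_fst : continuous (fst : G * G -> G). Proof. by move=> x; exact: cvg_fst. Qed.

Lemma continuous_snd : continuous (snd : G * G -> G). Proof. by move=> x; exact: cvg_snd. Qed.

Lemma continuous_mulVg : continuous (fun x : G * G => (x.2^-1 * x.1)%g : G).
Proof.
apply: continuous_mulg; last exact: continuous_fst.
by apply: continuous_invg; exact: continuous_snd.
Qed.

Lemma open_swap (O : set (G * G)) : open O -> open [set x : G * G | O (x.2, x.1)].
Proof.
apply: (@open_comp _ _ (fun x : G * G => (x.2, x.1))) => x _.
by apply: cvg_pair; [exact: cvg_snd|exact: cvg_fst].
Qed.

Lemma open_near A : (forall t, A t -> \forall s \near t, A s) -> open A.
Proof. by rewrite openE. Qed.

Lemma open_mulgl s A : open A -> open [set t | A (s * t)%g].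
Proof. by apply: open_comp => t _; exact: mulgl_continuous. Qed.

Lemma open_invg A : open A -> open [set t | A (t^-1)%g].
Proof. by apply: open_comp => t _; exact: invg_continuous. Qed.

Lemma rc_open W : rc W -> open W. Proof. by case. Qed.

Lemma rc_borel W : rc W -> measurable (W : set (borel G)).
Proof. by move=> /rc_open /open_borel. Qed.

Lemma rcS V W : rc W -> open V -> V `<=` W -> rc V.
Proof. by move=> [_ [K cK WK]] oV VW; split=> //; exists K => // t /VW /WK. Qed.

Lemma rc0 : rc set0.
Proof. by split; [exact: open0|exists set0 => //; exact: compact0]. Qed.

Lemma rcU V W : rc V -> rc W -> rc (V `|` W).
Proof.
move=> [oV [K cK VK]] [oW [L cL WL]]; split; first exact: openU.
by exists (K `|` L); [exact: compactU|exact: setUSS].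
Qed.

Lemma rcI V W : open V -> rc W -> rc (V `&` W).
Proof.
move=> oV rW; apply: (rcS rW); last exact: subIsetr.
by apply: openI => //; exact: rc_open.
Qed.

Lemma rc_preimage (f g : G -> G) W : continuous f -> continuous g ->
  (forall t, g (f t) = t) -> rc W -> rc (f @^-1` W).
Proof.
move=> cf cg fK [oW [K cK WK]]; split; first by apply: open_comp => // t _; exact: cf.
exists (g @` K).
  by apply: continuous_compact => //; exact: continuous_subspaceT.
by move=> t /WK Kt; exists (f t).
Qed.

Lemma rc_mulgl s W : rc W -> rc [set t | W (s * t)%g].
Proof.
apply: (@rc_preimage _ (fun t => (s^-1 * t)%g)); [exact: mulgl_continuous..|].
by move=> t; rewrite mulgA mulVg mul1g.
Qed.

Lemma rc_mulgr s W : rc W -> rc [set t | W (t * s)%g].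
Proof.
apply: (@rc_preimage _ (fun t => (t * s^-1)%g)); [exact: mulgr_continuous..|].
by move=> t; rewrite -mulgA mulgV mulg1.
Qed.

Lemma rc_invg W : rc W -> rc [set t | W (t^-1)%g].
Proof. by apply: (@rc_preimage _ (fun t => (t^-1)%g)); [exact: invg_continuous..|exact: invgK]. Qed.

Hypothesis lcG : locally_compact [set: G].

Lemma rc_nbhs t A : nbhs t A -> exists2 W, rc W & W t /\ W `<=` A.
Proof.
move=> nA; have [K nK [cK _]] := lcG (I : [set: G] t).
have nKt : nbhs t K by apply: (@filterS _ (nbhs t) _ [set u | [set: G] u -> K u]) => // u; apply.
exists (A `&` K)°; last split.
- split; first exact: open_interior.
  by exists K => // u /interior_subset[].
- exact: filterI.
- by move=> u /interior_subset[].
Qed.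

(** Compactness as an induction principle: a property of open sets that holds
    locally and passes to unions holds on a neighbourhood of [K]. *)
Lemma compact_directed (P : set G -> Prop) K : compact K ->
  (forall U, P U -> open U) -> (exists U, P U) ->
  (forall U V, P U -> P V -> exists2 W, P W & U `|` V `<=` W) ->
  (forall t, K t -> exists2 U, P U & U t) -> exists2 U, P U & K `<=` U.
Proof.
move=> cK oP [U0 PU0] dP KP.
have := cK; rewrite compact_cover => /(_ (set G) [set U | P U] id oP).
case=> [t /KP[U PU Ut]|D DP KD]; first by exists U.
have [W PW WD] : exists2 W, P W & forall U, U \in D -> U `<=` W.
  have : {subset (enum_fset D) <= [set U | P U]} by move=> U UD; exact: DP.
  suff : forall s : seq (set G), {subset s <= [set U | P U]} ->
      exists2 W, P W & forall U, U \in s -> U `<=` W by apply.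
  elim=> [|U s IH] sP; first by exists U0.
  have [|V PV Vs] := IH; first by move=> V Vs; apply: sP; rewrite inE Vs orbT.
  have PU : P U by apply: (@set_mem _ [set U | P U]); apply: sP; rewrite inE eqxx.
  have [W PW UVW] := dP U V PU PV.
  exists W => // U'; rewrite inE => /orP[/eqP ->|/Vs U'V] t.
    by move=> Ut; apply: UVW; left.
  by move=> /U'V Vt; apply: UVW; right.
by exists W => // t /KD[U UD Ut]; exact: (WD U UD).
Qed.

Lemma rc_between K V : compact K -> open V -> K `<=` V ->
  exists2 W, rc W & K `<=` W /\ W `<=` V.
Proof.
move=> cK oV KV.
have [| | | |W [rW WV] KW] := @compact_directed (fun U => rc U /\ U `<=` V) K cK.
- by move=> U [/rc_open].
- by exists set0; split; [exact: rc0|].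
- move=> U U' [rU UV] [rU' U'V]; exists (U `|` U') => //; split; first exact: rcU.
  by rewrite subUset.
- move=> t /KV Vt; have [|W rW [Wt WV]] := @rc_nbhs t V; last by exists W.
  by apply: open_nbhs_nbhs; split.
by exists W.
Qed.

(** Tube lemma; it is applied to maps such as [f (t, s) = t * s^-1], to keep the
    small translates of [K] inside [V]. *)
Lemma compact_near1 (f : G * G -> G) K V : continuous f ->
  (forall t, f (t, 1%g) = t) -> compact K -> open V -> K `<=` V ->
  \forall s \near (1%g : G), forall t, K t -> V (f (t, s)).
Proof.
move=> cf f1 cK oV KV.
pose P U := open U /\ \forall s \near (1%g : G), forall t, U t -> V (f (t, s)).
have [| | | |U [oU nU] KU] := @compact_directed P K cK.
- by move=> U [].
- by exists set0; split; [exact: open0|exact: nearW].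
- move=> U U' [oU nU] [oU' nU']; exists (U `|` U') => //; split; first exact: openU.
  by apply: filterS2 nU nU' => s sU sU' t [/sU|/sU'].
- move=> t /KV Vt.
  have : nbhs (t, 1%g : G) [set x | V (f x)].
    by apply: (cf (t, 1%g)); apply: open_nbhs_nbhs; rewrite f1.
  move=> [[/= A B] [nA nB] AB]; exists A°; last by exact: nA.
  split; first exact: open_interior.
  by apply: filterS nB => s Bs u /interior_subset Au; exact: (AB (u, s)).
by apply: filterS nU => s sU t /KU; exact: sU.
Qed.

End relatively_compact.

(** * Radon measures on open sets *)

Section radon_theory.
Context {R : realType} {G : topologicalGroupType}.
Variable mu : {measure set (borel G) -> \bar R}.
Hypotheses (hausG : hausdorff_space G) (lcG : locally_compact [set: G]).
Hypothesis rad : radon mu.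
Implicit Types (s t : G) (A U V W K E Z : set G) (O : set (G * G)).
Local Open Scope ereal_scope.

Lemma compact_borel K : compact K -> measurable (K : set (borel G)).
Proof.
move=> /(compact_closed hausG) cK.
rewrite -[K]setCK; apply: measurableC; apply: open_borel.
by rewrite openC.
Qed.

Lemma borel_le (A B : set (borel G)) :
  measurable A -> measurable B -> A `<=` B -> mu A <= mu B.
Proof. by move=> mA mB; apply: le_measure; exact: mem_set. Qed.

Lemma rc_finite W : rc W -> mu W < +oo.
Proof.
have [fK _ _] := rad; move=> [oW [K cK WK]].
apply: le_lt_trans (fK K cK); apply: borel_le => //.
- exact: (open_borel oW).
- exact: (compact_borel cK).
Qed.

(** Inner regularity makes [mu] continuous along directed families of open sets
    of any cardinality, where countable additivity would not suffice. *)
Lemma open_directed (P : set G -> Prop) V0 (y : \bar R) :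
  (forall U, P U -> open U) -> (exists U, P U) ->
  (forall U V, P U -> P V -> exists2 W, P W & U `|` V `<=` W) ->
  open V0 -> (forall t, V0 t -> exists2 U, P U & U t) -> y < mu V0 ->
  exists2 U, P U & y < mu U.
Proof.
move=> oP P0 dP oV0 VP.
have [_ _ ->//] := rad.
move=> /ereal_sup_gt[_ [K [cK KO] <-] yK].
have [|U PU KU] := compact_directed cK oP P0 dP; first by move=> t /KO /VP.
exists U => //; apply: lt_le_trans yK _; apply: borel_le => //.
- exact: (compact_borel cK).
- exact: (open_borel (oP _ PU)).
Qed.

Lemma rc_exhaust V (y : \bar R) : open V -> y < mu V ->
  exists2 W, rc W /\ W `<=` V & y < mu W.
Proof.
move=> oV; apply: (@open_directed (fun W => rc W /\ W `<=` V)) => //.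
- by move=> U [/rc_open].
- by exists set0; split; [exact: rc0|].
- move=> U U' [rU UV] [rU' U'V]; exists (U `|` U') => //; split; first exact: rcU.
  by rewrite subUset.
- move=> t Vt; have [|W rW [Wt WV]] := @rc_nbhs _ lcG t V; last by exists W.
  by apply: open_nbhs_nbhs; split.
Qed.

Lemma rc_approx V (e : R) : open V -> mu V < +oo -> (0 < e)%R ->
  exists2 W, rc W /\ W `<=` V & mu (V `\` W) < e%:E.
Proof.
move=> oV Voo e0.
have Vfin : mu V \is a fin_num by rewrite ge0_fin_numE.
have [|W [rW WV] VW] := @rc_exhaust V (mu V - e%:E) oV.
  by rewrite lteBlDr// lteDl// lte_fin.
exists W => //; have mW := rc_borel rW; have mV := open_borel oV.
have Wfin : mu W \is a fin_num by rewrite ge0_fin_numE//; exact: rc_finite.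
rewrite measureD//.
by rewrite (setIidr WV) lteBlDl// -lteBlDr// .
Qed.

Lemma outer_approx (A : set (borel G)) (e : R) : measurable A -> mu A < +oo ->
  (0 < e)%R -> exists2 V, open V /\ A `<=` V & mu (V `\` A) < e%:E.
Proof.
move=> mA Aoo e0; have Afin : mu A \is a fin_num by rewrite ge0_fin_numE.
have [_ outer _] := rad.
have : ereal_inf [set mu V | V in [set V : set G | open V /\ A `<=` V]] < mu A + e%:E.
  by rewrite -outer// lteDl// lte_fin.
move=> /ereal_inf_lt[_ [V [oV AV] <-] Ve].
exists V => //; have mV := open_borel oV.
rewrite measureD//; last by rewrite (lt_trans Ve)// lte_add_pinfty// ltry.
by rewrite (setIidr AV) lteBlDl.
Qed.

End radon_theory.

(** Applied to the values of a function, this approximates its integral by the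
    measures of finitely many superlevel sets. *)
Lemma staircase_bounds {R : realType} (d x : R) N : 0 < d -> 0 <= x <= N%:R * d ->
  x <= \sum_(k < N) d * (k%:R * d < x)%R%:R <= x + d.
Proof.
have sumd n : \sum_(k < n) d = n%:R * d by rewrite sumr_const card_ord mulr_natl.
move=> d0 /andP[x0 xN]; apply/andP; split; last first.
  elim: {xN} N => [|N IH]; first by rewrite big_ord0 addr_ge0// ltW.
  rewrite big_ord_recr/=; case: ltP => [Nx|_]; last by rewrite mulr0 addr0.
  rewrite lerD ?mulr1// (le_trans _ (ltW Nx))// -sumd.
  by apply: ler_sum => k _; apply: ler_piMr; [exact: ltW|case: (_ < _)].
elim: N xN => [|N IH]; first by rewrite mul0r big_ord0.
move=> xN; rewrite big_ord_recr/=; case: ltP => [Nx|xN1].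
  rewrite mulr1 (le_trans xN)// -natr1 mulrDl mul1r lerD2r -sumd.
  apply: ler_sum => k _; rewrite (_ : (_ < x) = true) ?mulr1//.
  by rewrite (le_lt_trans _ Nx)// ler_pM2r// ler_nat ltnW.
by rewrite mulr0 addr0 IH.
Qed.

(** * Integrals of directed families of lower semicontinuous functions *)

Section superlevel.
Context d (T : measurableType d) (R : realType) (mu : {measure set T -> \bar R}).
Implicit Types (f : T -> R) (Z : set T).
Local Open Scope ereal_scope.

Lemma superlevel_measurable Z f : (forall r : R, measurable (Z `&` [set t | (r < f t)%R])) ->
  measurable_fun Z f.
Proof.
move=> mf mZ; apply: (measurability _ (RGenOInfty.measurableE R)) => //.
move=> /= _ [_ [r ->] <-]; rewrite (_ : f @^-1` _ = [set t | (r < f t)%R])//.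
by apply/seteqP; split => t /=; rewrite in_itv/= andbT.
Qed.

Lemma integral_staircase Z f (e : R) N : (0 < e)%R ->
  (forall r : R, measurable (Z `&` [set t | (r < f t)%R])) -> measurable Z ->
  \int[mu]_(t in Z) (\sum_(k < N) e * (k%:R * e < f t)%R%:R)%:E =
  \sum_(k < N) e%:E * mu (Z `&` [set t | (k%:R * e < f t)%R]).
Proof.
move=> e0 mf mZ.
pose P (k : 'I_N) := Z `&` [set t | (k%:R * e < f t)%R].
have -> : \int[mu]_(t in Z) (\sum_(k < N) e * (k%:R * e < f t)%R%:R)%:E =
    \int[mu]_(t in Z) \sum_(k < N) (e * \1_(P k) t)%:E.
  apply: eq_integral => t; rewrite inE => Zt.
  rewrite sumEFin; congr EFin; apply: eq_bigr => k _; congr (_ * _)%R.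
  rewrite indicE; case: ltP => h; first by rewrite mem_set.
  by rewrite memNset// => -[_ /=]; rewrite ltNge h.
have mP k : measurable (P k) by exact: mf.
rewrite ge0_integral_sum//; last 2 first.
- move=> k; apply/measurable_EFinP/measurable_funM; first exact: measurable_cst.
  exact/measurable_funTS/measurable_indic.
- by move=> k t _; rewrite lee_fin mulr_ge0// ltW.
apply: eq_bigr => k _; under eq_integral do rewrite EFinM.
rewrite ge0_integralZl//; last 2 first.
- exact/measurable_EFinP/measurable_funTS/measurable_indic.
- by rewrite lee_fin ltW.
by rewrite integral_indic// setIC setIA setIid.
Qed.

End superlevel.

Section lsc.
Context {R : realType} {G : topologicalGroupType}.
Variable mu : {measure set (borel G) -> \bar R}.
Hypotheses (hausG : hausdorff_space G) (lcG : locally_compact [set: G]).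
Hypothesis rad : radon mu.
Implicit Types (s t : G) (A U V W K E Z : set G) (O : set (G * G)).
Local Open Scope ereal_scope.

(** By the staircase approximation, only the measures of [N] superlevel sets of
    [f] matter. They are open and are the directed unions of the superlevel sets
    of the [F i], so each is almost exhausted by one of these, and directedness
    provides an index that serves all [N] of them. *)
Lemma directed_lsc_integral Z (I : Type) (D : I -> Prop) (F : I -> G -> R)
    (f : G -> R) (M e : R) :
  rc Z -> (0 < e)%R -> (exists i, D i) ->
  (forall i j, D i -> D j ->
    exists2 k, D k & forall t, Z t -> (F i t <= F k t /\ F j t <= F k t)%R) ->
  (forall i r, D i -> open (Z `&` [set t | (r < F i t)%R])) ->
  (forall t, Z t -> (0 <= f t <= M)%R) ->
  (forall i t, D i -> Z t -> (0 <= F i t <= f t)%R) ->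
  (forall t r, Z t -> (r < f t)%R -> exists2 i, D i & (r < F i t)%R) ->
  exists2 i, D i & \int[mu]_(t in Z) (f t)%:E <= \int[mu]_(t in Z) (F i t)%:E + e%:E.
Proof.
move=> rZ e0 [i0 Di0] dD oF fM Ff supF.
have mZ := rc_borel rZ; have Zoo := rc_finite hausG rad rZ.
have oPf r : open (Z `&` [set t | (r < f t)%R]).
  rewrite (_ : _ `&` _ = \bigcup_(i in D) (Z `&` [set t | (r < F i t)%R])).
    by apply: bigcup_open => i Di; exact: oF.
  apply/seteqP; split=> [t [Zt /(supF _ _ Zt)[i Di rt]]|t [i Di [Zt/= rt]]].
    by exists i.
  by split=> //=; have /andP[_] := Ff i t Di Zt; exact: lt_le_trans.
have mf r : measurable (Z `&` [set t | (r < f t)%R] : set (borel G)) by exact: open_borel.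
have mF i : D i -> forall r, measurable (Z `&` [set t | (r < F i t)%R] : set (borel G)).
  by move=> Di r; apply: open_borel; exact: oF.
pose m := fine (mu Z).
have m0 : (0 <= m)%R by exact: fine_ge0.
have mE : mu Z = m%:E by rewrite fineK// ge0_fin_numE.
(* The steps have height [d], and the superlevel sets are exhausted up to [h];
   the resulting errors [d * mu Z] and [N * d * h] are at most [e / 2]. *)
pose d := (e / (2 * (m + 1)))%R.
have d0 : (0 < d)%R by rewrite divr_gt0// mulr_gt0// ltr_wpDl.
pose N := (Num.truncn (`|M| / d)).+1.
have MN : (M <= N%:R * d)%R.
  rewrite -ler_pdivrMr// (le_trans _ (ltW (truncnS_gt _)))//.
  by rewrite ler_pM2r ?invr_gt0// ler_norm.
have N0 : (0 < N%:R :> R)%R by rewrite ltr0n.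
have Nd0 : (0 < N%:R * d)%R by exact: mulr_gt0.
pose h := (e / (2 * (N%:R * d)))%R.
have h0 : (0 < h)%R by apply: divr_gt0 => //; exact: mulr_gt0.
have [i Di iP] : exists2 i, D i & forall k, (k < N)%N ->
    mu (Z `&` [set t | (k%:R * d < f t)%R]) <=
    mu (Z `&` [set t | (k%:R * d < F i t)%R]) + h%:E.
  move: (N) => N'; elim: N' => [|n [i Di IH]]; first by exists i0.
  pose r := (n%:R * d)%R; pose Pn := Z `&` [set t | (r < f t)%R].
  have Pnoo : mu Pn < +oo.
    by apply: le_lt_trans Zoo; apply: borel_le; [exact: mf|exact: mZ|exact: subIsetl].
  have Pnfin : mu Pn \is a fin_num by rewrite ge0_fin_numE.
  have [| | | | | |U [j Dj ->] Uj] := @open_directed _ _ _ hausG rad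
      (fun U => exists2 i, D i & U = Z `&` [set t | (r < F i t)%R]) Pn (mu Pn - h%:E).
  - by move=> U [j Dj ->]; exact: oF.
  - by exists (Z `&` [set t | (r < F i0 t)%R]); exists i0.
  - move=> U V [j Dj ->] [k Dk ->]; have [l Dl jk] := dD _ _ Dj Dk.
    exists (Z `&` [set t | (r < F l t)%R]); first by exists l.
    by move=> t [[Zt rt]|[Zt rt]]; split=> //=; apply: lt_le_trans rt _; case: (jk t Zt).
  - exact: oPf.
  - move=> t [Zt /(supF _ _ Zt)[j Dj rt]].
    by exists (Z `&` [set t | (r < F j t)%R]); first by exists j.
  - by rewrite lteBlDr// lteDl// lte_fin.
  have [l Dl jl] := dD _ _ Di Dj; exists l => // k; rewrite ltnS leq_eqVlt.
  have le_l i' (r' : R) : D i' -> (forall t, Z t -> (F i' t <= F l t)%R) ->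
      mu (Z `&` [set t | (r' < F i' t)%R]) <= mu (Z `&` [set t | (r' < F l t)%R]).
    move=> Di' il; apply: borel_le; [exact: mF|exact: mF|].
    by move=> t [Zt rt]; split=> //=; apply: lt_le_trans rt _; exact: il.
  move=> /predU1P[->|kn].
    rewrite -leeBlDr// (le_trans (ltW Uj))// le_l// => t Zt.
    by case: (jl t Zt).
  rewrite (le_trans (IH _ kn))// leeD2r// le_l// => t Zt.
  by case: (jl t Zt).
exists i => //.
have stF t : Z t -> (F i t <= \sum_(k < N) d * (k%:R * d < F i t)%R%:R <= F i t + d)%R.
  move=> Zt; apply: staircase_bounds => //.
  have /andP[-> /= Fif] := Ff i t Di Zt; have /andP[_ fMt] := fM t Zt.
  by rewrite (le_trans Fif)// (le_trans fMt).
have stf t : Z t -> (f t <= \sum_(k < N) d * (k%:R * d < f t)%R%:R)%R.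
  move=> Zt; have /andP[f0 fMt] := fM t Zt.
  by have /andP[] := @staircase_bounds _ d (f t) N d0 ltac:(by rewrite f0 (le_trans fMt)).
have mst g : (forall r, measurable (Z `&` [set t | (r < g t)%R] : set (borel G))) ->
    measurable_fun (Z : set (borel G)) (fun t => (\sum_(k < N) d * (k%:R * d < g t)%R%:R)%:E).
  move=> mg; apply/measurable_EFinP/measurable_sum => k.
  apply: measurable_funM; first exact: measurable_cst.
  apply: superlevel_measurable => r.
  have [r1|r1] := ltP r 1%R; have [r2|r2] := ltP r 0%R.
  - rewrite (_ : _ `&` _ = Z)//; apply/setIidPl => t _ /=.
    by rewrite (lt_le_trans r2).
  - rewrite (_ : _ `&` _ = Z `&` [set t | (k%:R * d < g t)%R])//.
    apply/seteqP; split => t /= [Zt] h1; split=> //.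
      by move: h1; case: (_ < g t)%R; rewrite // ltNge r2.
    by rewrite h1.
  - by have := lt_trans r2 ltr01; rewrite ltNge r1.
  - rewrite (_ : _ `&` _ = set0)//; apply/seteqP; split=> // t [_ /=].
    by case: (_ < g t)%R; rewrite ltNge ?r1 ?r2.
have mfZ g : (forall r, measurable (Z `&` [set t | (r < g t)%R] : set (borel G))) ->
    measurable_fun (Z : set (borel G)) (fun t => (g t)%:E).
  by move=> mg; apply/measurable_EFinP; exact: superlevel_measurable.
apply: (@le_trans _ _ (\sum_(k < N) d%:E * (mu (Z `&` [set t | (k%:R * d < F i t)%R]) + h%:E))%E).
  apply: (@le_trans _ _ (\int[mu]_(t in Z) (\sum_(k < N) d * (k%:R * d < f t)%R%:R)%:E)).
    apply: ge0_le_integral => //.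
    - by move=> t Zt; rewrite lee_fin; have /andP[] := fM t Zt.
    - exact: mfZ.
    - exact: mst.
  rewrite integral_staircase//; apply: lee_sum => k _.
  by rewrite lee_pmul2l ?lte_fin//; exact: iP.
under eq_bigr do rewrite ge0_muleDr// ?lee_fin ?ltW//.
rewrite big_split/= -integral_staircase//; last exact: mF.
apply: (@le_trans _ _ (\int[mu]_(t in Z) (F i t + d)%:E + (e / 2)%:E)).
  apply: leeD.
    apply: ge0_le_integral => //.
    - by move=> t Zt; rewrite lee_fin; apply: sumr_ge0 => k _; rewrite mulr_ge0// ltW.
    - by apply: mst; exact: mF.
    - under eq_fun do rewrite EFinD.
      apply: emeasurable_funD; last exact: measurable_cst.
      by apply: mfZ; exact: mF.
    - by move=> t Zt; rewrite lee_fin; have /andP[] := stF t Zt.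
  under eq_bigr do rewrite -EFinM; rewrite sumEFin lee_fin sumr_const card_ord.
  rewrite -[leLHS]mulr_natl /h (_ : N%:R * (d * (e / (2 * (N%:R * d)))) = e / 2)%R//.
  by field; rewrite !gt_eqF.
under eq_integral do rewrite EFinD.
rewrite ge0_integralD//; last 3 first.
- by move=> t Zt; rewrite lee_fin; have /andP[] := Ff i t Di Zt.
- by apply: mfZ; exact: mF.
- by move=> t Zt; rewrite lee_fin ltW.
rewrite integral_cst// mE -addeA leeD2l// -EFinM -EFinD lee_fin.
have : (d * m <= e / 2)%R.
  rewrite /d invfM mulrA -mulrA ler_piMr//; first by rewrite divr_ge0// ltW.
  by rewrite mulrC ler_pdivrMr ?mul1r ?lerDl// ltr_wpDl.
lra.
Qed.

End lsc.

(** * Iterated integrals over open subsets of the square *)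

Section tonelli.
Context {R : realType} {G : topologicalGroupType}.
Variable mu : {measure set (borel G) -> \bar R}.
Hypotheses (hausG : hausdorff_space G) (lcG : locally_compact [set: G]).
Hypothesis rad : radon mu.
Implicit Types (s t u : G) (A U V W K E Z : set G) (O : set (G * G)).
Local Open Scope ereal_scope.

Lemma open_setX A V : open A -> open V -> open (A `*` V).
Proof.
move=> oA oV; rewrite openE => -[t u] [At Vu].
by exists (A, V) => //; split; exact: open_nbhs_nbhs.
Qed.

Lemma open_fst_section O t : open O -> open [set u | O (t, u)].
Proof.
move=> oO; apply: (@open_comp _ _ (fun u => (t, u))) oO => u _.
by apply: (@cvg_pair _ _ _ _ (nbhs t)); [exact: cvg_cst|exact: cvg_id].
Qed.

(** An open part of the section of [O] at [t0], with measure still above [y], is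
    contained in the sections at all nearby points. *)
Lemma section_lsc O (y : \bar R) : open O ->
  open [set t | y < mu [set u | O (t, u)]].
Proof.
move=> oO; apply: open_near => t0 yt0.
have [| | | |u Ou|U [oU nU] yU] := @open_directed _ _ _ hausG rad
  (fun U => open U /\ \forall t \near t0, forall u, U u -> O (t, u)) _ y _ _ _ _ _ yt0.
- by move=> U [].
- by exists set0; split; [exact: open0|exact: nearW].
- move=> U U' [oU nU] [oU' nU']; exists (U `|` U') => //; split; first exact: openU.
  by apply: filterS2 nU nU' => s sU sU' t [/sU|/sU'].
- exact: open_fst_section.
- have : nbhs (t0, u) O by apply: open_nbhs_nbhs.
  move=> [[/= A B] [nA nB] AB]; exists B°; last by exact: nB.
  split; first exact: open_interior.
  by apply: filterS nA => s As v /interior_subset Bv; exact: (AB (s, v)).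
- apply: filterS nU => t tU; apply: lt_le_trans yU _; apply: borel_le => //.
  + exact: open_borel.
  + exact: (open_borel (open_fst_section t oO)).
Qed.

(** Finite unions of open rectangles belong to the product sigma-algebra and
    approximate open sets from inside. *)
Definition rectangles (l : seq (set G * set G)) : set (G * G) :=
  [set x | exists2 r, r \in l & r.1 x.1 /\ r.2 x.2].

Lemma rectangles_cons r l : rectangles (r :: l) = (r.1 `*` r.2) `|` rectangles l.
Proof.
apply/seteqP; split=> [x [q]|x [rx|[q ql qx]]].
- by rewrite inE => /predU1P[->|ql] qx; [left|right; exists q].
- by exists r => //; rewrite inE eqxx.
- by exists q => //; rewrite inE ql orbT.
Qed.

Lemma open_rectangles l : (forall r, r \in l -> open r.1 /\ open r.2) ->
  open (rectangles l).
Proof.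
elim: l => [_|r l IH lo].
  by rewrite (_ : rectangles _ = set0); [exact: open0|apply/seteqP; split=> // x [q]].
rewrite rectangles_cons; apply: openU.
  by have [|o1 o2] := lo r; [rewrite inE eqxx|exact: open_setX].
by apply: IH => q ql; apply: lo; rewrite inE ql orbT.
Qed.

Lemma measurable_rectangles l : (forall r, r \in l -> open r.1 /\ open r.2) ->
  measurable (rectangles l : set (borel G * borel G)).
Proof.
elim: l => [_|r l IH lo].
  by rewrite (_ : rectangles _ = set0)//; apply/seteqP; split=> // x [q].
rewrite rectangles_cons; apply: measurableU.
  have [|o1 o2] := lo r; first by rewrite inE eqxx.
  by apply: measurableX; exact: open_borel.
by apply: IH => q ql; apply: lo; rewrite inE ql orbT.
Qed.

(* The restrictions of [mu] to [Z] and to [E] are finite, so that the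
   Fubini-Tonelli theorem applies to them. *)
Lemma rectangles_tonelli Z E l : rc Z -> rc E ->
  (forall r, r \in l -> [/\ open r.1, open r.2, r.1 `<=` Z & r.2 `<=` E]) ->
  \int[mu]_(t in Z) mu [set u | rectangles l (t, u)] =
  \int[mu]_(u in E) mu [set t | rectangles l (t, u)].
Proof.
move=> rZ rE lo.
have mZ := rc_borel rZ; have mE := rc_borel rE.
have Zoo := rc_finite hausG rad rZ; have Eoo := rc_finite hausG rad rE.
pose m1 := mfrestr mZ Zoo; pose m2 := mfrestr mE Eoo.
have mA : measurable (rectangles l : set (borel G * borel G)).
  by apply: measurable_rectangles => r /lo[].
have rZE x : rectangles l x -> Z x.1 /\ E x.2.
  by move=> [r /lo[_ _ rZ' rE'] [/rZ' ? /rE' ?]].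
have := indic_fubini_tonelli m1 m2 mA.
rewrite indic_fubini_tonelli_FE// indic_fubini_tonelli_GE//.
have xE t : xsection (rectangles l) t = [set u | rectangles l (t, u)].
  by apply/seteqP; split=> u; rewrite /xsection/= inE.
have yE u : ysection (rectangles l) u = [set t | rectangles l (t, u)].
  by apply/seteqP; split=> t; rewrite /ysection/= inE.
have intm (D : set (borel G)) (mD : measurable D) (Doo : mu D < +oo) (f : G -> \bar R) :
    (forall t, ~ D t -> f t = 0) ->
    \int[mfrestr mD Doo]_t f t = \int[mu]_(t in D) f t.
  move=> f0.
  have -> : \int[mu]_(t in D) f t = \int[mfrestr mD Doo]_(t in D) f t.
    by apply: eq_measure_integral => A _ AD; rewrite /= /mfrestr /mrestr setIidl.
  rewrite [RHS]integral_mkcond; apply: eq_integral => t _.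
  by rewrite patchE; case: ifPn => // /negP; rewrite inE => /f0.
rewrite !intm; last 2 first.
- move=> u nE; rewrite /= yE (_ : [set t | _] = set0) ?measure0//.
  by apply/seteqP; split=> // t /rZE[].
- move=> t nZ; rewrite /= xE (_ : [set u | _] = set0) ?measure0//.
  by apply/seteqP; split=> // u /rZE[].
move=> H; rewrite -[LHS]/(\int[mu]_(t in Z) _) -[RHS]/(\int[mu]_(u in E) _).
have -> : \int[mu]_(t in Z) mu [set u | rectangles l (t, u)] =
    \int[mu]_(x in Z) (m2 \o xsection (rectangles l)) x.
  apply: eq_integral => t _; rewrite /= xE /m2 /mfrestr /mrestr setIidl//.
  by move=> u /rZE[].
rewrite H; apply: eq_integral => u _; rewrite /= yE /m1 /mfrestr /mrestr setIidl//.
by move=> t /rZE[].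
Qed.

(** The measure of a section of [O] is the directed supremum of the measures of
    the sections of the finite unions of rectangles contained in [O]. *)
Lemma open_tonelli_le Z E O : rc Z -> rc E -> open O -> O `<=` Z `*` E ->
  \int[mu]_(t in Z) mu [set u | O (t, u)] <= \int[mu]_(u in E) mu [set t | O (t, u)].
Proof.
move=> rZ rE oO OZE; have mZ := rc_borel rZ; have mE := rc_borel rE.
have OE t : [set u | O (t, u)] `<=` E by move=> u Ou; have [] := OZE _ Ou.
have oOt t : open [set u | O (t, u)] by exact: open_fst_section.
have oO' := open_swap oO.
have finE A : measurable (A : set (borel G)) -> A `<=` E -> (fine (mu A))%:E = mu A.
  move=> mA AE; rewrite fineK// ge0_fin_numE//.
  by apply: le_lt_trans (rc_finite hausG rad rE); exact: borel_le.
have le_fin A B : measurable (A : set (borel G)) -> measurable (B : set (borel G)) ->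
    A `<=` B -> B `<=` E -> (fine (mu A) <= fine (mu B))%R.
  move=> mA mB AB BE; rewrite -lee_fin !finE//; first exact: borel_le.
  exact: subset_trans BE.
apply/lee_addgt0Pr => e e0.
pose D (l : seq (set G * set G)) := forall r, r \in l ->
  [/\ open r.1, open r.2, r.1 `<=` Z, r.2 `<=` E & r.1 `*` r.2 `<=` O].
have DO l : D l -> rectangles l `<=` O.
  by move=> Dl x [r /Dl[_ _ _ _ rO] rx]; exact: rO.
have Do l : D l -> open (rectangles l).
  by move=> Dl; apply: open_rectangles => r /Dl[].
have mR l t : D l -> measurable ([set u | rectangles l (t, u)] : set (borel G)).
  by move=> Dl; exact: (open_borel (open_fst_section t (Do _ Dl))).
have mO t : measurable ([set u | O (t, u)] : set (borel G)) by exact: open_borel.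
have [| | | | | |l Dl le] := @directed_lsc_integral _ _ _ hausG rad Z
    (seq (set G * set G)) D (fun l t => fine (mu [set u | rectangles l (t, u)]))
    (fun t => fine (mu [set u | O (t, u)])) (fine (mu E)) e rZ e0.
- by exists [::].
- move=> l l' Dl Dl'; exists (l ++ l').
    by move=> r; rewrite mem_cat => /orP[/Dl|/Dl'].
  have Dll' : D (l ++ l') by move=> r; rewrite mem_cat => /orP[/Dl|/Dl'].
  move=> t Zt; split; apply: le_fin; try exact: mR.
  + by move=> u [r rl ru]; exists r => //; rewrite mem_cat rl.
  + by move=> u /(DO _ Dll') /OZE[].
  + by move=> u [r rl ru]; exists r => //; rewrite mem_cat rl orbT.
  + by move=> u /(DO _ Dll') /OZE[].
- move=> l r Dl; rewrite (_ : _ `&` _ = Z `&` [set t | r%:E < mu [set u | rectangles l (t, u)]]).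
    by apply: openI; [exact: rc_open|apply: section_lsc; exact: Do].
  apply/seteqP; split=> t [Zt rt]; split=> //; move: rt => /=.
    rewrite -lte_fin finE//; first exact: mR.
    by move=> u /(DO _ Dl) /OZE[].
  rewrite -lte_fin finE//; first exact: mR.
  by move=> u /(DO _ Dl) /OZE[].
- move=> t Zt; by rewrite fine_ge0//= le_fin.
- move=> l t Dl Zt; rewrite fine_ge0//= le_fin//; first exact: mR.
  by move=> u /(DO _ Dl).
- move=> t r Zt; rewrite -lte_fin finE; [move=> rt|by []|exact: OE].
  have [| | | |_ [l Dl ->] rU] := @open_directed _ _ _ hausG rad
      (fun U => exists2 l, D l & U = [set u | rectangles l (t, u)]) _ r%:E _ _ _ (oOt t) _ rt.
  + by move=> U [l Dl ->]; exact: (open_fst_section t (Do _ Dl)).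
  + by exists [set u | rectangles [::] (t, u)]; exists [::].
  + move=> U V [l Dl ->] [l' Dl' ->]; exists [set u | rectangles (l ++ l') (t, u)].
      by exists (l ++ l') => // q; rewrite mem_cat => /orP[/Dl|/Dl'].
    by move=> u [[q ql qu]|[q ql qu]]; exists q => //; rewrite mem_cat ql ?orbT.
  + move=> u Otu; have : nbhs (t, u) O by apply: open_nbhs_nbhs.
    move=> [[/= A B] [nA nB] AB].
    pose q := ((A° `&` Z), (B° `&` E)).
    exists [set u | rectangles [:: q] (t, u)].
      exists [:: q] => // q'; rewrite inE => /eqP ->; split=> /=.
      * by apply: openI; [exact: open_interior|exact: rc_open].
      * by apply: openI; [exact: open_interior|exact: rc_open].
      * exact: subIsetr.
      * exact: subIsetr.
      * by move=> x [[/interior_subset Ax _] [/interior_subset Bx _]]; apply: AB.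
    exists q; first by rewrite inE.
    by have [] := OZE _ Otu; split; split.
  + exists l => //; rewrite -lte_fin finE//; first exact: mR.
    by move=> u /(DO _ Dl) /OZE[].
have -> : \int[mu]_(t in Z) mu [set u | O (t, u)] =
    \int[mu]_(t in Z) (fine (mu [set u | O (t, u)]))%:E.
  by apply: eq_integral => t _; rewrite finE.
apply: (le_trans le); rewrite leeD2r//.
have -> : \int[mu]_(t in Z) (fine (mu [set u | rectangles l (t, u)]))%:E =
    \int[mu]_(t in Z) mu [set u | rectangles l (t, u)].
  apply: eq_integral => t _; rewrite finE//; first exact: mR.
  by move=> u /(DO _ Dl) /OZE[].
rewrite (@rectangles_tonelli Z E)//; last by move=> r /Dl[].
have oR' := open_swap (Do _ Dl).
have mlsc O' : open O' -> measurable_fun (E : set (borel G)) (fun u => mu [set t | O' (u, t)]).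
  move=> oO1; apply: measurable_funTS => _ ; apply: (measurability _ (ErealGenOInfty.measurableE R)) => //.
  move=> /= _ [_ [r ->] <-]; rewrite setTI.
  apply: open_borel; rewrite (_ : _ @^-1` _ = [set u | r%:E < mu [set t | O' (u, t)]]).
    exact: section_lsc.
  by apply/seteqP; split=> u /=; rewrite in_itv/= andbT.
have mF := mlsc _ oR'; have mG := mlsc _ oO'.
have mRu := open_borel (open_fst_section _ oR').
have mOu := open_borel (open_fst_section _ oO').
apply: ge0_le_integral => // u Eu.
by apply: borel_le; [exact: (mRu u)|exact: (mOu u)|move=> t; exact: DO].
Qed.

(** The Fubini-Tonelli theorem itself does not apply, because [O] need not belong
    to the product of the Borel sigma-algebras. *)
Lemma open_tonelli Z E O : rc Z -> rc E -> open O ->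
  \int[mu]_(t in Z) mu (E `&` [set u | O (t, u)]) =
  \int[mu]_(u in E) mu (Z `&` [set t | O (t, u)]).
Proof.
move=> rZ rE oO; have oZ := rc_open rZ; have oE := rc_open rE.
pose O' := O `&` (Z `*` E).
have oO' : open O' by apply: openI => //; exact: open_setX.
have oO'' := open_swap oO'.
have -> : \int[mu]_(t in Z) mu (E `&` [set u | O (t, u)]) =
    \int[mu]_(t in Z) mu [set u | O' (t, u)].
  apply: eq_integral => t; rewrite inE => Zt; congr (mu _).
  by apply/seteqP; split=> u [? //= [? ?]].
have -> : \int[mu]_(u in E) mu (Z `&` [set t | O (t, u)]) =
    \int[mu]_(u in E) mu [set t | O' (t, u)].
  apply: eq_integral => u; rewrite inE => Eu; congr (mu _).
  by apply/seteqP; split=> t [? //= [? ?]].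
apply/eqP; rewrite eq_le; apply/andP; split.
  by apply: open_tonelli_le => // x [].
apply: (@open_tonelli_le E Z [set x | O' (x.2, x.1)]) => //.
by move=> x [_ []].
Qed.

End tonelli.

(** * The modular function *)

Section haar_theory.
Context {R : realType} {G : topologicalGroupType}.
Variables (mu : {measure set (borel G) -> \bar R}) (Delta : G -> R).
Hypotheses (hausG : hausdorff_space G) (lcG : locally_compact [set: G]).
Hypotheses (haar : left_haar mu) (modular : modular_function mu Delta).
Implicit Types (s t u : G) (A U V W K E Z : set G) (O : set (G * G)).

Let rad : radon mu. Proof. by case: haar. Qed.

Local Open Scope ereal_scope.

Lemma mu_mulgl s (A : set (borel G)) : measurable A -> mu [set t | A (s * t)%g] = mu A.
Proof.
move=> mA; have [_ _ inv] := haar; rewrite -(inv s^-1%g A mA); congr (mu _).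
apply/seteqP; split=> [t /= At|_ [t At <-]] /=.
  by exists (s * t)%g => //; rewrite mulgA mulVg mul1g.
by rewrite mulgA mulgV mul1g.
Qed.

Lemma Delta_gt0 s : (0 < Delta s)%R. Proof. by case: (modular s). Qed.

Lemma Delta_ge0 s : (0 <= Delta s)%R. Proof. exact/ltW/Delta_gt0. Qed.

Lemma measurable_mulgr s (A : set (borel G)) : measurable A ->
  measurable ([set t | A (t * s)%g] : set (borel G)).
Proof.
move=> mA; rewrite -[X in measurable X]setTI.
by apply: (continuous_borel_measurable (@mulgr_continuous G s)).
Qed.

Lemma measurable_mulgl s (A : set (borel G)) : measurable A ->
  measurable ([set t | A (s * t)%g] : set (borel G)).
Proof.
move=> mA; rewrite -[X in measurable X]setTI.
by apply: (continuous_borel_measurable (@mulgl_continuous G s)).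
Qed.

Lemma measurable_invg (A : set (borel G)) : measurable A ->
  measurable ([set t | A (t^-1)%g] : set (borel G)).
Proof.
move=> mA; rewrite -[X in measurable X]setTI.
by apply: (continuous_borel_measurable (@invg_continuous G)).
Qed.

Lemma mu_mulgr s (A : set (borel G)) : measurable A ->
  mu [set t | A (t * s)%g] = (Delta s)^-1%:E * mu A.
Proof.
move=> mA; have [_ /(_ (EFin \o \1_A))] := modular s.
have mI : measurable_fun setT (EFin \o \1_A : borel G -> \bar R).
  by apply/measurable_EFinP; exact: measurable_indic.
move=> /(_ mI) H.
have := H _; rewrite (_ : (fun t => (EFin \o \1_A) (t * s)%g) = EFin \o \1_([set t | A (t * s)%g]))//.
rewrite !integral_indic ?setIT//; last exact: measurable_mulgr.
by apply => t; rewrite lee_fin.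
Qed.

(** If [W] were null, then so would be finite unions of its translates, which
    form a directed cover of [G]. *)
Lemma open_gt0 W : open W -> W !=set0 -> 0 < mu W.
Proof.
move=> oW [w Ww]; rewrite lt0e measure_ge0 andbT; apply/negP => /eqP W0.
have [_ T0 _] := haar.
have [| | | |t _|//|U [oU U0]] := @open_directed _ _ _ hausG rad
   (fun U => open U /\ mu U = 0) setT 0.
- by move=> U [].
- by exists set0; split; [exact: open0|exact: measure0].
- move=> U V [oU U0] [oV V0]; exists (U `|` V) => //; split; first exact: openU.
  have mU := open_borel oU; have mV := open_borel oV.
  apply/eqP; rewrite eq_le measure_ge0 andbT -(adde0 0) -[X in X + _]U0 -V0.
  exact: measureU2.
- exact: openT.
- exists [set u | W (w * t^-1 * u)%g]; last by rewrite /= mulgVK.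
  split; first exact: open_mulgl.
  by rewrite mu_mulgl//; exact: open_borel.
- by rewrite lt0e T0 measure_ge0.
- by rewrite U0 ltxx.
Qed.

Lemma rc_unit : exists2 W : set G, rc W & W 1%g.
Proof. by have [W rW [W1 _]] := @rc_nbhs _ lcG 1%g setT filterT; exists W. Qed.

Lemma DeltaM s t : Delta (s * t)%g = (Delta s * Delta t)%R.
Proof.
have [W rW W1] := rc_unit; have mW := rc_borel rW.
have W0 : 0 < mu W by apply: open_gt0; [exact: rc_open|exists 1%g].
have Woo := rc_finite hausG rad rW.
have := mu_mulgr (s * t)%g mW.
have -> : [set u | W (u * (s * t))%g] = [set u | [set v | W (v * t)%g] (u * s)%g].
  by apply/seteqP; split=> u /=; rewrite mulgA.
rewrite mu_mulgr; last exact: measurable_mulgr.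
rewrite mu_mulgr// muleA -EFinM => /eqP.
rewrite -[mu W]fineK ?ge0_fin_numE// -!EFinM eqe => /eqP.
have W0' : fine (mu W) != 0%R by rewrite gt_eqF// fine_gt0// W0.
by move=> /(mulIf W0') /(congr1 (@GRing.inv R)); rewrite invrK invfM !invrK.
Qed.

Lemma Delta1 : Delta 1%g = 1%R.
Proof.
by apply: (mulfI (lt0r_neq0 (Delta_gt0 1%g))); rewrite -DeltaM mulg1 mulr1.
Qed.

Lemma DeltaV s : Delta (s^-1)%g = (Delta s)^-1%R.
Proof.
have /eqP := DeltaM (s^-1)%g s; rewrite mulVg Delta1 => /eqP H.
by apply: (mulIf (lt0r_neq0 (Delta_gt0 s))); rewrite -H mulVf// gt_eqF// Delta_gt0.
Qed.

(** A compact subset of [W] that nearly fills [W] stays in [W] under small right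
    translations, hence [mu (W s)] is not much smaller than [mu W]. *)
Lemma Delta_near1 (e : R) : (0 < e)%R -> \forall s \near (1%g : G), (1 - e < Delta s)%R.
Proof.
move=> e0; have [W rW W1] := rc_unit; have mW := rc_borel rW.
have W0 : 0 < mu W by apply: open_gt0; [exact: rc_open|exists 1%g].
have Woo := rc_finite hausG rad rW.
have Wfin : mu W \is a fin_num by rewrite ge0_fin_numE.
have W0' : (0 < fine (mu W))%R by rewrite fine_gt0// W0.
pose y := ((1 - e) * fine (mu W))%R.
have yW : y%:E < mu W.
  by rewrite -[ltRHS]fineK// lte_fin /y gtr_pMl// ltrBlDr ltrDl.
have [_ _ inner] := rad; move: (yW); rewrite inner; last exact: rc_open.
move=> /ereal_sup_gt[_ [K [cK KW] <-] yK].
have mK := compact_borel hausG cK.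
have cf : continuous (fun x : G * G => (x.1 * x.2^-1)%g : G).
  apply: continuous_mulg; first exact: continuous_fst.
  by apply: continuous_invg; exact: continuous_snd.
have f1 t : (t * 1^-1)%g = t by rewrite invg1 mulg1.
have := compact_near1 cf f1 cK (rc_open rW) KW.
apply: filterS => s KsW.
have Ks : K `<=` [set t | W (t * s^-1)%g] by move=> t Kt; exact: KsW.
have : y%:E < mu [set t | W (t * s^-1)%g].
  apply: lt_le_trans yK _; apply: borel_le => //; exact: measurable_mulgr.
rewrite mu_mulgr// DeltaV invrK -[mu W]fineK// -EFinM lte_fin /y.
by rewrite ltr_pM2r.
Qed.

(** [Delta_near1] at [s^-1] bounds [Delta s] from above, and multiplicativity
    transfers the continuity at the unit to the other points. *)
Lemma Delta_continuous : continuous (Delta : G -> R).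
Proof.
have c1 : Delta s @[s --> (1%g : G)] --> (1%R : R).
  apply/cvgrPdist_lt => e e0.
  have e2 : (0 < e / (1 + e))%R by rewrite divr_gt0// addr_gt0.
  have N2 : \forall s \near (1%g : G), (1 - e / (1 + e) < Delta s^-1%g)%R.
    have : (s^-1)%g @[s --> (1%g : G)] --> (1%g : G).
      by rewrite -[X in _ --> X]invg1; exact: invg_continuous.
    by move=> cV; exact: (cV _ (Delta_near1 e2)).
  near=> s.
  have h1 : (1 - e < Delta s)%R by near: s; exact: Delta_near1.
  have h2 : (1 - e / (1 + e) < Delta s^-1%g)%R by near: s.
  have {h2} : (Delta s < 1 + e)%R.
    move: h2; rewrite DeltaV (_ : 1 - e / (1 + e) = (1 + e)^-1)%R; last first.
      by field; rewrite gt_eqF// addr_gt0.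
    by rewrite ltf_pV2 ?posrE ?addr_gt0// Delta_gt0.
  move=> h2; rewrite distrC ltr_distl; apply/andP; split=> //.
move=> s0.
have e : Delta = (fun t => Delta s0 * Delta (s0^-1 * t)%g)%R.
  by apply/funext => t; rewrite -DeltaM mulgA mulgV mul1g.
have h : (fun t => Delta s0 * Delta (s0^-1 * t)%g)%R @ s0 --> Delta s0.
  rewrite -[X in _ --> X]mulr1; apply: cvgMr.
  apply: (@cvg_comp _ _ _ (fun t => (s0^-1 * t)%g : G) Delta); last exact: c1.
  by have := @mulgl_continuous G (s0^-1)%g s0; rewrite /continuous_at mulVg.
by rewrite -e in h.
Unshelve. all: by end_near. Qed.

Lemma continuous_borel_measurable_fun (f : G -> R) : continuous f ->
  measurable_fun setT (f : borel G -> R).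
Proof.
move=> cf; apply: superlevel_measurable => r; rewrite setTI.
apply: open_borel; apply: (@open_comp _ _ f [set x | (r < x)%R]).
  by move=> t _; exact: cf.
exact: open_gt.
Qed.

Lemma measurable_Delta : measurable_fun setT (Delta : borel G -> R).
Proof. by apply: continuous_borel_measurable_fun; exact: Delta_continuous. Qed.

Lemma measurable_DeltaV : measurable_fun setT ((fun t => (Delta t)^-1%R) : borel G -> R).
Proof.
apply: continuous_borel_measurable_fun => t; apply: cvgV; last exact: Delta_continuous.
by rewrite gt_eqF// Delta_gt0.
Qed.

End haar_theory.

(** * Inversion *)

Section transfer.
Import HBNNSimple.

(** The level sets of the simple functions below an integrable function have
    finite measure, even when the measure is not sigma-finite. *)
Lemma ge0_integral_transfer d1 (T1 : measurableType d1) d2 (T2 : measurableType d2)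
    (R : realType) (mu1 : {measure set T1 -> \bar R}) (mu2 : {measure set T2 -> \bar R})
    (phi : T2 -> T1) (w : T2 -> R) :
  measurable_fun setT phi -> measurable_fun setT w -> (forall t, 0 <= w t) ->
  (forall A, measurable A -> (mu1 A < +oo)%E ->
    (\int[mu2]_t (w t * \1_A (phi t))%:E = mu1 A)%E) ->
  forall h : T1 -> \bar R, measurable_fun setT h -> (forall t, (0 <= h t)%E) ->
  (\int[mu1]_t h t < +oo)%E ->
  (\int[mu2]_t ((w t)%:E * h (phi t)) = \int[mu1]_t h t)%E.
Proof.
move=> mphi mw w0 H h mh h0 hoo.
pose g := nnsfun_approx measurableT mh.
have gh n t : ((g n t)%:E <= h t)%E by rewrite /g nnsfun_approxE; exact: le_approx.
have g_cvg t : (g n t)%:E @[n --> \oo] --> h t by exact: cvg_nnsfun_approx.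
have g_nd t m n : (m <= n)%N -> g m t <= g n t.
  by move=> mn; exact/lefP/nd_nnsfun_approx.
have int_g n : (\int[mu2]_t ((w t)%:E * (g n (phi t))%:E) = \int[mu1]_t (g n t)%:E)%E.
  have gE t : (g n t)%:E = (\sum_(y \in range (g n)) (y * \1_(g n @^-1` [set y]) t)%:E)%E.
    by rewrite [in LHS](fimfunE (g n)) -fsumEFin.
  have mgy y : measurable (g n @^-1` [set y]) by [].
  have gy0 y t : 0 <= y * \1_(g n @^-1` [set y]) t.
    rewrite indicE; have [|_] := boolP (t \in _); last by rewrite mulr0.
    by rewrite inE/= => <-; rewrite mulr1.
  under [RHS]eq_integral do rewrite gE.
  have wE t : ((w t)%:E * (g n (phi t))%:E =
      \sum_(y \in range (g n)) (w t * (y * \1_(g n @^-1` [set y]) (phi t)))%:E)%E.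
    by rewrite gE ge0_mule_fsumr// => y; rewrite lee_fin.
  under [LHS]eq_integral do rewrite wE.
  rewrite !ge0_integral_fsum//; last 4 first.
  - by move=> y; apply/measurable_EFinP/measurable_funM.
  - by move=> y t _; rewrite lee_fin.
  - move=> y; apply/measurable_EFinP/measurable_funM => //.
    apply: measurable_funM => //.
    by apply: (@measurableT_comp _ _ _ _ _ _ (\1_(g n @^-1` [set y]) : T1 -> R)).
  - by move=> y t _; rewrite lee_fin mulr_ge0.
  apply: eq_fsbigr => y; rewrite inE => -[t0 _ yE].
  have y0 : 0 <= y by rewrite -yE.
  under eq_integral do rewrite mulrCA EFinM.
  rewrite ge0_integralZl//; last 2 first.
  - apply/measurable_EFinP/measurable_funM => //.
    by apply: (@measurableT_comp _ _ _ _ _ _ (\1_(g n @^-1` [set y]) : T1 -> R)).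
  - by move=> t _; rewrite lee_fin mulr_ge0.
  under [RHS]eq_integral do rewrite EFinM.
  rewrite [RHS]ge0_integralZl//; last exact/measurable_EFinP.
  rewrite integral_indic// setIT.
  have [->|yn0] := eqVneq y 0; first by rewrite !mul0e.
  rewrite H//.
  have yp : 0 < y by rewrite lt_neqAle eq_sym yn0.
  have : (y%:E * mu1 (g n @^-1` [set y]) < +oo)%E.
    apply: le_lt_trans hoo.
    rewrite -[X in mu1 X]setIT -integral_indic// -ge0_integralZl//; last exact/measurable_EFinP.
    apply: ge0_le_integral => //.
    - by move=> t _; rewrite -EFinM lee_fin.
    - by apply/measurable_EFinP/measurable_funM.
    - move=> t _; apply: le_trans (gh n t); rewrite -EFinM lee_fin indicE.
      have [|_] := boolP (t \in _); last by rewrite mulr0.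
      by rewrite inE/= => <-; rewrite mulr1.
  by apply: contraTT; rewrite -leNgt leye_eq => /eqP ->; rewrite gt0_muley ?lte_fin// -leNgt.
transitivity (limn (fun n => \int[mu2]_t ((w t)%:E * (g n (phi t))%:E))%E).
  rewrite -monotone_convergence//; last 3 first.
  - move=> n; apply: emeasurable_funM; first exact/measurable_EFinP.
    by apply/measurable_EFinP; exact: measurableT_comp.
  - by move=> n t _; rewrite -EFinM lee_fin mulr_ge0.
  - by move=> t _ m n mn; rewrite -!EFinM lee_fin ler_wpM2l// g_nd.
  apply: eq_integral => t _; apply/esym/cvg_lim => //.
  by apply: cvgeZl => //; exact: g_cvg.
rewrite (_ : (fun n => _) = (fun n => \int[mu1]_t (g n t)%:E)%E); last exact/funext.
rewrite -monotone_convergence//; last 3 first.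
- by move=> n; exact/measurable_EFinP.
- by move=> n t _; rewrite lee_fin.
- by move=> t _ m n mn; rewrite lee_fin g_nd.
by apply: eq_integral => t _; apply/cvg_lim => //; exact: g_cvg.
Qed.

End transfer.

Section inversion.
Context {R : realType} {G : topologicalGroupType}.
Variables (mu : {measure set (borel G) -> \bar R}) (Delta : G -> R).
Hypotheses (hausG : hausdorff_space G) (lcG : locally_compact [set: G]).
Hypotheses (haar : left_haar mu) (modular : modular_function mu Delta).
Implicit Types (s t u : G) (A U V W K E Z : set G) (O : set (G * G)).

Let rad : radon mu. Proof. by case: haar. Qed.

Local Open Scope ereal_scope.

Lemma rc_mulV V W : rc V -> rc W ->
  exists2 Y, rc Y & forall v w, V v -> W w -> Y (w * v^-1)%g.
Proof.
move=> [oV [K cK VK]] [oW [L cL WL]].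
pose f := fun x : G * G => (x.2 * x.1^-1)%g.
have cf : continuous f.
  apply: continuous_mulg; first exact: continuous_snd.
  by apply: continuous_invg; exact: continuous_fst.
have cI : compact (f @` (K `*` L)).
  by apply: continuous_compact; [exact: continuous_subspaceT|exact: compact_setX].
have [Y rY [IY _]] := @rc_between _ lcG _ setT cI openT (@subsetT _ _).
by exists Y => // v w /VK Kv /WL Lw; apply: IY; exists (v, w).
Qed.

Lemma measurable_EFin_DeltaV D : measurable_fun (D : set (borel G)) (fun v => (Delta v)^-1%:E).
Proof. by apply/measurable_EFinP/measurable_funTS; exact: (measurable_DeltaV hausG lcG haar modular). Qed.

(** Both sides, multiplied by [mu W], equal the iterated integral of the measure
    of [{t | t^-1 s \in V}] over [s] in [W]. *)
Lemma rc_mu_invg V : rc V -> mu [set t | V (t^-1)%g] = \int[mu]_(v in V) (Delta v)^-1%:E.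
Proof.
move=> rV; have [W rW W1] := rc_unit lcG.
have mV := rc_borel rV; have mW := rc_borel rW.
have W0 : 0 < mu W by apply: (open_gt0 hausG haar); [exact: rc_open|exists 1%g].
have Woo := rc_finite hausG rad rW.
have [Y rY VWY] := rc_mulV rV rW.
have oV := rc_open rV; have oW := rc_open rW.
have cont2 (f : G * G -> G) : continuous f -> forall U, open U -> open (f @^-1` U).
  by move=> cf U; apply: open_comp => x _; exact: cf.
have cf := @continuous_mulVg G.
have T1 := open_tonelli hausG rad rW rY (cont2 _ cf _ oV).
have T2 := open_tonelli hausG rad rY rV (cont2 _ (@mulg_continuous G) _ oW).
have {}T1 : mu [set t | V (t^-1)%g] * mu W =
    \int[mu]_(t in Y) mu (W `&` [set s | V (t^-1 * s)%g]).
  rewrite -[RHS]T1.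
  rewrite -integral_cst//; apply: eq_integral => s; rewrite inE => Ws.
  rewrite -(mu_mulgl haar s^-1%g); last exact: measurable_invg.
  congr (mu _); apply/seteqP; split=> t /=; rewrite invgM invgK.
    by move=> Vt; split=> //; have := VWY _ _ Vt Ws; rewrite invgM invgK mulVKg.
  by case.
have {}T2 : \int[mu]_(t in Y) mu (W `&` [set s | V (t^-1 * s)%g]) =
    mu W * \int[mu]_(v in V) (Delta v)^-1%:E.
  rewrite (_ : mu W * _ = \int[mu]_(v in V) mu (Y `&` [set t | W (t * v)%g])); last first.
    rewrite -ge0_integralZl//; last 2 first.
    - exact: measurable_EFin_DeltaV.
    - by move=> v _; rewrite lee_fin invr_ge0; exact: (Delta_ge0 modular).
    apply: eq_integral => v; rewrite inE => Vv.
    rewrite muleC -(mu_mulgr modular v)//; congr (mu _); apply/seteqP; split=> t //=.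
      by move=> Wt; split=> //; have := VWY _ _ Vv Wt; rewrite mulgK.
    by case.
  rewrite -[RHS]T2; apply: eq_integral => t _.
  rewrite -(mu_mulgl haar t); last first.
    by apply: measurableI => //; exact: measurable_mulgl.
  by congr (mu _); apply/seteqP; split=> s /= []; rewrite mulKg.
have w0 : (fine (mu W) != 0)%R by rewrite gt_eqF// fine_gt0// W0.
have cancel x : (fine (mu W))^-1%:E * (mu W * x) = x.
  by rewrite -[mu W]fineK ?ge0_fin_numE// muleA -EFinM mulVf// mul1e.
by rewrite -[LHS]cancel [mu W * _]muleC T1 T2 cancel.
Qed.

Lemma ge0_DeltaV v : 0 <= (Delta v)^-1%:E.
Proof. by rewrite lee_fin invr_ge0; exact: (Delta_ge0 modular). Qed.

Lemma integral_DeltaV_le (A B : set (borel G)) : measurable A -> measurable B -> A `<=` B ->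
  \int[mu]_(v in A) (Delta v)^-1%:E <= \int[mu]_(v in B) (Delta v)^-1%:E.
Proof.
move=> mA mB AB; apply: ge0_subset_integral => //; first exact: measurable_EFin_DeltaV.
by move=> v _; exact: ge0_DeltaV.
Qed.

Lemma integral_DeltaV_bound (A : set (borel G)) (c : R) : measurable A ->
  (forall v, A v -> ((Delta v)^-1 <= c)%R) ->
  \int[mu]_(v in A) (Delta v)^-1%:E <= c%:E * mu A.
Proof.
move=> mA Ac; rewrite -integral_cst//; apply: ge0_le_integral => //.
- by move=> v _; exact: ge0_DeltaV.
- exact: measurable_EFin_DeltaV.
Qed.

Lemma open_mu_invg_le V : open V ->
  mu [set t | V (t^-1)%g] <= \int[mu]_(v in V) (Delta v)^-1%:E.
Proof.
move=> oV; rewrite leNgt; apply/negP => lt.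
have [W' [rW' W'V] ltW] := rc_exhaust hausG lcG rad (open_invg oV) lt.
move: ltW; apply/negP; rewrite -leNgt.
have -> : W' = [set t | [set u | W' (u^-1)%g] (t^-1)%g].
  by apply/seteqP; split=> t /=; rewrite invgK.
rewrite rc_mu_invg; last exact: rc_invg.
apply: integral_DeltaV_le; [exact: (rc_borel (rc_invg rW'))|exact: open_borel|].
by move=> t /W'V /=; rewrite invgK.
Qed.

Lemma borel_leU (A B C : set (borel G)) : measurable A -> measurable B -> measurable C ->
  C `<=` A `|` B -> mu C <= mu A + mu B.
Proof.
move=> mA mB mC CAB; apply: le_trans (measureU2 mu mA mB).
by apply: borel_le => //; exact: measurableU.
Qed.

Lemma open_DeltaV_lt (c : R) : open [set v : G | ((Delta v)^-1 < c)%R].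
Proof.
apply: (@open_comp _ _ (fun v => (Delta v)^-1%R) [set x | (x < c)%R]).
  move=> v _; apply: cvgV; last exact: (Delta_continuous hausG lcG haar modular).
  by rewrite gt_eqF// (Delta_gt0 modular).
exact: open_lt.
Qed.

(** Where [Delta^-1 < c], the right-hand side is at most [c * mu], so that small
    sets for [mu] are small for both sides and the formula passes from relatively
    compact open sets to Borel sets by regularity. *)
Lemma mu_invg_small (A : set (borel G)) (c : R) : measurable A -> mu A < +oo ->
  (forall v, A v -> ((Delta v)^-1 < c)%R) ->
  mu [set t | A (t^-1)%g] = \int[mu]_(v in A) (Delta v)^-1%:E.
Proof.
move=> mA Aoo Ac.
pose Om : set G := [set v | ((Delta v)^-1 < c)%R].
have oOm : open Om by exact: open_DeltaV_lt.
have [c0|c0] := leP c 0%R.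
  have -> : A = set0.
    apply/seteqP; split=> // v /Ac; rewrite ltNge (le_trans c0)// invr_ge0.
    exact: (Delta_ge0 modular).
  by rewrite integral_set0 (_ : [set t | _] = set0) ?measure0.
have cover (e : R) : (0 < e)%R -> exists2 V, [/\ open V, A `<=` V & V `<=` Om] &
    mu (V `\` A) < e%:E.
  move=> e0; have [V [oV AV] Ve] := outer_approx rad mA Aoo e0.
  exists (V `&` Om); first split => //; first exact: openI.
    by move=> v Av; split; [exact: AV|exact: Ac].
  apply: le_lt_trans Ve; apply: borel_le.
  - by apply: measurableD => //; apply: open_borel; exact: openI.
  - by apply: measurableD => //; exact: open_borel.
  - by move=> v [[]].
have fin_D V (e : R) : open V -> mu (V `\` A) < e%:E -> A `<=` V -> mu V < +oo.
  move=> oV Ve AV; have mV := open_borel oV.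
  have mD : measurable (V `\` A : set (borel G)) by exact: measurableD.
  apply: le_lt_trans (borel_leU mA mD mV _) _; first by rewrite setDUK.
  by rewrite lte_add_pinfty// (lt_trans Ve)// ltry.
have mAi := measurable_invg mA.
apply/eqP; rewrite eq_le; apply/andP; split; apply/lee_addgt0Pr => e e0.
  have [|V [oV AV VOm] Ve] := cover (e / c)%R; first exact: divr_gt0.
  have mV := open_borel oV; have mD : measurable (V `\` A : set (borel G)) by exact: measurableD.
  apply: (@le_trans _ _ (\int[mu]_(v in V) (Delta v)^-1%:E)).
    apply: le_trans (open_mu_invg_le oV); apply: borel_le => //.
      exact: (open_borel (open_invg oV)).
    by move=> t; exact: AV.
  rewrite -{1}(setDUK AV) ge0_integral_setU//; last 3 first.
  - exact: measurable_EFin_DeltaV.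
  - by move=> v _; exact: ge0_DeltaV.
  - by rewrite disj_set2E setDIK.
  rewrite leeD2l//; apply: (@le_trans _ _ (c%:E * mu (V `\` A))).
    by apply: integral_DeltaV_bound => // v [/VOm Vc _]; exact: ltW.
  by rewrite -lee_pdivlMl// -EFinM mulrC ltW.
have ec0 : (0 < e / 4 / c)%R by rewrite !divr_gt0.
have [V [oV AV VOm] Ve] := cover _ ec0.
have mV := open_borel oV; have mD : measurable (V `\` A : set (borel G)) by exact: measurableD.
have Voo := fin_D _ _ oV Ve AV.
have [W [rW WV] We] := rc_approx hausG lcG rad oV Voo ec0.
have mW := rc_borel rW.
have mVW : measurable (V `\` W : set (borel G)) by exact: measurableD.
have [V' [oV' DV'] V'e] := outer_approx rad mD (lt_trans Ve (ltry _)) ec0.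
have V'2 : mu (V' `&` Om) <= (e / 4 / c + e / 4 / c)%:E.
  apply: (@le_trans _ _ (mu V')).
    by apply: borel_le => //; apply: open_borel => //; exact: openI.
  have mV' := open_borel oV'.
  have mD' : measurable (V' `\` (V `\` A) : set (borel G)) by exact: measurableD.
  apply: le_trans (borel_leU mD mD' mV' _) _; first by rewrite setDUK.
  by rewrite EFinD leeD// ltW.
apply: (@le_trans _ _ (\int[mu]_(v in V) (Delta v)^-1%:E)); first exact: integral_DeltaV_le.
rewrite -{1}(setDUK WV) ge0_integral_setU//; last 3 first.
- exact: measurable_EFin_DeltaV.
- by move=> v _; exact: ge0_DeltaV.
- by rewrite disj_set2E setDIK.
rewrite -rc_mu_invg//.
have H1 : \int[mu]_(v in V `\` W) (Delta v)^-1%:E <= (e / 4)%:E.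
  apply: (@le_trans _ _ (c%:E * mu (V `\` W))).
    by apply: integral_DeltaV_bound => // v [/VOm Vc _]; exact: ltW.
  by rewrite -lee_pdivlMl// -EFinM mulrC ltW.
have oV'Om : open (V' `&` Om) by exact: openI.
have H2 : mu [set t | (V' `&` Om) (t^-1)%g] <= (e / 2)%:E.
  apply: le_trans (open_mu_invg_le oV'Om) _.
  apply: (@le_trans _ _ (c%:E * mu (V' `&` Om))).
    apply: integral_DeltaV_bound => [|v [_ Vc]]; last exact: ltW.
    exact: open_borel.
  rewrite -lee_pdivlMl// -EFinM (le_trans V'2)// lee_fin.
  by rewrite le_eqVlt; apply/orP; left; apply/eqP; field; rewrite gt_eqF.
have H3 : mu [set t | W (t^-1)%g] <= mu [set t | A (t^-1)%g] + (e / 2)%:E.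
  have mVOi := open_borel (open_invg oV'Om); have mWi := rc_borel (rc_invg rW).
  apply: le_trans (borel_leU mAi mVOi mWi _) _; last by rewrite leeD2l.
  move=> t /WV Vt; have [At|nAt] := pselect (A (t^-1)%g); first by left.
  by right; split; [apply: DV'|exact: VOm].
apply: (@le_trans _ _ (mu [set t | A (t^-1)%g] + (e / 2)%:E + (e / 4)%:E)).
  exact: leeD.
rewrite -addeA leeD2l// -EFinD lee_fin; lra.
Qed.

Lemma DeltaV_exhaust (A : set (borel G)) : measurable A ->
  exists F : nat -> set (borel G), [/\ forall n, measurable (F n), nondecreasing_seq F,
    \bigcup_n F n = A & forall n v, F n v -> ((Delta v)^-1 < n%:R)%R].
Proof.
move=> mA; exists (fun n => A `&` [set v | ((Delta v)^-1 < n%:R)%R]); split.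
- by move=> n; apply: measurableI => //; apply: open_borel; exact: open_DeltaV_lt.
- move=> m n mn; apply/subsetPset => v [Av vm]; split=> //.
  by apply: lt_le_trans vm _; rewrite ler_nat.
- apply/seteqP; split=> [v [n _ []]//|v Av].
  by exists (Num.truncn (Delta v)^-1).+1 => //; split=> //=; exact: truncnS_gt.
- by move=> n v [].
Qed.

(** [A] is exhausted by the sets on which [Delta^-1] is bounded. *)
Lemma mu_invg (A : set (borel G)) : measurable A -> mu A < +oo ->
  mu [set t | A (t^-1)%g] = \int[mu]_(v in A) (Delta v)^-1%:E.
Proof.
move=> mA Aoo.
have [F [mF ndF FA Fn]] := DeltaV_exhaust mA.
have FsubA n : F n `<=` A by rewrite -FA; exact: bigcup_sup.
have FE n : mu [set t | F n (t^-1)%g] = \int[mu]_(v in F n) (Delta v)^-1%:E.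
  apply: (@mu_invg_small _ n%:R) => //; last exact: Fn.
  by apply: le_lt_trans Aoo; apply: borel_le.
have c1 : mu [set t | F n (t^-1)%g] @[n --> \oo] --> mu [set t | A (t^-1)%g].
  have -> : [set t | A (t^-1)%g] = \bigcup_n [set t | F n (t^-1)%g].
    by rewrite -{1}FA; apply/seteqP; split=> t [n _ h]; exists n.
  apply: (@nondecreasing_cvg_mu _ _ _ mu (fun n => [set t | F n (t^-1)%g])).
  - by move=> n; exact: measurable_invg.
  - by apply: bigcup_measurable => n _; exact: measurable_invg.
  - by move=> m n mn; apply/subsetPset => t; exact: (subsetPset _ _ (ndF _ _ mn)).
have c2 : \int[mu]_(v in F n) (Delta v)^-1%:E @[n --> \oo] -->
    \int[mu]_(v in A) (Delta v)^-1%:E.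
  rewrite -[in X in _ --> X]FA; apply: ge0_nondecreasing_set_cvg_integral => //.
  - by move=> n; exact: measurable_EFin_DeltaV.
  - by move=> n v _; exact: ge0_DeltaV.
move: c1; under eq_fun do rewrite FE; move=> c1.
exact: cvg_unique c1 c2.
Qed.

Lemma null_invg (A : set (borel G)) : measurable A -> mu A = 0 ->
  mu [set t | A (t^-1)%g] = 0.
Proof. by move=> mA A0; rewrite mu_invg ?A0// null_set_integral//; exact: measurable_EFin_DeltaV. Qed.

Lemma integral_invg_set (A : set (borel G)) : measurable A -> mu A < +oo ->
  \int[mu]_(t in [set t | A (t^-1)%g]) (Delta t)^-1%:E = mu A.
Proof.
move=> mA Aoo.
have [F [mF ndF FA Fn]] := DeltaV_exhaust mA.
have mFi n : measurable ([set t | F n (t^-1)%g] : set (borel G)) by exact: measurable_invg.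
have FsubA n : F n `<=` A by rewrite -FA; exact: bigcup_sup.
have Foo n : mu (F n) < +oo by apply: le_lt_trans Aoo; apply: borel_le.
have FE n : mu (F n) = \int[mu]_(t in [set t | F n (t^-1)%g]) (Delta t)^-1%:E.
  rewrite -mu_invg//; last first.
    rewrite (@mu_invg_small _ n%:R)//; last exact: Fn.
    apply: le_lt_trans (integral_DeltaV_bound (mF n) (fun v Fv => ltW (Fn n v Fv))) _.
    by rewrite lte_mul_pinfty// lee_fin.
  by congr (mu _); apply/seteqP; split=> t /=; rewrite invgK.
have c1 : mu (F n) @[n --> \oo] --> mu A.
  by rewrite -[in X in _ --> X]FA; apply: nondecreasing_cvg_mu => //; exact: bigcup_measurable.
have c2 : \int[mu]_(t in [set t | F n (t^-1)%g]) (Delta t)^-1%:E @[n --> \oo] -->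
    \int[mu]_(t in [set t | A (t^-1)%g]) (Delta t)^-1%:E.
  have -> : [set t | A (t^-1)%g] = \bigcup_n [set t | F n (t^-1)%g].
    by rewrite -{1}FA; apply/seteqP; split=> t [n _ h]; exists n.
  apply: (@ge0_nondecreasing_set_cvg_integral _ _ _
    (fun n => [set t : borel G | F n (t^-1)%g]) (fun t => (Delta t)^-1%:E) mu) => //.
  - by move=> m n mn; apply/subsetPset => t; exact: (subsetPset _ _ (ndF _ _ mn)).
  - by move=> n; exact: measurable_EFin_DeltaV.
  - by move=> n v _; exact: ge0_DeltaV.
move: c1; under eq_fun do rewrite FE; move=> c1.
exact: cvg_unique c2 c1.
Qed.

Lemma integral_invg (h : borel G -> \bar R) : measurable_fun setT h ->
  (forall t, 0 <= h t) -> \int[mu]_t h t < +oo ->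
  \int[mu]_t ((Delta t)^-1%:E * h (t^-1)%g) = \int[mu]_t h t.
Proof.
move=> mh h0 hoo.
apply: (@ge0_integral_transfer _ _ _ _ R mu mu (fun t : borel G => (t^-1)%g : borel G)
  (fun t => (Delta t)^-1%R)) => //.
- by apply: continuous_borel_measurable; exact: invg_continuous.
- exact: (measurable_DeltaV hausG lcG haar modular).
- by move=> t; have := ge0_DeltaV t.
move=> A mA Aoo; rewrite -[RHS]integral_invg_set// [RHS]integral_mkcond.
apply: eq_integral => t _; rewrite patchE indicE.
have [At|nAt] := pselect (A (t^-1)%g).
  by rewrite !mem_set ?mulr1.
by rewrite !memNset ?mulr0.
Qed.

End inversion.

(** * Complex functions and their classes in L^p *)

Import ComplexField.
Notation normc := Normc.normc.

Section complex_facts.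
Context {R : realType}.
Implicit Types x y z c : R[i].

(** Integrals of [rprod] are the real parts of the complex pairings; they keep
    all the integrals real-valued. *)
Definition rprod x y : R := complex.Re (x * y).

Lemma rprodE x y :
  rprod x y = complex.Re x * complex.Re y - complex.Im x * complex.Im y.
Proof. by case: x => a b; case: y. Qed.

Lemma rprodDl x y z : rprod (x + y) z = rprod x z + rprod y z.
Proof. by rewrite !rprodE; case: x => a b; case: y => c d; case: z => e f /=; ring. Qed.

Lemma rprodDr x y z : rprod x (y + z) = rprod x y + rprod x z.
Proof. by rewrite !rprodE; case: x => a b; case: y => c d; case: z => e f /=; ring. Qed.

Lemma rprodZ c x y : rprod (c * x) y = rprod x (c * y).
Proof. by rewrite /rprod [c * x]mulrC mulrA. Qed.

Lemma normc_ge0 x : 0 <= normc x. Proof. by case: x => a b; exact: sqrtr_ge0. Qed.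

Lemma Re_le_normc x : `|complex.Re x| <= normc x.
Proof.
case: x => a b /=; rewrite -sqrtr_sqr ler_wsqrtr// lerDl sqr_ge0//.
Qed.

Lemma Im_le_normc x : `|complex.Im x| <= normc x.
Proof. by case: x => a b /=; rewrite -sqrtr_sqr ler_wsqrtr// lerDr sqr_ge0. Qed.

Lemma rprod_le x y : `|rprod x y| <= normc x * normc y.
Proof. by rewrite -Normc.normcM; exact: Re_le_normc. Qed.

Lemma normc_real (a : R) : normc a%:C%C = `|a|.
Proof. by rewrite /= expr0n/= addr0 sqrtr_sqr. Qed.

Lemma normc_conj x : normc (conjc x) = normc x.
Proof. by case: x => a b /=; rewrite sqrrN. Qed.

(** [dual_elt p z] is the number of modulus [|z|^(p-1)] and of phase opposite
    to that of [z]. *)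
Definition dual_elt (p : R) z : R[i] := (normc z `^ (p - 2))%:C%C * conjc z.

Lemma rprod_dual_elt p z : p != 0 -> rprod (dual_elt p z) z = normc z `^ p.
Proof.
move=> p0; have [->|z0] := eqVneq z 0.
  by rewrite /rprod mulr0 Normc.normc0 powR0.
have nz : 0 < normc z.
  by rewrite lt_neqAle normc_ge0 andbT eq_sym; apply: contra_neq z0 => /Normc.eq0_normc.
have -> : rprod (dual_elt p z) z = normc z `^ (p - 2) * (normc z ^+ 2).
  rewrite /rprod /dual_elt; case: z {z0} nz => a b /= nz.
  by rewrite sqr_sqrtr ?addr_ge0 ?sqr_ge0//; ring.
have nz' := lt0r_neq0 nz.
by rewrite -powR_mulrn ?normc_ge0// -powRD ?nz' ?implybT// subrK.
Qed.

Lemma normc_dual_elt p z : p != 1 -> normc (dual_elt p z) = normc z `^ (p - 1).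
Proof.
move=> p1; rewrite /dual_elt Normc.normcM normc_conj normc_real ger0_norm ?powR_ge0//.
have [->|z0] := eqVneq z 0.
  by rewrite Normc.normc0 mulr0 powR0// subr_eq0.
have nz : 0 < normc z.
  by rewrite lt_neqAle normc_ge0 andbT eq_sym; apply: contra_neq z0 => /Normc.eq0_normc.
have nz' := lt0r_neq0 nz.
rewrite -[X in _ * X]powRr1 ?normc_ge0// -powRD ?nz' ?implybT//.
by congr (_ `^ _); ring.
Qed.

End complex_facts.

Section complex_coordinates.
Context {R : realType}.
Implicit Types x y c : R[i].

Lemma rprod_ext x y : (forall c, rprod c x = rprod c y) -> x = y.
Proof.
move=> h; have := h 1; have := h (Complex 0 1); rewrite !rprodE.
by case: x {h} => a b; case: y => c d /=; rewrite !mul0r !mul1r !sub0r !subr0 => /oppr_inj -> ->.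
Qed.

Lemma complex_combination c : c = (complex.Re c)%:C%C + (complex.Im c)%:C%C * Complex 0 1.
Proof. by case: c => a b; rewrite /= /real_complex_def; apply/eqP; rewrite eq_complex /=; apply/andP; split; apply/eqP; ring. Qed.

Lemma normc_le_parts (a b A B : R) : `|a| <= A -> `|b| <= B -> normc (Complex a b) <= A + B.
Proof.
move=> ha hb; rewrite [Complex a b]complex_combination.
apply: le_trans (le_normcD a%:C%C (b%:C%C * Complex 0 1)) _.
rewrite Normc.normcM !normc_real (_ : normc (Complex 0 1) = 1) ?mulr1; first exact: lerD.
by rewrite /= expr0n/= add0r expr1n sqrtr1.
Qed.

End complex_coordinates.

Section cmeasurable_facts.
Context d (T : measurableType d) (R : realType).
Implicit Types (f g : T -> R[i]).

Lemma cmeasurable_rprod f g : cmeasurable f -> cmeasurable g ->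
  measurable_fun setT (fun t => rprod (f t) (g t)).
Proof.
move=> [fr fi] [gr gi]; under eq_fun do rewrite rprodE.
by apply: measurable_funB; apply: measurable_funM.
Qed.

Lemma cmeasurableM f g : cmeasurable f -> cmeasurable g ->
  cmeasurable (fun t => f t * g t).
Proof.
move=> [fr fi] [gr gi]; split.
  rewrite (_ : _ \o _ = (fun t => complex.Re (f t) * complex.Re (g t) -
      complex.Im (f t) * complex.Im (g t))).
    by apply: measurable_funB; apply: measurable_funM.
  by apply/funext => t /=; case: (f t); case: (g t).
rewrite (_ : _ \o _ = (fun t => complex.Re (f t) * complex.Im (g t) +
    complex.Im (f t) * complex.Re (g t))).
  by apply: measurable_funD; apply: measurable_funM.
by apply/funext => t /=; case: (f t); case: (g t).
Qed.

Lemma cmeasurable_real (f : T -> R) : measurable_fun setT f ->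
  cmeasurable (fun t => (f t)%:C%C).
Proof. by move=> mf; split=> //; exact: measurable_cst. Qed.

Lemma cmeasurable_conjc f : cmeasurable f -> cmeasurable (fun t => conjc (f t)).
Proof.
move=> [fr fi]; split.
  by rewrite (_ : _ \o _ = @complex.Re R \o f)//; apply/funext => t /=; case: (f t).
rewrite (_ : _ \o _ = \- (@complex.Im R \o f)); first exact: measurable_funN.
by apply/funext => t /=; case: (f t).
Qed.

Lemma cmeasurable_comp d' (T' : measurableType d') (phi : T' -> T) f :
  measurable_fun setT phi -> cmeasurable f -> cmeasurable (f \o phi).
Proof.
by move=> mphi [fr fi]; split; [exact: (measurableT_comp fr)|exact: (measurableT_comp fi)].
Qed.

Lemma cmeasurable_dual_elt p f : cmeasurable f ->
  cmeasurable (fun t => dual_elt p (f t)).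
Proof.
move=> mf; apply: cmeasurableM; last exact: cmeasurable_conjc.
apply: cmeasurable_real; apply: (@measurableT_comp _ _ _ _ _ _ (fun x : R => x `^ (p - 2))).
  exact: measurable_powR.
exact: cmeasurable_normc.
Qed.

End cmeasurable_facts.

Section toLp.
Context d (T : measurableType d) (R : realType).
Variables (mu : {measure set T -> \bar R}) (p : R) (p1 : 1 <= p).
Implicit Types (f g : T -> R[i]) (u v : Lp mu p1).

(** Defined for every function, with the value [0] outside [L^p], so that terms
    carry no proofs of membership. *)
Definition toLp f : Lp mu p1 :=
  match pselect (f \in Lp_pred mu p1) with
  | left h => Lp_class (MkLpFun h)
  | right _ => 0
  end.

Lemma toLpE f (h : f \in Lp_pred mu p1) : toLp f = Lp_class (MkLpFun h).
Proof.
rewrite /toLp; case: pselect => // h'; congr (Lp_class _).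
by apply: val_inj.
Qed.

Lemma toLp_ae f : f \in Lp_pred mu p1 -> (Lp_repr (toLp f) : T -> R[i]) = f %[ae mu].
Proof. by move=> h; rewrite (toLpE h); exact: Lp_classK. Qed.

Lemma Lp_repr_in u : (Lp_repr u : T -> R[i]) \in Lp_pred mu p1.
Proof. exact: valP. Qed.

Lemma toLpK u : toLp (Lp_repr u) = u.
Proof. by rewrite (toLpE (Lp_repr_in u)) -[RHS]Lp_reprK; congr (Lp_class _); apply: val_inj. Qed.

Lemma toLp_eq f g : f \in Lp_pred mu p1 -> g \in Lp_pred mu p1 ->
  f = g %[ae mu] -> toLp f = toLp g.
Proof. by move=> hf hg fg; rewrite (toLpE hf) (toLpE hg); apply/Lp_class_eq. Qed.

Lemma in_LpD f g : f \in Lp_pred mu p1 -> g \in Lp_pred mu p1 ->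
  (fun t => f t + g t) \in Lp_pred mu p1.
Proof.
move=> /Lp_predP[mf fy] /Lp_predP[mg gy]; apply/Lp_predP; split.
  exact: cmeasurableD.
by apply: le_lt_trans (cLnormD mu p1 mf mg) _; rewrite lte_add_pinfty.
Qed.

Lemma in_LpZ c f : f \in Lp_pred mu p1 -> (fun t => c * f t) \in Lp_pred mu p1.
Proof.
move=> /Lp_predP[mf fy]; apply/Lp_predP; split; first exact: (cmeasurableZ c mf).
by rewrite (cLnormZ mu p1 c mf) lte_mul_pinfty// lee_fin normc_ge0.
Qed.

Lemma toLpD f g : f \in Lp_pred mu p1 -> g \in Lp_pred mu p1 ->
  toLp (fun t => f t + g t) = toLp f + toLp g.
Proof.
move=> hf hg; rewrite (toLpE hf) (toLpE hg) (toLpE (in_LpD hf hg)) -Lp_classD.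
by congr (Lp_class _); apply: val_inj.
Qed.

Lemma toLpZ c f : f \in Lp_pred mu p1 -> toLp (fun t => c * f t) = c *: toLp f.
Proof.
move=> hf; rewrite (toLpE hf) (toLpE (in_LpZ c hf)) -Lp_classZ.
by congr (Lp_class _); apply: val_inj.
Qed.

Lemma toLp_norm f : f \in Lp_pred mu p1 -> Lp_norm (toLp f) = fine (cLnorm mu p f).
Proof. by move=> h; rewrite (toLpE h) Lp_norm_class. Qed.

Lemma Lp_repr_toLp u f : f \in Lp_pred mu p1 -> u = toLp f ->
  (Lp_repr u : T -> R[i]) = f %[ae mu].
Proof. by move=> hf uf; subst u; exact: toLp_ae. Qed.

Lemma Lp_reprD u v :
  (Lp_repr (u + v) : T -> R[i]) = (fun t => Lp_repr u t + Lp_repr v t) %[ae mu].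
Proof.
apply: Lp_repr_toLp; first by apply: in_LpD; exact: Lp_repr_in.
by rewrite toLpD ?Lp_repr_in// !toLpK.
Qed.

Lemma Lp_reprZ c u :
  (Lp_repr (c *: u) : T -> R[i]) = (fun t => c * Lp_repr u t) %[ae mu].
Proof.
apply: Lp_repr_toLp; first by apply: in_LpZ; exact: Lp_repr_in.
by rewrite toLpZ ?Lp_repr_in// toLpK.
Qed.

Lemma Lp_norm0 : Lp_norm (0 : Lp mu p1) = 0.
Proof. by have := Lp_normZ 0 (0 : Lp mu p1); rewrite scale0r Normc.normc0 mul0r. Qed.

Lemma Lp_normN u : Lp_norm (- u) = Lp_norm u.
Proof. by rewrite -scaleN1r Lp_normZ normcN Normc.normc1 mul1r. Qed.

Lemma Lp_normB u v : Lp_norm (u - v) = Lp_norm (v - u).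
Proof. by rewrite -Lp_normN opprB. Qed.

Lemma Lp_norm_powR u : ((Lp_norm u) `^ p)%:E = (\int[mu]_t (normc (Lp_repr u t) `^ p)%:E)%E.
Proof.
have p0 : 0 < p by exact: lt_le_trans ltr01 p1.
rewrite -poweR_EFin fineK; last exact: LpFun_cLnorm.
rewrite cLnormE -poweRrM mulVf ?gt_eqF// poweRe1// integral_ge0// => t _.
by rewrite lee_fin powR_ge0.
Qed.

(** The bounds in the definition of [bop] are complex numbers. *)
Lemma bop_Lp_bound (A : bop (Lp mu p1)) :
  exists2 C : R, 0 <= C & forall u, Lp_norm (A u) <= C * Lp_norm u.
Proof.
have [M M0 AM] := bounded_map_ge0 (bop_bounded A).
exists (complex.Re M); first by move: M0; rewrite lecE => /andP[].
move=> u; have := AM u; rewrite !Lp_normE.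
have -> : M = (complex.Re M)%:C%C.
  by move: M0; rewrite lecE => /andP[/eqP]; case: M {AM} => a b /= ->.
by rewrite -(rmorphM (real_complex R)) lecR.
Qed.

End toLp.

(** * The duality between L^p and L^q *)

Section pairing.
Context d (T : measurableType d) (R : realType).
Variables (mu : {measure set T -> \bar R}) (p q : R) (p1 : 1 <= p) (q1 : 1 <= q).
Hypothesis pq : p^-1 + q^-1 = 1.
Implicit Types (f g x : T -> R[i]) (u v : Lp mu p1) (xi eta : Lp mu q1).

Lemma p_gt0 : 0 < p. Proof. exact: lt_le_trans ltr01 p1. Qed.
Lemma q_gt0 : 0 < q. Proof. exact: lt_le_trans ltr01 q1. Qed.

Lemma conj_neq1 : p != 1.
Proof.
apply/eqP => p_1; move: pq; rewrite p_1 invr1 => /eqP.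
by rewrite -subr_eq0 addrAC subrr add0r invr_eq0 gt_eqF// q_gt0.
Qed.

Lemma conj_mul : (p - 1) * q = p.
Proof.
have q0 := lt0r_neq0 q_gt0; have p0 := lt0r_neq0 p_gt0.
have H : p * q = p + q by rewrite -[LHS]mulr1 -pq; field; rewrite p0 q0.
by rewrite mulrBl mul1r H addrK.
Qed.

Lemma hoelderc x f : cmeasurable x -> cmeasurable f ->
  (\int[mu]_t (normc (x t) * normc (f t))%:E <= cLnorm mu q x * cLnorm mu p f)%E.
Proof.
move=> mx mf.
have := @hoelder _ _ _ mu _ _ q p (cmeasurable_normc mx) (cmeasurable_normc mf)
  q_gt0 p_gt0.
rewrite addrC => /(_ pq); apply: le_trans; rewrite Lnorm1.
rewrite le_eqVlt; apply/orP; left; apply/eqP; apply: eq_integral => t _ /=.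
by rewrite ger0_norm// mulr_ge0// normc_ge0.
Qed.

Lemma integrable_rprod x f : x \in Lp_pred mu q1 -> f \in Lp_pred mu p1 ->
  mu.-integrable setT (EFin \o (fun t => rprod (x t) (f t))).
Proof.
move=> /Lp_predP[mx xoo] /Lp_predP[mf foo]; apply/integrableP; split.
  by apply/measurable_EFinP; exact: cmeasurable_rprod.
apply: (@le_lt_trans _ _ (\int[mu]_t (normc (x t) * normc (f t))%:E)%E).
  apply: ge0_le_integral => //.
  - apply: measurableT_comp => //; apply/measurable_EFinP; exact: cmeasurable_rprod.
  - apply/measurable_EFinP; apply: measurable_funM; exact: cmeasurable_normc.
  - by move=> t _; rewrite lee_fin rprod_le.
by apply: le_lt_trans (hoelderc mx mf) _; rewrite lte_mul_pinfty// ?cLnorm_ge0// ge0_fin_numE ?cLnorm_ge0.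
Qed.

(** The imaginary part of the duality is the pairing with [-i u]. *)
Definition pairing xi u : R := \int[mu]_t rprod (Lp_repr xi t) (Lp_repr u t).

Lemma eq_pairing x f xi u : x \in Lp_pred mu q1 -> f \in Lp_pred mu p1 ->
  (Lp_repr xi : T -> R[i]) = x %[ae mu] -> (Lp_repr u : T -> R[i]) = f %[ae mu] ->
  pairing xi u = \int[mu]_t rprod (x t) (f t).
Proof.
move=> hx hf xix uf; congr fine; apply: ae_eq_integral => //.
- by case/integrableP: (integrable_rprod (Lp_repr_in xi) (Lp_repr_in u)).
- by case/integrableP: (integrable_rprod hx hf).
- by apply: filterS2 xix uf => t /(_ I) -> /(_ I) ->.
Qed.

Lemma pairing_toLp x f : x \in Lp_pred mu q1 -> f \in Lp_pred mu p1 ->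
  pairing (toLp mu q1 x) (toLp mu p1 f) = \int[mu]_t rprod (x t) (f t).
Proof. by move=> hx hf; apply: eq_pairing => //; exact: toLp_ae. Qed.

Lemma pairingDr xi u v : pairing xi (u + v) = pairing xi u + pairing xi v.
Proof.
have hx := Lp_repr_in xi; have hu := Lp_repr_in u; have hv := Lp_repr_in v.
rewrite (eq_pairing hx (in_LpD hu hv) _ (Lp_reprD u v)); last exact: aeW.
rewrite /pairing -RintegralD//; last 2 first.
- exact: (integrable_rprod hx hu).
- exact: (integrable_rprod hx hv).
by apply: eq_Rintegral => t _; rewrite rprodDr.
Qed.

Lemma pairingDl xi eta u : pairing (xi + eta) u = pairing xi u + pairing eta u.
Proof.
have hx := Lp_repr_in xi; have he := Lp_repr_in eta; have hu := Lp_repr_in u.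
rewrite (eq_pairing (in_LpD hx he) hu (Lp_reprD xi eta)); last exact: aeW.
rewrite /pairing -RintegralD//; last 2 first.
- exact: (integrable_rprod hx hu).
- exact: (integrable_rprod he hu).
by apply: eq_Rintegral => t _; rewrite rprodDl.
Qed.

Lemma pairingZ c xi u : pairing (c *: xi) u = pairing xi (c *: u).
Proof.
have hx := Lp_repr_in xi; have hu := Lp_repr_in u.
rewrite (eq_pairing (in_LpZ c hx) hu (Lp_reprZ c xi)); last exact: aeW.
rewrite (eq_pairing hx (in_LpZ c hu) _ (Lp_reprZ c u)); last exact: aeW.
by apply: eq_Rintegral => t _; rewrite rprodZ.
Qed.

Lemma pairing0r xi : pairing xi 0 = 0.
Proof. by have /eqP := pairingDr xi 0 0; rewrite addr0 -subr_eq subrr => /eqP. Qed.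

Lemma pairingNr xi u : pairing xi (- u) = - pairing xi u.
Proof. by apply/eqP; rewrite -addr_eq0 addrC -pairingDr subrr pairing0r. Qed.

Lemma pairingBr xi u v : pairing xi (u - v) = pairing xi u - pairing xi v.
Proof. by rewrite pairingDr pairingNr. Qed.

Lemma pairing_realZ (a : R) xi u : pairing xi (a%:C%C *: u) = a * pairing xi u.
Proof.
have hx := Lp_repr_in xi; have hu := Lp_repr_in u.
rewrite (eq_pairing hx (in_LpZ _ hu) _ (Lp_reprZ _ u)); last exact: aeW.
rewrite -RintegralZl//; last exact: (integrable_rprod hx hu).
apply: eq_Rintegral => t _; rewrite !rprodE; case: (Lp_repr u t) => x y /=; ring.
Qed.

Lemma pairing_le xi u : `|pairing xi u| <= Lp_norm xi * Lp_norm u.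
Proof.
have hx := Lp_repr_in xi; have hu := Lp_repr_in u.
have mx := LpFun_cmeasurable (Lp_repr xi); have mu_ := LpFun_cmeasurable (Lp_repr u).
apply: le_trans (le_normr_Rintegral _ _) _ => //; first exact: (integrable_rprod hx hu).
rewrite -lee_fin EFinM !fineK ?LpFun_cLnorm//; last first.
  by apply: integrable_fin_num => //; apply: integrable_norm; exact: (integrable_rprod hx hu).
apply: le_trans (hoelderc mx mu_); apply: ge0_le_integral => //.
- by apply/measurable_EFinP; apply: measurableT_comp => //; exact: cmeasurable_rprod.
- apply/measurable_EFinP; apply: measurable_funM; exact: cmeasurable_normc.
- by move=> t _; rewrite lee_fin rprod_le.
Qed.

Lemma cLnorm_dual_elt f : cLnorm mu q (fun t => dual_elt p (f t)) =
  ((\int[mu]_t (normc (f t) `^ p)%:E) `^ q^-1)%E.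
Proof.
rewrite cLnormE.
by under eq_integral => t _ do rewrite normc_dual_elt ?conj_neq1// -powRrM conj_mul.
Qed.

Lemma dual_elt_in f : f \in Lp_pred mu p1 -> (fun t => dual_elt p (f t)) \in Lp_pred mu q1.
Proof.
move=> /Lp_predP[mf foo]; apply/Lp_predP; split; first exact: cmeasurable_dual_elt.
rewrite cLnorm_dual_elt; apply: poweR_lty.
by move: foo; rewrite cLnormE; apply: lty_poweRy; rewrite invr_eq0 lt0r_neq0// p_gt0.
Qed.

(** [dual_elt p u] is an element of [L^q] on which the supremum that defines the
    dual norm of [u] is attained. *)
Lemma pairing_norming C u : 0 <= C ->
  (forall xi, `|pairing xi u| <= C * Lp_norm xi) -> Lp_norm u <= C.
Proof.
move=> C0 H; have hu := Lp_repr_in u.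
have hd := dual_elt_in hu.
have := H (toLp mu q1 (fun t => dual_elt p (Lp_repr u t))).
rewrite toLp_norm// cLnorm_dual_elt -Lp_norm_powR poweR_EFin/=.
rewrite (eq_pairing hd hu (toLp_ae hd)); last exact: aeW.
under eq_Rintegral do rewrite rprod_dual_elt ?lt0r_neq0 ?p_gt0//.
rewrite /Rintegral -Lp_norm_powR/= ger0_norm ?powR_ge0//.
set N := Lp_norm u => le.
have [->//|N0] := eqVneq N 0.
have Np : 0 < N by rewrite lt_neqAle eq_sym N0 Lp_norm_ge0.
have NE : N `^ p = N * (N `^ p) `^ q^-1.
  rewrite -powRrM -[X in X * _]powRr1 ?ltW// -powRD ?N0 ?implybT//; congr (_ `^ _).
  by rewrite -[X in X + _](mulfV (lt0r_neq0 p_gt0)) -mulrDr pq mulr1.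
by move: le; rewrite [leLHS]NE ler_pM2r// !powR_gt0.
Qed.

Lemma pairing_eq0 u : (forall xi, pairing xi u = 0) -> u = 0.
Proof.
move=> H; apply: Lp_norm_eq0; apply/eqP; rewrite eq_le Lp_norm_ge0 andbT.
by apply: pairing_norming => // xi; rewrite H normr0 mul0r.
Qed.

End pairing.

Lemma pairingC d (T : measurableType d) (R : realType) (mu : {measure set T -> \bar R})
    (p q : R) (p1 : 1 <= p) (q1 : 1 <= q) (xi : Lp mu q1) (u : Lp mu p1) :
  pairing xi u = pairing u xi.
Proof. by apply: eq_Rintegral => t _; rewrite /rprod mulrC. Qed.

(** * Approximation by step functions *)

Lemma measurable_powR_comp d (T : measurableType d) (R : realType) (q : R) (f : T -> R) :
  measurable_fun setT f -> measurable_fun setT (fun t => (f t `^ q)%:E).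
Proof.
move=> mf; apply/measurable_EFinP.
apply: (@measurableT_comp _ _ _ _ _ _ (fun x : R => x `^ q)).
  exact: measurable_powR.
exact: mf.
Qed.

Lemma cmeasurableB d (T : measurableType d) (R : realType) (f g : T -> R[i]) :
  cmeasurable f -> cmeasurable g -> cmeasurable (fun t => f t - g t).
Proof.
move=> mf mg; have := cmeasurableD mf (cmeasurableZ (-1) mg).
by rewrite (_ : f + _ = (fun t => f t - g t))//; apply/funext => t; rewrite !fctE scaleN1r.
Qed.

Section cLnorm_facts.
Context d (T : measurableType d) (R : realType) (mu : {measure set T -> \bar R}).
Variables (q : R) (q1 : 1 <= q).
Implicit Types (f g : T -> R[i]).

Let q0 : 0 < q. Proof. exact: lt_le_trans ltr01 q1. Qed.

Lemma cLnorm_lt f (e : R) : 0 < e ->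
  (\int[mu]_t (normc (f t) `^ q)%:E < (e `^ q)%:E)%E -> (cLnorm mu q f < e%:E)%E.
Proof.
move=> e0 H; rewrite cLnormE.
have I0 : (0 <= \int[mu]_t (normc (f t) `^ q)%:E)%E.
  by apply: integral_ge0 => t _; rewrite lee_fin powR_ge0.
have Ifin : (\int[mu]_t (normc (f t) `^ q)%:E)%E \is a fin_num.
  by rewrite ge0_fin_numE// (lt_trans H)// ltry.
move: H I0; rewrite -(fineK Ifin) lte_fin lee_fin => H I0.
rewrite poweR_EFin lte_fin -[ltRHS](powRr1 (ltW e0)).
rewrite -(mulfV (lt0r_neq0 q0)) powRrM.
by apply: gt0_ltr_powR; rewrite ?invr_gt0// nnegrE powR_ge0.
Qed.

Lemma cLnorm_lty f : (\int[mu]_t (normc (f t) `^ q)%:E < +oo)%E <-> (cLnorm mu q f < +oo)%E.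
Proof.
rewrite cLnormE; split; first exact: poweR_lty.
by apply: lty_poweRy; rewrite invr_eq0 lt0r_neq0.
Qed.

Lemma cLnorm_le f g : cmeasurable f -> cmeasurable g ->
  (forall t, normc (f t) <= normc (g t)) -> (cLnorm mu q f <= cLnorm mu q g)%E.
Proof.
move=> mf mg fg; apply: le_Lnorm => //; [exact: cmeasurable_normc..|].
by move=> t; rewrite normc_ge0/= fg.
Qed.

Lemma cLnorm_triangle f g (h : T -> R[i]) : cmeasurable f -> cmeasurable g -> cmeasurable h ->
  (cLnorm mu q (fun t => f t - h t)%R <=
   cLnorm mu q (fun t => f t - g t)%R + cLnorm mu q (fun t => g t - h t)%R)%E.
Proof.
move=> mf mg mh; apply: le_trans (cLnormD mu q1 (cmeasurableB mf mg) (cmeasurableB mg mh)).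
rewrite (_ : (fun t => f t - h t) = (fun t => f t - g t) + (fun t => g t - h t))//.
by apply/funext => t; rewrite !fctE subrKA.
Qed.

End cLnorm_facts.

Lemma cLnorm_dominated_cvg d (T : measurableType d) (R : realType)
    (m : {measure set T -> \bar R}) (q : R) (h : T -> R) (g : (T -> R)^nat) :
  1 <= q -> measurable_fun setT h -> (forall n, measurable_fun setT (g n)) ->
  (forall n t, 0 <= g n t <= h t) -> (forall t, g n t @[n --> \oo] --> h t) ->
  (\int[m]_t (h t `^ q)%:E < +oo)%E -> forall e : R, 0 < e ->
  \forall n \near \oo, (cLnorm m q (fun t => (h t)%:C%C - (g n t)%:C%C)%R < e%:E)%E.
Proof.
move=> q1 mh mg gh g_cvg hoo e e0; have q0 : 0 < q by exact: lt_le_trans ltr01 q1.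
have h0 t : 0 <= h t by have /andP[g0 /(le_trans g0)] := gh 0%N t.
have [] := @dominated_convergence _ _ _ m setT measurableT
    (fun n t => ((h t - g n t) `^ q)%:E) (fun=> 0%E) (fun t => (h t `^ q)%:E).
- by move=> n; apply: measurable_powR_comp; exact: measurable_funB.
- exact: measurable_cst.
- apply: aeW => t _.
  have : `|h t - g n t| `^ q @[n --> \oo] --> (0 : R).
    apply/cvgrPdist_lt => r r0; have rq : 0 < r `^ q^-1 by exact: powR_gt0.
    have /cvgrPdist_lt /(_ _ rq) := g_cvg t; apply: filterS => n hn.
    rewrite sub0r normrN ger0_norm ?powR_ge0// -[ltRHS](powRr1 (ltW r0)).
    rewrite -(mulVf (lt0r_neq0 q0)) powRrM; apply: gt0_ltr_powR => //.
    by rewrite nnegrE powR_ge0.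
  move=> c; apply/fine_cvgP; split; first exact: nearW.
  apply: cvg_trans c; apply: near_eq_cvg; apply: nearW => n /=.
  by rewrite ger0_norm// subr_ge0; case/andP: (gh n t).
- apply/integrableP; split; first exact: measurable_powR_comp.
  rewrite (_ : (\int[m]_x _)%E = (\int[m]_t (h t `^ q)%:E)%E)//.
  by apply: eq_integral => t _; rewrite gee0_abs// lee_fin powR_ge0.
- apply: aeW => t n _; rewrite /= lee_fin ger0_norm ?powR_ge0//.
  have /andP[g0 gt] := gh n t.
  by rewrite ge0_ler_powR ?nnegrE ?subr_ge0// ?(ltW q0)// gerBl.
move=> _ _; rewrite integral0 => /= c.
have eq0 : (0 < (e `^ q)%:E)%E by rewrite lte_fin powR_gt0.
have : \forall n \near \oo, (\int[m]_x ((h x - g n x) `^ q)%:E < (e `^ q)%:E)%E.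
  exact: (c _ (open_ereal_lt' eq0)).
have nE n t : normc ((h t)%:C%C - (g n t)%:C%C) = h t - g n t.
  by have /andP[g0 gt] := gh n t; rewrite -rmorphB normc_real ger0_norm// subr_ge0.
apply: filterS => n lt; apply: (cLnorm_lt q1 e0).
by under eq_integral => t _ do rewrite nE.
Qed.

Section step_functions.
Context {R : realType} {G : topologicalGroupType}.
Implicit Types (c : R[i]) (A W : set G) (f g y : G -> R[i]).

Definition cindic c A : G -> R[i] := fun t => c * (\1_A t)%:C%C.

(** The sets are open and relatively compact, rather than Borel of finite
    measure, for [open_tonelli] to apply to them. *)
Inductive step_fun : (G -> R[i]) -> Prop :=
| step_cindic c W : rc W -> step_fun (cindic c W)
| step_add f g : step_fun f -> step_fun g -> step_fun (fun t => f t + g t).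

Lemma step_scale c y : step_fun y -> step_fun (fun t => c * y t).
Proof.
elim=> [c' W rW|f g sf IHf sg IHg].
  rewrite (_ : (fun t => _) = cindic (c * c') W); first exact: step_cindic.
  by apply/funext => t; rewrite /cindic mulrA.
rewrite (_ : (fun t => _) = (fun t => c * f t + c * g t)); first exact: step_add.
by apply/funext => t; rewrite mulrDr.
Qed.

Lemma step_zero : step_fun (fun=> 0).
Proof.
rewrite (_ : (fun=> 0) = cindic 0 set0); first by apply: step_cindic; exact: rc0.
by apply/funext => t; rewrite /cindic mul0r.
Qed.

Lemma cmeasurable_cindic c (A : set (borel G)) : measurable A ->
  cmeasurable (cindic c A : borel G -> R[i]).
Proof.
move=> mA; apply: cmeasurableM; first by split; exact: measurable_cst.
by apply: cmeasurable_real; exact: measurable_indic.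
Qed.

Lemma cmeasurable_step y : step_fun y -> cmeasurable (y : borel G -> R[i]).
Proof.
elim=> [c W rW|f g _ mf _ mg]; last exact: cmeasurableD.
by apply: cmeasurable_cindic; exact: rc_borel.
Qed.

Lemma normc_cindic c A t : normc (cindic c A t) = normc c * \1_A t.
Proof. by rewrite /cindic Normc.normcM normc_real ger0_norm. Qed.

Lemma normc_cindic_diff c A W t : normc (cindic c A t - cindic c W t) =
  normc c * \1_((A `\` W) `|` (W `\` A)) t.
Proof.
rewrite /cindic -mulrBr Normc.normcM -rmorphB/= expr0n/= addr0 sqrtr_sqr; congr (_ * _).
have [At|At] := pselect (A t); have [Wt|Wt] := pselect (W t); rewrite !indicE.
- rewrite (mem_set At) (mem_set Wt) subrr normr0 memNset//.
  by case=> -[].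
- by rewrite (mem_set At) (memNset Wt) subr0 normr1 mem_set//; left.
- by rewrite (memNset At) (mem_set Wt) sub0r normrN1 mem_set//; right.
- rewrite (memNset At) (memNset Wt) subrr normr0 memNset//.
  by case=> -[].
Qed.

Lemma cLnorm_indic (mu : {measure set (borel G) -> \bar R}) (q : R) (h : G -> R[i]) c
    (A : set (borel G)) : 1 <= q -> measurable A ->
  (forall t, normc (h t) = normc c * \1_A t) ->
  (\int[mu]_t (normc (h t) `^ q)%:E = (normc c `^ q)%:E * mu A)%E.
Proof.
move=> q1 mA hE; have q0 : q != 0 by rewrite gt_eqF// (lt_le_trans ltr01).
rewrite -[X in mu X]setIT -integral_indic// -ge0_integralZl//; last 2 first.
- by apply/measurable_EFinP; exact: measurable_indic.
- by rewrite lee_fin powR_ge0.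
apply: eq_integral => t _; rewrite hE -EFinM powRM ?normc_ge0//; congr (_ * _)%:E.
by rewrite indicE; case: (t \in A); rewrite ?powR1 ?powR0.
Qed.

End step_functions.

Section density.
Import HBNNSimple.
Context {R : realType} {G : topologicalGroupType}.
Variables (m1 m2 : {measure set (borel G) -> \bar R}) (q1 q2 : R).
Hypotheses (q1_ge1 : 1 <= q1) (q2_ge1 : 1 <= q2).
Hypothesis approx : forall A : set (borel G), measurable A -> (m1 A < +oo)%E ->
  (m2 A < +oo)%E -> forall e : R, 0 < e -> exists2 W : set G, rc W &
  (m1 ((A `\` W) `|` (W `\` A)) < e%:E)%E /\ (m2 ((A `\` W) `|` (W `\` A)) < e%:E)%E.
Implicit Types (c : R[i]) (A W : set G) (f g y : borel G -> R[i]).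

Let approximable f := forall e : R, 0 < e -> exists2 y, step_fun y &
  (cLnorm m1 q1 (fun t => f t - y t)%R < e%:E)%E /\
  (cLnorm m2 q2 (fun t => f t - y t)%R < e%:E)%E.

Lemma approximable0 : approximable (fun=> 0).
Proof.
move=> e e0; exists (fun=> 0); first exact: step_zero.
by rewrite subrr !cLnorm0 ?lte_fin.
Qed.

Lemma approximableD f g : cmeasurable f -> cmeasurable g ->
  approximable f -> approximable g -> approximable (fun t => f t + g t).
Proof.
move=> mf mg af ag e e0; have e20 : 0 < e / 2 by rewrite divr_gt0.
have [y sy [y1 y2]] := af _ e20; have [z sz [z1 z2]] := ag _ e20.
exists (fun t => y t + z t); first exact: step_add.
have -> : (fun t => f t + g t - (y t + z t)) = (fun t => f t - y t) + (fun t => g t - z t).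
  by apply/funext => t; rewrite !fctE opprD addrACA.
have mfy := cmeasurableB mf (cmeasurable_step sy).
have mgz := cmeasurableB mg (cmeasurable_step sz).
split; (apply: le_lt_trans; first exact: cLnormD); rewrite [e]splitr EFinD.
  exact: lteD.
exact: lteD.
Qed.

Lemma approximableZ c f : cmeasurable f -> approximable f -> approximable (fun t => c * f t).
Proof.
move=> mf af e e0; have c0 : 0 < normc c + 1 by rewrite ltr_wpDl ?normc_ge0.
have ec0 : 0 < e / (normc c + 1) by rewrite divr_gt0.
have [y sy [y1 y2]] := af _ ec0.
exists (fun t => c * y t); first exact: step_scale.
have -> : (fun t => c * f t - c * y t) = c *: (fun t => f t - y t).
  by apply/funext => t; rewrite !fctE -mulrBr.
have mfy := cmeasurableB mf (cmeasurable_step sy).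
have le x : (0 <= x)%E -> (x < (e / (normc c + 1))%:E)%E -> ((normc c)%:E * x < e%:E)%E.
  move=> x0 xe; have xf : x \is a fin_num by rewrite ge0_fin_numE// (lt_trans xe)// ltry.
  move: x0 xe; rewrite -(fineK xf) -EFinM !lte_fin lee_fin => x0 xe.
  apply: (@le_lt_trans _ _ ((normc c + 1) * fine x)).
    by rewrite ler_wpM2r// lerDl.
  by rewrite mulrC -ltr_pdivlMr.
by rewrite !cLnormZ//; split; apply: le => //; exact: cLnorm_ge0.
Qed.

Lemma approximable_lim f : cmeasurable f -> (forall e : R, 0 < e -> exists2 g,
    cmeasurable g /\ approximable g & (cLnorm m1 q1 (fun t => f t - g t)%R < e%:E)%E /\
    (cLnorm m2 q2 (fun t => f t - g t)%R < e%:E)%E) -> approximable f.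
Proof.
move=> mf H e e0; have e20 : 0 < e / 2 by rewrite divr_gt0.
have [g [mg ag] [g1 g2]] := H _ e20; have [y sy [y1 y2]] := ag _ e20.
have my := cmeasurable_step sy.
exists y => //; split.
  by apply: le_lt_trans (cLnorm_triangle m1 q1_ge1 mf mg my) _; rewrite [e]splitr EFinD lteD.
by apply: le_lt_trans (cLnorm_triangle m2 q2_ge1 mf mg my) _; rewrite [e]splitr EFinD lteD.
Qed.

Lemma approximable_cindic c (A : set (borel G)) : measurable A ->
  (m1 A < +oo)%E -> (m2 A < +oo)%E -> approximable (cindic c A).
Proof.
move=> mA A1 A2 e e0.
pose a (q : R) := e `^ q / (normc c `^ q + 1).
have a0 q : 0 < a q by rewrite divr_gt0 ?powR_gt0// ltr_wpDl// powR_ge0.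
have d0 : 0 < Num.min (a q1) (a q2) by rewrite lt_min !a0.
have [W rW [W1 W2]] := approx mA A1 A2 d0.
have mW := rc_borel rW.
have mD : measurable ((A `\` W) `|` (W `\` A) : set (borel G)).
  by apply: measurableU; exact: measurableD.
have key (m : {measure set (borel G) -> \bar R}) q : 1 <= q ->
    (m ((A `\` W) `|` (W `\` A)) < (a q)%:E)%E ->
    (cLnorm m q (fun t => cindic c A t - cindic c W t)%R < e%:E)%E.
  move=> q_ge1 mlt; apply: cLnorm_lt => //.
  rewrite (@cLnorm_indic _ _ _ _ _ c _ q_ge1 mD); last by move=> t; exact: normc_cindic_diff.
  have xf : m ((A `\` W) `|` (W `\` A)) \is a fin_num.
    by rewrite ge0_fin_numE// (lt_trans mlt)// ltry.
  move: mlt; rewrite -(fineK xf) -EFinM !lte_fin => mlt.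
  have : (normc c `^ q + 1) * fine (m ((A `\` W) `|` (W `\` A))) < e `^ q.
    by rewrite mulrC -ltr_pdivlMr// ltr_wpDl// powR_ge0.
  by apply: le_lt_trans; rewrite ler_wpM2r ?fine_ge0// lerDl.
exists (cindic c W); first exact: step_cindic.
split; apply: key => //.
  by apply: lt_le_trans W1 _; rewrite lee_fin ge_min lexx.
by apply: lt_le_trans W2 _; rewrite lee_fin ge_min lexx orbT.
Qed.

Lemma approximable_nonneg (h : borel G -> R) : measurable_fun setT h ->
  (forall t, 0 <= h t) -> (\int[m1]_t (h t `^ q1)%:E < +oo)%E ->
  (\int[m2]_t (h t `^ q2)%:E < +oo)%E -> approximable (fun t => (h t)%:C%C).
Proof.
move=> mh h0 h1 h2; have mhE : measurable_fun setT (EFin \o h) by exact/measurable_EFinP.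
pose g := nnsfun_approx measurableT mhE.
have gh n t : 0 <= g n t <= h t.
  rewrite fun_ge0/= -lee_fin /g nnsfun_approxE; apply: le_approx => //= x _.
  by rewrite lee_fin.
have g_cvg t : g n t @[n --> \oo] --> h t.
  have h0E x : [set: borel G] x -> (0 <= (EFin \o h) x)%E by rewrite /= lee_fin.
  exact: (fine_cvg (@cvg_nnsfun_approx _ _ _ _ measurableT _ mhE h0E t Logic.I)).
have step_g n : approximable (fun t => (g n t)%:C%C).
  have gE : (fun t => (g n t)%:C%C) = (fun t =>
      \sum_(r <- fset_set (range (g n))) cindic r%:C%C (g n @^-1` [set r]) t).
    apply/funext => t; rewrite [in LHS](fimfunE (g n)) fsbig_finite//=.
    rewrite (big_morph (real_complex R) (id1 := 0) (op1 := +%R))//; last exact: rmorphD.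
    by apply: eq_bigr => r _; rewrite /cindic -rmorphM.
  rewrite gE.
  have mgr (r : R) : measurable (g n @^-1` [set r]) by [].
  have : forall r, r \in enum_fset (fset_set (range (g n))) -> range (g n) r.
    by move=> r rg; apply: set_mem; rewrite -in_fset_set.
  elim: (enum_fset _) => [_|r s IH sg].
    by under eq_fun do rewrite big_nil; exact: approximable0.
  under eq_fun do rewrite big_cons.
  apply: approximableD.
  - exact: cmeasurable_cindic.
  - elim: (s) => [|z s' IHs]; first by under eq_fun do rewrite big_nil; exact: cmeasurable0.
    under eq_fun do rewrite big_cons; apply: cmeasurableD => //.
    exact: cmeasurable_cindic.
  - have [t0 _ rE] := sg r (mem_head _ _).
    have [->|r0] := eqVneq r 0.
      rewrite (_ : cindic _ _ = fun=> 0); first exact: approximable0.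
      by apply/funext => t; rewrite /cindic mul0r.
    have r_gt0 : 0 < r by rewrite lt_neqAle eq_sym r0 -rE fun_ge0.
    have fin (m : {measure set (borel G) -> \bar R}) (q : R) : 1 <= q ->
        (\int[m]_t (h t `^ q)%:E < +oo)%E -> (m (g n @^-1` [set r]) < +oo)%E.
      move=> q_ge1 hoo; have : ((r `^ q)%:E * m (g n @^-1` [set r]) < +oo)%E.
        apply: le_lt_trans hoo; have := @cLnorm_indic _ _ m q (cindic r%:C%C (g n @^-1` [set r])) r%:C%C _ q_ge1 (mgr r).
        rewrite normc_real gtr0_norm// => <-; last first.
          by move=> t; rewrite normc_cindic normc_real gtr0_norm.
        apply: ge0_le_integral => //.
        - by move=> t _; rewrite lee_fin powR_ge0.
        - by apply: measurable_normc_powR; exact: cmeasurable_cindic.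
        - exact: measurable_powR_comp.
        - move=> t _; rewrite lee_fin ge0_ler_powR ?nnegrE ?normc_ge0//.
            exact: le_trans ler01 q_ge1.
          rewrite normc_cindic normc_real gtr0_norm// indicE.
          have [|_] := boolP (t \in _); last by rewrite mulr0.
          by rewrite inE/= => <-; rewrite mulr1; case/andP: (gh n t).
      apply: contraTT; rewrite -!leNgt !leye_eq => /eqP ->.
      by rewrite gt0_muley// lte_fin powR_gt0.
    by apply: approximable_cindic => //; [exact: fin h1|exact: fin h2].
  - by apply: IH => z zs; apply: sg; rewrite in_cons zs orbT.
apply: approximable_lim; first exact: cmeasurable_real.
move=> e e0.
have mg n : measurable_fun setT (g n) by [].
have near1 := @cLnorm_dominated_cvg _ _ _ m1 q1 h (fun n => g n) q1_ge1 mh mg gh g_cvg h1 e e0.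
have near2 := @cLnorm_dominated_cvg _ _ _ m2 q2 h (fun n => g n) q2_ge1 mh mg gh g_cvg h2 e e0.
have [n [n1 n2]] := @filter_ex _ _ eventually_filter _ (@filterI _ _ _ _ _ near1 near2).
exists (fun t => (g n t)%:C%C) => //; split=> //.
by apply: cmeasurable_real.
Qed.

(** The two norms are needed to approximate a function and, by the same step
    function, its composition with the inversion. *)
Theorem step_dense f : cmeasurable f -> (cLnorm m1 q1 f < +oo)%E ->
  (cLnorm m2 q2 f < +oo)%E -> forall e : R, 0 < e -> exists2 y, step_fun y &
  (cLnorm m1 q1 (fun t => f t - y t)%R < e%:E)%E /\
  (cLnorm m2 q2 (fun t => f t - y t)%R < e%:E)%E.
Proof.
move=> [mr mi] f1 f2.
have part (h : borel G -> R) : measurable_fun setT h ->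
    (forall t, `|h t| <= normc (f t)) -> approximable (fun t => (Num.max (h t) 0)%:C%C).
  move=> mh hf; have mm : measurable_fun setT (fun t => Num.max (h t) 0).
    by apply: measurable_maxr => //; exact: measurable_cst.
  have m0 t : 0 <= Num.max (h t) 0 by rewrite le_max lexx orbT.
  have mle t : Num.max (h t) 0 <= normc (f t).
    by rewrite ge_max normc_ge0 andbT (le_trans _ (hf t))// ler_norm.
  have bound (m : {measure set (borel G) -> \bar R}) q : 1 <= q -> (cLnorm m q f < +oo)%E ->
      (\int[m]_t ((Num.max (h t) 0) `^ q)%:E < +oo)%E.
    move=> q_ge1 /(cLnorm_lty m q_ge1); apply: le_lt_trans; apply: ge0_le_integral => //.
    - by move=> t _; rewrite lee_fin powR_ge0.
    - exact: measurable_powR_comp.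
    - exact: measurable_normc_powR.
    - move=> t _; rewrite lee_fin ge0_ler_powR ?nnegrE ?normc_ge0//.
      exact: le_trans ler01 q_ge1.
  by apply: approximable_nonneg => //; exact: bound.
have parts (h : borel G -> R) : measurable_fun setT h ->
    (forall t, `|h t| <= normc (f t)) -> approximable (fun t => (h t)%:C%C).
  move=> mh hf.
  have mN : measurable_fun setT (fun t => - h t) by exact: measurable_funN.
  have mmax (k : borel G -> R) : measurable_fun setT k -> cmeasurable (fun t => (Num.max (k t) 0)%:C%C).
    by move=> mk; apply: cmeasurable_real; apply: measurable_maxr => //; exact: measurable_cst.
  rewrite (_ : (fun t => _) = (fun t => (Num.max (h t) 0)%:C%C + (-1) * (Num.max (- h t) 0)%:C%C)).
    apply: approximableD => //; [exact: mmax|exact: (cmeasurableZ (-1) (mmax _ mN))|exact: part|].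
    apply: approximableZ; first exact: mmax.
    by apply: part => // t; rewrite normrN.
  apply/funext => t; rewrite mulN1r -rmorphB; congr (_%:C%C).
  by case: (leP (h t) 0) => h1; case: (leP (- h t) 0) => h2; lra.
rewrite (_ : f = (fun t => (complex.Re (f t))%:C%C + Complex 0 1 * (complex.Im (f t))%:C%C)).
  apply: approximableD.
  - exact: cmeasurable_real.
  - by apply: (@cmeasurableZ _ _ _ (Complex 0 1) (fun t => (complex.Im (f t))%:C%C)); exact: cmeasurable_real.
  - by apply: parts => // t; exact: Re_le_normc.
  - apply: approximableZ; first exact: cmeasurable_real.
    by apply: parts => // t; exact: Im_le_normc.
by apply/funext => t; exact: complexE.
Qed.

End density.

(** * Indicators of Borel sets and inversion *)

Section haar_density.
Context {R : realType} {G : topologicalGroupType}.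
Variables (mu : {measure set (borel G) -> \bar R}) (Delta : G -> R).
Hypotheses (hausG : hausdorff_space G) (lcG : locally_compact [set: G]).
Hypotheses (haar : left_haar mu) (modular : modular_function mu Delta).
Implicit Types (s t u : G) (U V W K E Z : set G).

Let rad : radon mu. Proof. by case: haar. Qed.
Local Open Scope ereal_scope.

Lemma compact_approx V (e : R) : open V -> mu V < +oo -> (0 < e)%R ->
  exists2 K, compact K /\ K `<=` V & mu (V `\` K) < e%:E.
Proof.
move=> oV Voo e0; have [_ _ inner] := rad.
have Vfin : mu V \is a fin_num by rewrite ge0_fin_numE.
have : mu V - e%:E < mu V by rewrite lteBlDr// lteDl// lte_fin.
rewrite {2}inner// => /ereal_sup_gt[_ [K [cK KV] <-] VK].
have mV := open_borel oV; have mK := compact_borel hausG cK.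
have Kfin : mu K \is a fin_num.
  by rewrite ge0_fin_numE//; apply: le_lt_trans Voo; exact: borel_le.
exists K => //; rewrite measureD//.
by rewrite (setIidr KV) lteBlDl// -lteBlDr.
Qed.

Lemma open_rc_approx (F : set (borel G)) (c d : R) : measurable F -> mu F < +oo ->
  (forall v, F v -> ((Delta v)^-1 < c)%R) -> (0 < d)%R ->
  exists V W : set G, [/\ open V, rc W, W `<=` V, F `<=` V & forall v, V v -> ((Delta v)^-1 < c)%R] /\
    (mu (V `\` F) < d%:E /\ mu (V `\` W) < d%:E).
Proof.
move=> mF Foo Fc d0; pose Om : set G := [set v | ((Delta v)^-1 < c)%R].
have oOm : open Om by exact: (open_DeltaV_lt hausG lcG haar modular).
have [V [oV FV] Vd] := outer_approx rad mF Foo d0.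
have oVO : open (V `&` Om) by exact: openI.
have mV := open_borel oV; have mVO := open_borel oVO.
have mVOF : measurable ((V `&` Om) `\` F : set (borel G)) by exact: measurableD.
have mVF : measurable (V `\` F : set (borel G)) by exact: measurableD.
have VOd : mu ((V `&` Om) `\` F) < d%:E.
  by apply: le_lt_trans Vd; apply: (borel_le mu mVOF mVF) => v [[]].
have FVO : F `<=` V `&` Om by move=> v Fv; split; [exact: FV|exact: Fc].
have VOoo : mu (V `&` Om) < +oo.
  apply: le_lt_trans (borel_leU mu mF mVOF mVO _) _; first by rewrite setDUK.
  by rewrite lte_add_pinfty// (lt_trans VOd)// ltry.
have [W [rW WV] Wd] := rc_approx hausG lcG rad oVO VOoo d0.
by exists (V `&` Om), W; split=> //; split=> // v [].
Qed.

(** The hypothesis of [step_dense], for twice the same measure. *)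
Lemma rc_approx_borel (A : set (borel G)) : measurable A -> mu A < +oo -> mu A < +oo ->
  forall e : R, (0 < e)%R -> exists2 W, rc W &
  mu ((A `\` W) `|` (W `\` A)) < e%:E /\ mu ((A `\` W) `|` (W `\` A)) < e%:E.
Proof.
move=> mA Aoo _ e e0; have e20 : (0 < e / 2)%R by rewrite divr_gt0.
have [V [oV AV] Ve] := outer_approx rad mA Aoo e20.
have mV := open_borel oV.
have mVA : measurable (V `\` A : set (borel G)) by exact: measurableD.
have Voo : mu V < +oo.
  apply: le_lt_trans (borel_leU mu mA mVA mV _) _; first by rewrite setDUK.
  by rewrite lte_add_pinfty// (lt_trans Ve)// ltry.
have [W [rW WV] We] := rc_approx hausG lcG rad oV Voo e20.
have mW := rc_borel rW.
have mVW : measurable (V `\` W : set (borel G)) by exact: measurableD.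
have mS : measurable ((A `\` W) `|` (W `\` A) : set (borel G)).
  by apply: measurableU; exact: measurableD.
suff H : mu ((A `\` W) `|` (W `\` A)) < e%:E by exists W.
apply: le_lt_trans (borel_leU mu mVA mVW mS _) _; last by rewrite [e]splitr EFinD lteD.
by move=> v [[/AV Vv nW]|[/WV Vv nA]]; [right|left].
Qed.

End haar_density.

Section inv_measure.
Context {R : realType} {G : topologicalGroupType}.
Variable mu : {measure set (borel G) -> \bar R}.
Local Open Scope ereal_scope.

Definition inv_measure (A : set (borel G)) := mu [set t | A (t^-1)%g].

Let inv0 : inv_measure set0 = 0.
Proof. exact: measure0. Qed.

Let inv_ge0 A : 0 <= inv_measure A.
Proof. exact: measure_ge0. Qed.

Let inv_sigma_additive : semi_sigma_additive inv_measure.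
Proof.
move=> F mF tF mUF; rewrite /inv_measure.
have -> : [set t | (\bigcup_n F n) (t^-1)%g] = \bigcup_n [set t | F n (t^-1)%g].
  by apply/seteqP; split=> t [n _ h]; exists n.
apply: (@measure_semi_sigma_additive _ _ _ mu (fun n => [set t : borel G | F n (t^-1)%g])).
- by move=> n; exact: measurable_invg.
- by apply/trivIsetP => i j _ _ ij; apply/seteqP; split=> // t [Fi Fj];
    have /trivIsetP/(_ i j Logic.I Logic.I ij) := tF;
    move=> /seteqP[/(_ (t^-1)%g) + _]; apply.
- by apply: bigcup_measurable => n _; exact: measurable_invg.
Qed.

HB.instance Definition _ := isMeasure.Build _ _ _
  inv_measure inv0 inv_ge0 inv_sigma_additive.

Lemma integral_inv_measure (h : borel G -> \bar R) : measurable_fun setT h ->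
  (forall t, 0 <= h t) -> \int[inv_measure]_t h t = \int[mu]_t h (t^-1)%g.
Proof.
move=> mh h0.
have minv : measurable_fun setT (fun t : borel G => (t^-1)%g : borel G).
  by apply: continuous_borel_measurable; exact: invg_continuous.
rewrite -[RHS](@ge0_integral_pushforward _ _ _ _ _ _ minv mu setT)//.
Qed.

End inv_measure.

Section haar_density2.
Context {R : realType} {G : topologicalGroupType}.
Variables (mu : {measure set (borel G) -> \bar R}) (Delta : G -> R).
Hypotheses (hausG : hausdorff_space G) (lcG : locally_compact [set: G]).
Hypotheses (haar : left_haar mu) (modular : modular_function mu Delta).
Implicit Types (s t u : G) (U V W K E Z : set G).
Local Open Scope ereal_scope.

Let rad : radon mu. Proof. by case: haar. Qed.

(** The hypothesis of [step_dense], for [mu] and its image by the inversion. On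
    the sets where [Delta^-1 < n] that image is at most [n * mu], so that the
    regularity of [mu] is enough, and they exhaust [A] for both measures. *)
Lemma rc_approx_borel_inv (A : set (borel G)) : measurable A -> mu A < +oo -> inv_measure mu A < +oo ->
  forall e : R, (0 < e)%R -> exists2 W, rc W &
  mu ((A `\` W) `|` (W `\` A)) < e%:E /\ inv_measure mu ((A `\` W) `|` (W `\` A)) < e%:E.
Proof.
move=> mA A1 A2 e e0.
have [F [mF ndF FA Fn]] := DeltaV_exhaust hausG lcG haar modular mA.
have FsubA n : F n `<=` A by rewrite -FA; exact: bigcup_sup.
have small (m : {measure set (borel G) -> \bar R}) (r : R) : m A < +oo -> (0 < r)%R ->
    \forall n \near \oo, m (A `\` F n) < r%:E.
  move=> moo r0.
  have : m (F n) @[n --> \oo] --> m A.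
    by rewrite -[in X in _ --> X]FA; apply: nondecreasing_cvg_mu => //; exact: bigcup_measurable.
  have mfin : m A \is a fin_num by rewrite ge0_fin_numE.
  have lt : (m A - r%:E < m A) by rewrite lteBlDr// lteDl// lte_fin.
  move=> c.
  have h : \forall n \near \oo, m A - r%:E < m (F n) by exact: (c _ (open_ereal_gt' lt)).
  apply: filterS h => n h.
  rewrite measureD// (setIidr (FsubA n)) lteBlDr; last first.
    by rewrite ge0_fin_numE// (le_lt_trans (borel_le m (mF n) mA (FsubA n))).
  by rewrite addeC -lteBlDr.
have e30 : (0 < e / 4)%R by rewrite divr_gt0.
have [n [n1 n2]] := @filter_ex _ _ eventually_filter _
  (@filterI _ _ _ _ _ (small mu _ A1 e30) (small (inv_measure mu) _ A2 e30)).
pose d := (e / 4 / n.+1%:R)%R.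
have d0 : (0 < d)%R by rewrite !divr_gt0.
have de : (d <= e / 4)%R by rewrite ler_pdivrMr// ler_peMr// ?ler1n// ltW.
have nde : (n%:R * d <= e / 4)%R.
  by rewrite /d mulrCA ler_piMr// ?(ltW e30)// ler_pdivrMr// mul1r ler_nat.
have Foo : mu (F n) < +oo by exact: le_lt_trans (borel_le mu (mF n) mA (FsubA n)) A1.
have [V [W [[oV rW WV FV Vn] [VF VW]]]] := open_rc_approx hausG lcG haar modular (mF n) Foo (Fn n) d0.
have mV := open_borel oV; have mW := rc_borel rW; have mFn := mF n.
have mVF : measurable (V `\` F n : set (borel G)) by exact: measurableD.
have mVW : measurable (V `\` W : set (borel G)) by exact: measurableD.
have mAF : measurable (A `\` F n : set (borel G)) by exact: measurableD.
have mU : measurable ((V `\` F n) `|` (V `\` W) : set (borel G)) by exact: measurableU.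
have mS : measurable ((A `\` W) `|` (W `\` A) : set (borel G)).
  by apply: measurableU; exact: measurableD.
have sub : (A `\` W) `|` (W `\` A) `<=` (A `\` F n) `|` ((V `\` F n) `|` (V `\` W)).
  move=> v [[Av nW]|[Wv nA]].
    by have [Fv|nF] := pselect (F n v); [right; right; split=> //; exact: FV|left].
  by right; left; split; [exact: WV|move=> /FsubA].
have fin (m : {measure set (borel G) -> \bar R}) : m (A `\` F n) < (e / 4)%:E ->
    m (V `\` F n) <= (e / 4)%:E -> m (V `\` W) <= (e / 4)%:E ->
    m ((A `\` W) `|` (W `\` A)) < e%:E.
  move=> h1 h2 h3; apply: le_lt_trans (borel_leU m mAF mU mS sub) _.
  have h4 : m ((V `\` F n) `|` (V `\` W)) <= (e / 4 + e / 4)%:E.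
    by apply: le_trans (measureU2 m mVF mVW) _; rewrite EFinD leeD.
  apply: (@lt_le_trans _ _ ((e / 4)%:E + (e / 4 + e / 4)%:E)).
    by rewrite lte_leD// ge0_fin_numE// (le_lt_trans h4)// ltry.
  by rewrite -EFinD lee_fin; lra.
have inv_small (B : set (borel G)) : measurable B -> B `<=` V -> mu B < d%:E ->
    inv_measure mu B <= (e / 4)%:E.
  move=> mB BV Bd.
  have Bn v : B v -> ((Delta v)^-1 < n%:R)%R by move=> /BV; exact: Vn.
  rewrite /inv_measure (mu_invg_small hausG lcG haar modular mB (lt_trans Bd (ltry _)) Bn).
  apply: le_trans (integral_DeltaV_bound hausG lcG haar modular mB (fun v Bv => ltW (Bn v Bv))) _.
  apply: (@le_trans _ _ (n%:R%:E * d%:E)); last by rewrite -EFinM lee_fin.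
  by apply: lee_wpmul2l; [rewrite lee_fin|exact: ltW].
exists W => //; split; apply: fin => //.
- by rewrite (le_trans (ltW VF))// lee_fin.
- by rewrite (le_trans (ltW VW))// lee_fin.
- by apply: inv_small => // v [].
- by apply: inv_small => // v [].
Qed.

End haar_density2.

(** * Left translations of L^p *)

Section bop_facts.
Context {K : numFieldType} {V : normedModType K}.
Implicit Types (A B : bop V) (u v : V).

Lemma bopD A u v : A (u + v) = A u + A v.
Proof. by have := bop_linear A 1 u v; rewrite !scale1r. Qed.

Lemma bop0 A : A 0 = 0.
Proof. by apply: (addrI (A 0)); rewrite -bopD !addr0. Qed.

Lemma bopZ A c u : A (c *: u) = c *: A u.
Proof. by have := bop_linear A c u 0; rewrite bop0 !addr0. Qed.

Lemma bopN A u : A (- u) = - A u.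
Proof. by rewrite -scaleN1r bopZ scaleN1r. Qed.

Lemma bopB A u v : A (u - v) = A u - A v.
Proof. by rewrite bopD bopN. Qed.

End bop_facts.

Section translation_Lp.
Context {R : realType} {G : topologicalGroupType}.
Variables (mu : {measure set (borel G) -> \bar R}).
Hypotheses (hausG : hausdorff_space G) (lcG : locally_compact [set: G]).
Hypothesis haar : left_haar mu.
Variables (p : R) (p1 : 1 <= p).
Implicit Types (s t : G) (U V W K E Z : set G) (c : R[i]) (u v : Lp mu p1).

Let rad : radon mu. Proof. by case: haar. Qed.

Definition ltrans s : bop (Lp mu p1) := wcomp_bop p1 (lambda_subproof haar s).

Lemma in_Lp_ltrans s (f : borel G -> R[i]) : f \in Lp_pred mu p1 ->
  (fun t => f (s^-1 * t)%g) \in Lp_pred mu p1.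
Proof.
move=> hf; have := wcomp_subproof (lambda_subproof haar s) (MkLpFun hf).
by rewrite /wcomp (_ : (fun t => _) = (fun t => f (s^-1 * t)%g))//; apply/funext => t; rewrite mul1r.
Qed.

Lemma ltrans_toLp s (f : borel G -> R[i]) : f \in Lp_pred mu p1 ->
  ltrans s (toLp mu p1 f) = toLp mu p1 (fun t => f (s^-1 * t)%g).
Proof.
move=> hf; rewrite (toLpE hf) (toLpE (in_Lp_ltrans s hf)).
rewrite [LHS](wcomp_LpE (lambda_subproof haar s)); congr (Lp_class _); apply: val_inj.
by apply/funext => t; exact: mul1r.
Qed.

Lemma ltransM s t u : ltrans s (ltrans t u) = ltrans (s * t)%g u.
Proof.
have hu := Lp_repr_in u; rewrite -(toLpK u) ltrans_toLp// ltrans_toLp; last exact: in_Lp_ltrans.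
rewrite ltrans_toLp//; congr toLp; apply/funext => x.
by rewrite invgM mulgA.
Qed.

Lemma ltrans1 u : ltrans 1%g u = u.
Proof.
rewrite -(toLpK u) ltrans_toLp ?Lp_repr_in//; congr toLp; apply/funext => x.
by rewrite invg1 mul1g.
Qed.

Lemma ltrans_norm s u : Lp_norm (ltrans s u) = Lp_norm u.
Proof.
have hu := Lp_repr_in u; rewrite -(toLpK u) ltrans_toLp// !toLp_norm//; last exact: in_Lp_ltrans.
congr fine; have := @cLnorm_wcomp _ _ _ _ p _ _ (lambda_subproof haar s) _ (LpFun_cmeasurable (Lp_repr u)).
by rewrite /wcomp (_ : (fun t => _) = (fun t => Lp_repr u (s^-1 * t)%g))//; apply/funext => t; rewrite mul1r.
Qed.

Lemma cLnorm_cindic c (A : set (borel G)) : measurable A ->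
  (cLnorm mu p (cindic c A) = ((normc c `^ p)%:E * mu A) `^ p^-1)%E.
Proof.
by move=> mA; rewrite cLnormE (@cLnorm_indic _ _ mu p _ c A)// => t; exact: normc_cindic.
Qed.

Lemma cindic_in c (A : set (borel G)) : measurable A -> (mu A < +oo)%E ->
  cindic c A \in Lp_pred mu p1.
Proof.
move=> mA Aoo; apply/Lp_predP; split; first exact: cmeasurable_cindic.
by rewrite cLnorm_cindic//; apply: poweR_lty; rewrite lte_mul_pinfty// lee_fin powR_ge0.
Qed.

Lemma rc_cindic_in c W : rc W -> cindic c W \in Lp_pred mu p1.
Proof. by move=> rW; apply: cindic_in; [exact: rc_borel|exact: (rc_finite hausG rad)]. Qed.

Lemma step_in (y : borel G -> R[i]) : step_fun y -> y \in Lp_pred mu p1.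
Proof. by elim=> [c W rW|f g _ hf _ hg]; [exact: rc_cindic_in|exact: in_LpD]. Qed.

Definition ind c W : Lp mu p1 := toLp mu p1 (cindic c W).

Lemma toLp_step_ind (P : Lp mu p1 -> Prop) : (forall c W, rc W -> P (ind c W)) ->
  (forall u v, P u -> P v -> P (u + v)) -> forall y, step_fun y -> P (toLp mu p1 y).
Proof.
move=> Pi PD y; elim=> [c W rW|f g sf Pf sg Pg]; first exact: Pi.
by rewrite toLpD; [exact: PD|exact: step_in..].
Qed.

Lemma ltrans_ind s c W : rc W -> ltrans s (ind c W) = ind c [set t | W (s^-1 * t)%g].
Proof. by move=> rW; rewrite ltrans_toLp//; exact: rc_cindic_in. Qed.

Lemma indZ a c W : rc W -> ind (a * c) W = a *: ind c W.
Proof.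
move=> rW; rewrite -toLpZ; last exact: rc_cindic_in.
by congr toLp; apply/funext => t; rewrite /cindic mulrA.
Qed.

Lemma Lp_step_dense u (e : R) : 0 < e ->
  exists2 y, step_fun y & Lp_norm (u - toLp mu p1 y) < e.
Proof.
move=> e0; have /Lp_predP[mu_ uoo] := Lp_repr_in u.
have [y sy [y1 _]] := step_dense p1 p1 (rc_approx_borel hausG lcG haar) mu_ uoo uoo e0.
exists y => //; have hy := step_in sy; have hu := Lp_repr_in u.
have hN : (fun t => -1 * y t) \in Lp_pred mu p1 by exact: in_LpZ.
have -> : u - toLp mu p1 y = toLp mu p1 (fun t => Lp_repr u t + -1 * y t).
  by rewrite toLpD// toLpK toLpZ// scaleN1r.
rewrite toLp_norm; last exact: in_LpD.
rewrite -lte_fin fineK; last first.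
  by rewrite ge0_fin_numE ?cLnorm_ge0//; have /Lp_predP[] := in_LpD hu hN.
by rewrite (_ : (fun t => _) = (fun t => Lp_repr u t - y t))//; apply/funext => t; rewrite mulN1r.
Qed.

(** Density of the step functions, in the form in which it serves below: two
    expressions that are additive and bounded in [u] need only be compared on
    indicators. *)
Lemma functional_eq0 (L : Lp mu p1 -> R) (C : R) :
  (forall u v, L (u + v) = L u + L v) -> (forall u, `|L u| <= C * Lp_norm u) ->
  (forall c W, rc W -> L (ind c W) = 0) -> forall u, L u = 0.
Proof.
move=> LD LC Li u; apply/eqP; rewrite -normr_eq0 eq_le normr_ge0 andbT.
apply/ler_addgt0Pr => e e0; rewrite add0r.
have C0 : 0 < `|C| + 1 by rewrite ltr_wpDl.
have [y sy ye] := Lp_step_dense u (divr_gt0 e0 C0).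
have Ly : L (toLp mu p1 y) = 0.
  by apply: (@toLp_step_ind (fun v => L v = 0)) => // v w; rewrite LD => -> ->; rewrite addr0.
rewrite -[u](subrK (toLp mu p1 y)) LD Ly addr0 (le_trans (LC _))//.
apply: (@le_trans _ _ ((`|C| + 1) * Lp_norm (u - toLp mu p1 y))).
  by rewrite ler_wpM2r ?Lp_norm_ge0// (le_trans (ler_norm _))// lerDl.
by rewrite mulrC -ler_pdivlMr// ltW.
Qed.

Definition continuous_Lp (F : G -> Lp mu p1) := forall s (e : R), 0 < e ->
  \forall t \near s, Lp_norm (F t - F s) < e.

(** The set [W] and its translate differ by subsets of [W \ K] and of its
    translate, for a compact [K] that nearly fills [W]. *)
Lemma ind_near1 c W (e : R) : rc W -> 0 < e ->
  \forall s \near (1%g : G), Lp_norm (ltrans s (ind c W) - ind c W) < e.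
Proof.
move=> rW e0; have oW := rc_open rW; have mW := rc_borel rW.
have Woo := rc_finite hausG rad rW.
pose d := e `^ p / (2 * (normc c `^ p + 1)).
have c0 : 0 < normc c `^ p + 1 by rewrite ltr_wpDl ?powR_ge0.
have d0 : 0 < d by rewrite divr_gt0 ?powR_gt0// mulr_gt0.
have [K [cK KW] WK] := compact_approx hausG haar oW Woo d0.
have mK := compact_borel hausG cK.
have mWK : measurable (W `\` K : set (borel G)) by exact: measurableD.
have cf : continuous (fun x : G * G => (x.2 * x.1)%g : G).
  by apply: continuous_mulg; [exact: continuous_snd|exact: continuous_fst].
have cg := @continuous_mulVg G.
have near1 := compact_near1 cf (fun t => mul1g t) cK oW KW.
have g1 (t : G) : (1^-1 * t)%g = t by rewrite invg1 mul1g.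
have near2 := compact_near1 cg g1 cK oW KW.
apply: filterS2 near1 near2 => s sK sVK.
pose sW := [set t | W (s^-1 * t)%g].
have rsW : rc sW by exact: rc_mulgl.
have msW := rc_borel rsW.
rewrite ltrans_ind// -/sW.
have hsW := rc_cindic_in c rsW; have hW := rc_cindic_in c rW.
have hN : (fun t => -1 * cindic c W t) \in Lp_pred mu p1 by exact: in_LpZ.
have hD := in_LpD hsW hN.
have -> : ind c sW - ind c W = toLp mu p1 (fun t => cindic c sW t + -1 * cindic c W t).
  by rewrite toLpD// (toLpZ (-1) hW) scaleN1r.
rewrite toLp_norm// -lte_fin fineK; last first.
  by rewrite ge0_fin_numE ?cLnorm_ge0//; have /Lp_predP[] := hD.
apply: (cLnorm_lt p1 e0).
have mD : measurable ((sW `\` W) `|` (W `\` sW) : set (borel G)).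
  by apply: measurableU; exact: measurableD.
rewrite (@cLnorm_indic _ _ mu p _ c ((sW `\` W) `|` (W `\` sW)))//; last first.
  by move=> t; rewrite mulN1r; exact: normc_cindic_diff.
have mWK' : measurable ([set t | (W `\` K) (s^-1 * t)%g] : set (borel G)).
  exact: measurable_mulgl.
have : (mu ((sW `\` W) `|` (W `\` sW)) < (d + d)%:E)%E.
  apply: (@le_lt_trans _ _ (mu [set t | (W `\` K) (s^-1 * t)%g] + mu (W `\` K))%E).
    apply: borel_leU => // t [[sWt nW]|[Wt nsW]]; [left|right]; split=> //.
      by move=> Kt; apply: nW; have := sK _ Kt; rewrite mulVKg.
    by move=> Kt; apply: nsW; exact: sVK.
  by rewrite (mu_mulgl haar)// EFinD lteD.
set x := mu _ => xd.
have xfin : x \is a fin_num by rewrite ge0_fin_numE ?measure_ge0// (lt_trans xd)// ltry.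
move: xd; rewrite -(fineK xfin) -EFinM !lte_fin => xd.
apply: (@le_lt_trans _ _ ((normc c `^ p + 1) * fine x)).
  by rewrite ler_wpM2r ?lerDl// fine_ge0// measure_ge0.
rewrite mulrC -ltr_pdivlMr// (lt_le_trans xd)// /d le_eqVlt; apply/orP; left; apply/eqP.
by field; rewrite gt_eqF.
Qed.

Lemma ltrans_near1 u (e : R) : 0 < e ->
  \forall s \near (1%g : G), Lp_norm (ltrans s u - u) < e.
Proof.
move=> e0; have e30 : 0 < e / 3 by rewrite divr_gt0.
have [y sy ye] := Lp_step_dense u e30.
have ny : \forall s \near (1%g : G), Lp_norm (ltrans s (toLp mu p1 y) - toLp mu p1 y) < e / 3.
  move: y sy {ye} (e / 3) e30.
  apply: (@toLp_step_ind (fun v => forall e : R, 0 < e ->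
    \forall s \near (1%g : G), Lp_norm (ltrans s v - v) < e)).
    by move=> c W rW r r0; exact: ind_near1.
  move=> v w nv nw r r0; have r20 : 0 < r / 2 by rewrite divr_gt0.
  apply: filterS2 (nv _ r20) (nw _ r20) => s sv sw.
  rewrite bopD opprD addrACA [r]splitr (le_lt_trans (Lp_normD _ _))//; exact: ltrD.
apply: filterS ny => s sy'.
have -> : ltrans s u - u = (ltrans s (u - toLp mu p1 y) + (ltrans s (toLp mu p1 y) - toLp mu p1 y))
    + (toLp mu p1 y - u).
  by rewrite bopB !subrKA.
rewrite (le_lt_trans (Lp_normD _ _))// (_ : e = e / 3 + e / 3 + e / 3); last by lra.
rewrite ltrD//; last by rewrite Lp_normB.
by rewrite (le_lt_trans (Lp_normD _ _))// ltrD// ltrans_norm.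
Qed.

Lemma ltrans_continuous u : continuous_Lp (ltrans^~ u).
Proof.
move=> s e e0.
have c : (s^-1 * t)%g @[t --> s] --> (1%g : G).
  by have := @mulgl_continuous G (s^-1)%g s; rewrite /continuous_at mulVg.
have h : \forall t \near s, Lp_norm (ltrans (s^-1 * t)%g u - u) < e.
  exact: (c _ (ltrans_near1 u e0)).
by apply: filterS h => t; rewrite -(ltrans_norm s) bopB ltransM mulVKg.
Qed.

End translation_Lp.

(** * The flip *)

Section flip.
Context {R : realType} {G : topologicalGroupType}.
Variables (mu : {measure set (borel G) -> \bar R}) (Delta : G -> R).
Hypotheses (hausG : hausdorff_space G) (lcG : locally_compact [set: G]).
Hypotheses (haar : left_haar mu) (modular : modular_function mu Delta).
Variables (p : R) (p1 : 1 < p).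
Implicit Types (s t : G) (f g : borel G -> R[i]).

Local Notation LpG := (Lp mu (ltW p1)).
Implicit Types u v : LpG.

Let D0 := Delta_gt0 modular.
Let p0 : 0 < p. Proof. exact: lt_trans p1. Qed.

Definition flip f : borel G -> R[i] := fun t => (Delta (t^-1)%g `^ p^-1)%:C%C * f (t^-1)%g.

Lemma measurable_inv : measurable_fun setT (fun t : borel G => (t^-1)%g : borel G).
Proof. by apply: continuous_borel_measurable; exact: invg_continuous. Qed.

Lemma cmeasurable_flip f : cmeasurable f -> cmeasurable (flip f).
Proof.
move=> mf; apply: cmeasurableM; last exact: (cmeasurable_comp measurable_inv mf).
apply: cmeasurable_real; apply: (@measurableT_comp _ _ _ _ _ _ (fun x : R => x `^ p^-1)).
  exact: measurable_powR.
exact: (measurableT_comp (measurable_Delta hausG lcG haar modular) measurable_inv).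
Qed.

Lemma normc_flip f t : normc (flip f t) `^ p = (Delta t)^-1 * normc (f (t^-1)%g) `^ p.
Proof.
rewrite /flip Normc.normcM normc_real ger0_norm ?powR_ge0// powRM ?powR_ge0 ?normc_ge0//.
rewrite -powRrM mulVf ?lt0r_neq0// powRr1 ?(ltW (D0 _))//.
by rewrite (DeltaV hausG lcG haar modular).
Qed.

Lemma flip_in f : f \in Lp_pred mu (ltW p1) ->
  flip f \in Lp_pred mu (ltW p1) /\ cLnorm mu p (flip f) = cLnorm mu p f.
Proof.
move=> /Lp_predP[mf foo].
have e : cLnorm mu p (flip f) = cLnorm mu p f.
  rewrite !cLnormE.
  have -> // : (\int[mu]_t (normc (flip f t) `^ p)%:E = \int[mu]_t (normc (f t) `^ p)%:E)%E.
  rewrite -(integral_invg hausG lcG haar modular (measurable_normc_powR p mf)).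
  - by apply: eq_integral => t _; rewrite normc_flip EFinM.
  - by move=> t; rewrite lee_fin powR_ge0.
  - exact/(cLnorm_lty mu (ltW p1)).
split=> //; apply/Lp_predP; split; first exact: cmeasurable_flip.
by rewrite e.
Qed.

Lemma flip_ae f g : f = g %[ae mu] -> flip f = flip g %[ae mu].
Proof.
move=> [N [mN N0 fgN]]; exists [set t | N (t^-1)%g]; split.
- exact: measurable_invg.
- exact: (null_invg hausG lcG haar modular).
- move=> t /= nt; apply: fgN => /= fg; apply: nt => _.
  by rewrite /flip fg.
Qed.

Lemma flipK f : flip (flip f) = f.
Proof.
apply/funext => t; rewrite /flip invgK mulrA -rmorphM/= -powRM ?(ltW (D0 _))//.
rewrite -(DeltaM hausG lcG haar modular) mulVg (Delta1 hausG lcG haar modular).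
by rewrite powR1 mul1r.
Qed.

Definition flipLp u : LpG := toLp mu (ltW p1) (flip (Lp_repr u)).

Lemma flipLp_toLp f : f \in Lp_pred mu (ltW p1) ->
  flipLp (toLp mu (ltW p1) f) = toLp mu (ltW p1) (flip f).
Proof.
move=> hf; have [hf' _] := flip_in hf.
have [hg' _] := flip_in (Lp_repr_in (toLp mu (ltW p1) f)).
by apply: toLp_eq => //; apply: flip_ae; exact: toLp_ae.
Qed.

Lemma flipLp_norm u : Lp_norm (flipLp u) = Lp_norm u.
Proof.
have [hf e] := flip_in (Lp_repr_in u).
by rewrite /flipLp toLp_norm// e.
Qed.

Lemma flipLp_bop : flipLp \in bop_pred.
Proof.
apply/bop_predP; split.
  move=> a u v; have hu := Lp_repr_in u; have hv := Lp_repr_in v.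
  rewrite -{1}(toLpK u) -{1}(toLpK v) -toLpZ// -toLpD//; last exact: in_LpZ.
  rewrite flipLp_toLp; last by apply: in_LpD => //; exact: in_LpZ.
  have [hfu _] := flip_in hu; have [hfv _] := flip_in hv.
  rewrite /flipLp -toLpZ// -toLpD//; last exact: in_LpZ.
  by congr toLp; apply/funext => t; rewrite /flip mulrDr mulrCA.
by exists 1 => u; rewrite mul1r !Lp_normE lecR flipLp_norm.
Qed.

Definition flip_bop : bop LpG := MkBop flipLp_bop.

Lemma flip_bop_toLp f : f \in Lp_pred mu (ltW p1) ->
  flip_bop (toLp mu (ltW p1) f) = toLp mu (ltW p1) (flip f).
Proof. exact: flipLp_toLp. Qed.

Lemma flip_bopE u : (Lp_repr (flip_bop u) : G -> R[i]) =
  (fun t => (Delta (t^-1)%g `^ p^-1)%:C%C * Lp_repr u (t^-1)%g) %[ae mu].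
Proof. by have [hu _] := flip_in (Lp_repr_in u); exact: (toLp_ae hu). Qed.

Lemma flip_bopK u : flip_bop (flip_bop u) = u.
Proof.
have hu := Lp_repr_in u; have [hf _] := flip_in hu.
by rewrite -(toLpK u) flip_bop_toLp// flip_bop_toLp// flipK.
Qed.

Lemma flip_bop_norm u : Lp_norm (flip_bop u) = Lp_norm u.
Proof. exact: flipLp_norm. Qed.

Lemma rho_in s f : f \in Lp_pred mu (ltW p1) ->
  (fun t => (Delta s `^ p^-1)%:C%C * f (t * s)%g) \in Lp_pred mu (ltW p1).
Proof. by move=> hf; exact: (wcomp_subproof (rho_subproof modular p1 s) (MkLpFun hf)). Qed.

Lemma rho_toLp s f : f \in Lp_pred mu (ltW p1) -> rho modular p1 s (toLp mu (ltW p1) f) =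
  toLp mu (ltW p1) (fun t => (Delta s `^ p^-1)%:C%C * f (t * s)%g).
Proof.
move=> hf; rewrite (toLpE hf) (toLpE (rho_in s hf)).
rewrite [LHS](wcomp_LpE (rho_subproof modular p1 s)); congr (Lp_class _); exact: val_inj.
Qed.

Lemma lambda_toLp s f : f \in Lp_pred mu (ltW p1) ->
  lambda haar p1 s (toLp mu (ltW p1) f) = toLp mu (ltW p1) (fun t => f (s^-1 * t)%g).
Proof. by move=> hf; exact: (ltrans_toLp haar s hf). Qed.

Lemma rho_flip_lambda s : rho modular p1 s = bop_comp flip_bop (bop_comp (lambda haar p1 s) flip_bop).
Proof.
apply: bop_ext => u; rewrite /=; have hu := Lp_repr_in u; have [hf _] := flip_in hu.
rewrite -[u in LHS]toLpK -[u in RHS]toLpK -[RHS]/(flip_bop (lambda haar p1 s (flip_bop _))).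
rewrite -[LHS]/(rho modular p1 s _) rho_toLp// flip_bop_toLp// lambda_toLp//.
have hl : (fun t => flip (Lp_repr u) (s^-1 * t)%g) \in Lp_pred mu (ltW p1).
  exact: (in_Lp_ltrans haar).
rewrite flip_bop_toLp//; congr toLp; apply/funext => t.
rewrite /flip invgM !invgK mulrA -rmorphM/= -powRM ?(ltW (D0 _))//.
by rewrite -(DeltaM hausG lcG haar modular) mulKg.
Qed.

Lemma lambda_rho_comm s t :
  bop_comp (lambda haar p1 s) (rho modular p1 t) = bop_comp (rho modular p1 t) (lambda haar p1 s).
Proof.
apply: bop_ext => u; have hu := Lp_repr_in u.
rewrite -[LHS]/(lambda haar p1 s (rho modular p1 t u)).
rewrite -[RHS]/(rho modular p1 t (lambda haar p1 s u)) -(toLpK u).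
rewrite rho_toLp// lambda_toLp; last exact: rho_in.
rewrite lambda_toLp// rho_toLp; last exact: (in_Lp_ltrans haar).
by congr toLp; apply/funext => x; rewrite mulgA.
Qed.

Lemma rho_continuous u : continuous_Lp (fun s => rho modular p1 s u).
Proof.
move=> s e e0.
apply: filterS (ltrans_continuous hausG lcG haar (flip_bop u) s e0) => t ht.
rewrite !rho_flip_lambda.
change (Lp_norm (flip_bop (lambda haar p1 t (flip_bop u)) - flip_bop (lambda haar p1 s (flip_bop u))) < e).
by rewrite -bopB flip_bop_norm.
Qed.

End flip.

(** * Weak integrals of continuous L^p-valued functions *)

Section bounded_functional.
Context d (T : measurableType d) (R : realType).
Variables (mu : {measure set T -> \bar R}) (p : R) (p1 : 1 <= p).

(** Linearity over the reals is what the real-valued [pairing] satisfies. *)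
Definition bounded_functional (L : Lp mu p1 -> R) (C : R) :=
  [/\ forall u v, L (u + v) = L u + L v, forall (a : R) u, L (a%:C%C *: u) = a * L u
    & forall u, `|L u| <= C * Lp_norm u].

Lemma functionalB L C u v : bounded_functional L C -> L (u - v) = L u - L v.
Proof.
move=> [LD LZ _]; rewrite LD; congr (_ + _).
by rewrite -scaleN1r -[(-1)](rmorphN1 (real_complex R)) LZ mulN1r.
Qed.

Lemma functional_comp L C (A : bop (Lp mu p1)) : 0 <= C -> bounded_functional L C ->
  exists2 D, 0 <= D & bounded_functional (L \o A) D.
Proof.
move=> C0 [LD LZ LC]; have [D D0 AD] := bop_Lp_bound A.
exists (C * D); first exact: mulr_ge0.
split=> [u v|a u|u] /=; rewrite ?bopD ?bopZ//.
by rewrite (le_trans (LC _))// -mulrA ler_wpM2l.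
Qed.

End bounded_functional.

Lemma integrable_cst_fin d (T : measurableType d) (R : realType)
    (mu : {measure set T -> \bar R}) (Y : set T) (k : R) : measurable Y ->
  (mu Y < +oo)%E -> mu.-integrable Y (EFin \o (fun=> k)).
Proof.
move=> mY Yoo; apply: measurable_bounded_integrable => //.
exists `|k|; split; first exact: num_real.
by move=> x kx t _; exact: ltW.
Qed.

Section weak_integral.
Context {R : realType} {G : topologicalGroupType}.
Variables (mu : {measure set (borel G) -> \bar R}).
Hypotheses (hausG : hausdorff_space G) (lcG : locally_compact [set: G]).
Hypothesis haar : left_haar mu.
Variables (p q : R) (p1 : 1 <= p) (q1 : 1 <= q).
Hypothesis pq : p^-1 + q^-1 = 1.
Local Notation LpG := (Lp mu p1).
Local Notation LqG := (Lp mu q1).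
Implicit Types (s t : G) (X Y U W K : set G) (u v : LpG) (xi : LqG) (F : G -> LpG).

Let rad : radon mu. Proof. by case: haar. Qed.

Lemma pairing_functional xi : bounded_functional (pairing xi : LpG -> R) (Lp_norm xi).
Proof.
split=> [u v|a u|u]; [exact: (pairingDr pq)|exact: (pairing_realZ pq)|exact: (pairing_le pq)].
Qed.

Lemma functional_continuous F (L : LpG -> R) C : 0 <= C -> bounded_functional L C ->
  continuous_Lp F -> continuous (L \o F : G -> R).
Proof.
move=> C0 Lb cF s; apply/cvgrPdist_lt => e e0 /=.
have C1 : 0 < C + 1 by rewrite ltr_wpDl.
apply: filterS (cF s _ (divr_gt0 e0 C1)) => t lt.
rewrite distrC -(functionalB _ _ Lb); have [_ _ LC] := Lb.
apply: le_lt_trans (LC _) _.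
apply: (@le_lt_trans _ _ ((C + 1) * Lp_norm (F t - F s))).
  by rewrite ler_wpM2r ?Lp_norm_ge0// lerDl.
by rewrite mulrC -ltr_pdivlMr.
Qed.

Lemma continuous_Lp_bop F (A : bop LpG) : continuous_Lp F -> continuous_Lp (A \o F).
Proof.
move=> cF s e e0; have [C C0 AC] := bop_Lp_bound A.
have C1 : 0 < C + 1 by rewrite ltr_wpDl.
apply: filterS (cF s _ (divr_gt0 e0 C1)) => t lt.
rewrite /= -bopB; apply: le_lt_trans (AC _) _.
apply: (@le_lt_trans _ _ ((C + 1) * Lp_norm (F t - F s))).
  by rewrite ler_wpM2r ?Lp_norm_ge0// lerDl.
by rewrite mulrC -ltr_pdivlMr.
Qed.

Lemma continuous_Lp_bounded F X : continuous_Lp F -> rc X ->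
  exists2 M : R, 0 <= M & forall t, X t -> Lp_norm (F t) <= M.
Proof.
move=> cF [_ [K cK XK]].
have [| | | |U [oU [M M0 UM]] KU] := @compact_directed _
    (fun U => open U /\ exists2 M : R, 0 <= M & forall t, U t -> Lp_norm (F t) <= M) K cK.
- by move=> U [].
- by exists set0; split; [exact: open0|exists 0].
- move=> U V [oU [M M0 UM]] [oV [N N0 VN]]; exists (U `|` V) => //.
  split; first exact: openU.
  exists (M + N); first exact: addr_ge0.
  by move=> t [/UM h|/VN h]; rewrite (le_trans h)// ?lerDl// lerDr.
- move=> t _; have := cF t 1 ltr01; rewrite /prop_near1 nbhsE => -[U [oU Ut] UF].
  exists U => //; split=> //; exists (1 + Lp_norm (F t)).
    by rewrite addr_ge0// Lp_norm_ge0.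
  move=> s /UF h; rewrite -[F s](subrK (F t)) (le_trans (Lp_normD _ _))//.
  by rewrite lerD2r ltW.
by exists M => // t /XK /KU; exact: UM.
Qed.

Lemma functional_integrable F (L : LpG -> R) C X (Y : set (borel G)) : 0 <= C ->
  bounded_functional L C -> continuous_Lp F -> rc X -> measurable Y -> Y `<=` X ->
  mu.-integrable Y (EFin \o (L \o F)).
Proof.
move=> C0 Lb cF rX mY YX.
have [M M0 XM] := continuous_Lp_bounded cF rX.
apply: measurable_bounded_integrable => //.
- by apply: le_lt_trans (rc_finite hausG rad rX); apply: borel_le => //; exact: rc_borel.
- apply: measurable_funTS; apply: continuous_borel_measurable_fun.
  exact: (functional_continuous C0 Lb cF).
- exists (C * M); split; first exact: num_real.
  move=> x Mx t Yt; have [_ _ LC] := Lb.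
  by rewrite /= (le_trans (LC _))// (le_trans _ (ltW Mx))// ler_wpM2l// XM//; exact: YX.
Qed.

(** The point is that [y] does not depend on [L]. The domains that admit such a
    [y] are stable under unions, and a domain on which [F] varies by less than [e]
    admits a multiple of a value of [F]. *)
Lemma riemann_sum F X (e : R) : continuous_Lp F -> rc X -> 0 < e ->
  exists y, forall L C, 0 <= C -> bounded_functional L C ->
    `|\int[mu]_(s in X) L (F s) - L y| <= C * e * fine (mu X).
Proof.
move=> cF rX e0; have [_ [K cK XK]] := rX.
have mX := rc_borel rX.
pose good (Y : set (borel G)) := exists y, forall L C, 0 <= C -> bounded_functional L C ->
    `|\int[mu]_(s in Y) L (F s) - L y| <= C * e * fine (mu Y).
have finY (Y : set (borel G)) : measurable Y -> Y `<=` X -> mu Y \is a fin_num.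
  move=> mY YX; rewrite ge0_fin_numE//.
  by apply: le_lt_trans (rc_finite hausG rad rX); exact: borel_le.
have [| | | |U [oU Ug] KU] := @compact_directed _
    (fun U => open U /\ forall Y : set (borel G), measurable Y -> Y `<=` X -> Y `<=` U -> good Y) K cK.
- by move=> U [].
- exists set0; split; first exact: open0.
  move=> Y _ _; rewrite subset0 => ->; exists 0 => L C C0 Lb.
  rewrite Rintegral_set0 sub0r normrN measure0 mulr0.
  by have [_ _ /(_ 0)] := Lb; rewrite Lp_norm0 mulr0.
- move=> U V [oU Ug] [oV Vg]; exists (U `|` V) => //; split; first exact: openU.
  move=> Y mY YX YUV; have mU := open_borel oU.
  have mYU : measurable (Y `&` U : set (borel G)) by exact: measurableI.
  have mYD : measurable (Y `\` U : set (borel G)) by exact: measurableD.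
  have [y yP] : good (Y `&` U) by apply: Ug => // t [] // /YX.
  have [z zP] : good (Y `\` U).
    by apply: Vg => // t [Yt nU]; [exact: YX|case: (YUV t Yt)].
  exists (y + z) => L C C0 Lb.
  have YE : Y = (Y `&` U) `|` (Y `\` U) by rewrite setUIDK.
  have disj : [disjoint Y `&` U & Y `\` U].
    by apply/disj_setPS => t [[_ Ut] [_ /(_ Ut)]].
  have -> : \int[mu]_(s in Y) L (F s) =
      \int[mu]_(s in Y `&` U) L (F s) + \int[mu]_(s in Y `\` U) L (F s).
    rewrite {1}YE Rintegral_setU// -YE.
    exact: (functional_integrable C0 Lb cF rX).
  have -> : fine (mu Y) = fine (mu (Y `&` U)) + fine (mu (Y `\` U)).
    rewrite {1}YE measureU//; last by apply/seteqP; split=> // t [[_ Ut] [_ /(_ Ut)]].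
    by rewrite fineD//; apply: finY => // t [] // /YX.
  have [LD _ _] := Lb; rewrite LD opprD addrACA mulrDr.
  by rewrite (le_trans (ler_normD _ _))// lerD// ?yP// zP.
- move=> s _; have := cF s e e0; rewrite /prop_near1 nbhsE => -[U [oU Us] UF].
  exists U => //; split=> // Y mY YX YU.
  exists ((fine (mu Y))%:C%C *: F s) => L C C0 Lb.
  have [LD LZ LC] := Lb; rewrite LZ mulrC -Rintegral_cst//.
  have iL := functional_integrable C0 Lb cF rX mY YX.
  have ic (k : R) : mu.-integrable Y (EFin \o (fun=> k)).
    by apply: integrable_cst_fin => //; rewrite -ge0_fin_numE// finY.
  rewrite -RintegralB//.
  apply: le_trans (le_normr_Rintegral mY _) _.
    have := @integrableB _ _ _ mu Y mY _ _ iL (ic (L (F s))).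
    by apply: eq_integrable.
  rewrite -Rintegral_cst//; apply: le_Rintegral => //.
    apply: integrable_norm.
    have := @integrableB _ _ _ mu Y mY _ _ iL (ic (L (F s))).
    by apply: eq_integrable.
  move=> t Yt; rewrite -(functionalB _ _ Lb) (le_trans (LC _))// ler_wpM2l// ltW//.
  exact: (UF t (YU t Yt)).
by apply: Ug => // t /XK /KU.
Qed.

(** Integrals of [L^p]-valued functions are defined by duality, so that only scalar
    functions are integrated. *)
Definition weak_integral X F u := forall xi, pairing xi u = \int[mu]_(s in X) pairing xi (F s).

(** The vectors of [riemann_sum] are close to [u] in norm, because they are
    uniformly close on the unit ball of [L^q]; hence the defining equation extends
    from the pairings to all bounded functionals, and weak integrals are preserved
    by bounded operators without any transposition. *)
Lemma weak_integral_functional X F u (L : LpG -> R) C : 0 <= C -> continuous_Lp F ->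
  rc X -> weak_integral X F u -> bounded_functional L C ->
  L u = \int[mu]_(s in X) L (F s).
Proof.
move=> C0 cF rX wu Lb; have m0 : 0 <= fine (mu X) by rewrite fine_ge0.
apply/eqP; rewrite -subr_eq0 -normr_eq0 eq_le normr_ge0 andbT.
apply/ler_addgt0Pr => e e0; rewrite add0r.
pose d := e / (2 * (C + 1) * (fine (mu X) + 1)).
have d0 : 0 < d by rewrite divr_gt0// !mulr_gt0// ltr_wpDl.
have [y yP] := riemann_sum cF rX d0.
have uy : Lp_norm (u - y) <= d * fine (mu X).
  apply: (pairing_norming pq); first by rewrite mulr_ge0// ltW.
  move=> xi; rewrite (pairingBr pq) wu mulrC mulrA.
  by apply: yP; [exact: Lp_norm_ge0|exact: pairing_functional].
rewrite -(subrK (L y) (L u)) -addrA (le_trans (ler_normD _ _))//.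
rewrite -(functionalB _ _ Lb) [X in _ + X <= _]distrC.
have [_ _ LC] := Lb.
apply: (@le_trans _ _ (C * (d * fine (mu X)) + C * d * fine (mu X))).
  by rewrite lerD ?yP// (le_trans (LC _))// ler_wpM2l.
have -> : C * (d * fine (mu X)) + C * d * fine (mu X) =
    e * (C / (C + 1) * (fine (mu X) / (fine (mu X) + 1))).
  rewrite /d; field; apply/andP; split; rewrite gt_eqF// ltr_wpDl//.
rewrite ler_piMr ?(ltW e0)// mulr_ile1 ?divr_ge0 ?addr_ge0//.
  by rewrite ler_pdivrMr ?mul1r ?lerDl// ltr_wpDl.
by rewrite ler_pdivrMr ?mul1r ?lerDl// ltr_wpDl.
Qed.

Lemma weak_integral_bop X F u (A : bop LpG) : continuous_Lp F -> rc X ->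
  weak_integral X F u -> weak_integral X (A \o F) (A u).
Proof.
move=> cF rX wu xi.
have [D D0 Lb] := functional_comp A (Lp_norm_ge0 xi) (pairing_functional xi).
exact: (weak_integral_functional D0 cF rX wu Lb).
Qed.

Lemma weak_integral_norm X F u (M : R) : continuous_Lp F -> rc X ->
  weak_integral X F u -> 0 <= M -> (forall t, X t -> Lp_norm (F t) <= M) ->
  Lp_norm u <= M * fine (mu X).
Proof.
move=> cF rX wu M0 XM; have mX := rc_borel rX.
apply: (pairing_norming pq); first by rewrite mulr_ge0// fine_ge0.
move=> xi; rewrite wu.
have iL := functional_integrable (Lp_norm_ge0 xi) (pairing_functional xi) cF rX mX (@subset_refl _ X).
apply: le_trans (le_normr_Rintegral mX iL) _.
rewrite mulrC mulrA -Rintegral_cst//; apply: le_Rintegral => //.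
- exact: integrable_norm.
- by apply: integrable_cst_fin => //; exact: (rc_finite hausG rad rX).
- by move=> t Xt; rewrite (le_trans (pairing_le pq _ _))// ler_wpM2l ?Lp_norm_ge0// XM.
Qed.

Lemma weak_integral_unique X F u v : weak_integral X F u -> weak_integral X F v -> u = v.
Proof.
move=> wu wv; apply/eqP; rewrite -subr_eq0; apply/eqP; apply: (pairing_eq0 pq) => xi.
by rewrite (pairingBr pq) wu wv subrr.
Qed.

Lemma weak_integralD X F F' u v : continuous_Lp F -> continuous_Lp F' -> rc X ->
  weak_integral X F u -> weak_integral X F' v ->
  weak_integral X (fun s => F s + F' s) (u + v).
Proof.
move=> cF cF' rX wu wv xi; have mX := rc_borel rX.
rewrite (pairingDr pq) wu wv -RintegralD//.
- by apply: eq_Rintegral => s _; rewrite (pairingDr pq).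
- exact: (functional_integrable (Lp_norm_ge0 xi) (pairing_functional xi) cF rX mX (@subset_refl _ X)).
- exact: (functional_integrable (Lp_norm_ge0 xi) (pairing_functional xi) cF' rX mX (@subset_refl _ X)).
Qed.

End weak_integral.

(** * A converse of the inequality of Hoelder *)

Section converse_hoelder.
Context {R : realType} {G : topologicalGroupType}.
Variables (mu : {measure set (borel G) -> \bar R}).
Hypotheses (hausG : hausdorff_space G) (lcG : locally_compact [set: G]).
Hypothesis haar : left_haar mu.
Variables (p q : R) (p1 : 1 <= p) (q1 : 1 <= q).
Hypothesis pq : p^-1 + q^-1 = 1.
Implicit Types (s t : G) (X Y U V W K : set G).

Let rad : radon mu. Proof. by case: haar. Qed.
Let qp : q^-1 + p^-1 = 1. Proof. by rewrite addrC. Qed.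
Let q0 : 0 < q. Proof. exact: lt_le_trans ltr01 q1. Qed.

Variables (m : borel G -> R[i]) (B C : R).
Hypotheses (cre : continuous (fun t => complex.Re (m t) : R))
  (cim : continuous (fun t => complex.Im (m t) : R)).
Hypothesis mB : forall t, normc (m t) <= B.
Hypothesis C0 : 0 <= C.
Hypothesis mC : forall y, step_fun y ->
  `|\int[mu]_t rprod (y t) (m t)| <= C * Lp_norm (toLp mu p1 y).

Let B0 : 0 <= B. Proof. exact: le_trans (normc_ge0 (m 1%g)) (mB 1%g). Qed.

Lemma cmeasurable_continuous : cmeasurable m.
Proof. by split; exact: continuous_borel_measurable_fun. Qed.

Let cut W : borel G -> R[i] := fun t => m t * (\1_W t)%:C%C.

Let cmeasurable_cut W : rc W -> cmeasurable (cut W).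
Proof.
move=> rW; apply: cmeasurableM; first exact: cmeasurable_continuous.
by apply: cmeasurable_real; apply: measurable_indic; exact: rc_borel.
Qed.

Let normc_cut W t : normc (cut W t) = normc (m t) * \1_W t.
Proof. by rewrite /cut Normc.normcM normc_real ger0_norm. Qed.

Let cut_in W : rc W -> cut W \in Lp_pred mu q1.
Proof.
move=> rW; have mW := rc_borel rW; apply/Lp_predP; split; first exact: cmeasurable_cut.
have [mc coo] := Lp_predP mu q1 _ (rc_cindic_in hausG haar q1 B%:C%C rW).
apply: le_lt_trans coo.
apply: cLnorm_le => //; first exact: cmeasurable_cut.
by move=> t; rewrite normc_cut normc_cindic normc_real ger0_norm// ler_wpM2r.
Qed.

Let step_cut W (y : borel G -> R[i]) : rc W -> step_fun y -> step_fun (fun t => y t * (\1_W t)%:C%C).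
Proof.
move=> rW; elim=> [c V rV|f g _ sf _ sg].
  rewrite (_ : (fun t => _) = cindic c (V `&` W)).
    by apply: step_cindic; apply: rcI => //; exact: rc_open.
  apply/funext => t; rewrite /cindic -mulrA -rmorphM; congr (_ * _%:C%C).
  by rewrite indicI.
rewrite (_ : (fun t => _) = (fun t => f t * (\1_W t)%:C%C + g t * (\1_W t)%:C%C)).
  exact: step_add.
by apply/funext => t; rewrite mulrDl.
Qed.

Lemma cut_norm W : rc W -> Lp_norm (toLp mu q1 (cut W)) <= C.
Proof.
move=> rW; have hc := cut_in rW.
apply: (pairing_norming qp) => // xi.
apply/ler_addgt0Pr => e e0.
pose N := C + Lp_norm (toLp mu q1 (cut W)) + 1.
have N0 : 0 < N by rewrite ltr_wpDl// addr_ge0// Lp_norm_ge0.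
have [y sy ye] := Lp_step_dense hausG lcG haar xi (divr_gt0 e0 N0).
have hy := step_in hausG haar p1 sy.
have syW := step_cut rW sy; have hyW := step_in hausG haar p1 syW.
have H : `|pairing (toLp mu p1 y) (toLp mu q1 (cut W))| <= C * Lp_norm (toLp mu p1 y).
  rewrite (pairing_toLp qp hy hc).
  rewrite (_ : \int[mu]_t _ = \int[mu]_t rprod (y t * (\1_W t)%:C%C) (m t)); last first.
    by apply: eq_Rintegral => t _; rewrite /rprod /cut -mulrA [X in y t * X]mulrC.
  apply: le_trans (mC syW) _; rewrite ler_wpM2l// !toLp_norm// fine_le//.
  - by rewrite ge0_fin_numE ?cLnorm_ge0//; have /Lp_predP[] := hyW.
  - by rewrite ge0_fin_numE ?cLnorm_ge0//; have /Lp_predP[] := hy.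
  apply: cLnorm_le => //; [exact: cmeasurable_step..|move=> t].
  rewrite Normc.normcM normc_real ger0_norm//.
  by rewrite ler_piMr ?normc_ge0// indicE; case: (t \in W).
rewrite -{1}(subrK (toLp mu p1 y) xi) (pairingDl qp).
rewrite (le_trans (ler_normD _ _))//.
have h1 := pairing_le qp (xi - toLp mu p1 y) (toLp mu q1 (cut W)).
have h2 : Lp_norm (toLp mu p1 y) <= Lp_norm xi + Lp_norm (xi - toLp mu p1 y).
  rewrite -{1}(subrK xi (toLp mu p1 y)) (le_trans (Lp_normD _ _))//.
  by rewrite addrC lerD2l Lp_normB.
have n0 := Lp_norm_ge0 (xi - toLp mu p1 y).
set x := Lp_norm (xi - _) in ye h1 h2 n0 *.
set z := Lp_norm (toLp mu q1 _) in N N0 ye h1 *.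
have xe : x * N <= e by rewrite -ler_pdivlMr// ltW.
have C2 : C * Lp_norm (toLp mu p1 y) <= C * (Lp_norm xi + x) by rewrite ler_wpM2l.
have : x * z + C * (Lp_norm xi + x) <= C * Lp_norm xi + e.
  apply: (@le_trans _ _ (C * Lp_norm xi + x * N)); last by rewrite lerD2l.
  by rewrite /N; nra.
by apply: le_trans; rewrite lerD// (le_trans H).
Qed.

Lemma integral_cut W : rc W ->
  (\int[mu]_(t in W) (normc (m t) `^ q)%:E <= (C `^ q)%:E)%E.
Proof.
move=> rW; have mW := rc_borel rW; have hc := cut_in rW.
have -> : (\int[mu]_(t in W) (normc (m t) `^ q)%:E = \int[mu]_t (normc (cut W t) `^ q)%:E)%E.
  rewrite integral_mkcond; apply: eq_integral => t _.
  rewrite patchE normc_cut indicE; case: (t \in W); first by rewrite mulr1.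
  by rewrite mulr0 powR0// gt_eqF.
have := Lp_norm_powR (toLp mu q1 (cut W)).
have -> : (\int[mu]_t (normc (Lp_repr (toLp mu q1 (cut W)) t) `^ q)%:E =
    \int[mu]_t (normc (cut W t) `^ q)%:E)%E.
  apply: ae_eq_integral => //.
  - exact/measurable_normc_powR/LpFun_cmeasurable.
  - exact/measurable_normc_powR/cmeasurable_cut.
  - by apply: filterS (toLp_ae hc) => t /[apply] ->.
move=> <-; rewrite lee_fin ge0_ler_powR ?nnegrE ?Lp_norm_ge0//; first exact: ltW.
exact: cut_norm.
Qed.

(** By density of the step functions, the restrictions of [m] to relatively
    compact open sets are in [L^q], with norm at most [C]. The set where [m] is
    not zero is the union of the open sets [V n], on which [|m| > 1 / n.+1], so
    that these have finite measure and are approximated by relatively compact open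
    subsets, although [G] itself may not be exhausted by sets of finite measure. *)
Theorem converse_hoelder : m \in Lp_pred mu q1 /\ (cLnorm mu q m <= C%:E)%E.
Proof.
have mm := cmeasurable_continuous.
have mF : measurable_fun setT (fun t : borel G => (normc (m t) `^ q)%:E) by exact: measurable_normc_powR.
have F0 (t : borel G) : (0 <= (normc (m t) `^ q)%:E)%E by rewrite lee_fin powR_ge0.
suff H : (\int[mu]_t (normc (m t) `^ q)%:E <= (C `^ q)%:E)%E.
  have cl : (cLnorm mu q m <= C%:E)%E.
    rewrite cLnormE; have I0 : (0 <= \int[mu]_t (normc (m t) `^ q)%:E)%E by exact: integral_ge0.
    have Ifin : (\int[mu]_t (normc (m t) `^ q)%:E)%E \is a fin_num.
      by rewrite ge0_fin_numE// (le_lt_trans H)// ltry.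
    move: H I0; rewrite -(fineK Ifin) poweR_EFin !lee_fin => H I0.
    rewrite -[leRHS](powRr1 C0) -(mulfV (lt0r_neq0 q0)) powRrM.
    by rewrite ge0_ler_powR ?nnegrE ?invr_ge0 ?powR_ge0// ltW.
  by split=> //; apply/Lp_predP; split=> //; rewrite (le_lt_trans cl)// ltry.
pose V (n : nat) : set (borel G) := [set t | n.+1%:R^-1 < `|complex.Re (m t)|] `|`
                    [set t | n.+1%:R^-1 < `|complex.Im (m t)|].
have oV n : open (V n : set G).
  have oabs (f : G -> R) : continuous f -> open [set t | n.+1%:R^-1 < `|f t|].
    move=> cf; apply: (@open_comp _ _ (fun t => `|f t|) [set x | n.+1%:R^-1 < x]).
      by move=> t _; apply: (@continuous_comp _ _ _ f (@Num.norm _ R)); [exact: cf|exact: pseudometric_normed_Zmodule.norm_continuous].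
    exact: open_gt.
  by apply: openU; exact: oabs.
have mV n : measurable (V n : set (borel G)) := open_borel (oV n).
have VF n (t : borel G) : V n t -> (n.+1%:R^-1 `^ q <= normc (m t) `^ q)%R.
  move=> Vt; rewrite ge0_ler_powR ?nnegrE ?normc_ge0 ?(ltW q0)//.
  case: Vt => /ltW Vt; apply: le_trans Vt _; [exact: Re_le_normc|exact: Im_le_normc].
have Voo n : (mu (V n) < +oo)%E.
  rewrite ltNge leye_eq; apply/negP => /eqP Voo.
  pose k := n.+1%:R^-1 `^ q : R.
  have k0 : 0 < k by rewrite powR_gt0// invr_gt0.
  have [|W [rW WV] Wlt] := @rc_exhaust _ _ _ hausG lcG rad (V n) (C `^ q / k)%:E (oV n).
    by rewrite Voo ltry.
  have := integral_cut rW; apply/negP; rewrite -ltNge.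
  apply: (@lt_le_trans _ _ (k%:E * mu W)%E).
    by move: Wlt; rewrite -lte_pdivrMl// -EFinM mulrC.
  have mW := rc_borel rW.
  rewrite -integral_cst//; apply: ge0_le_integral => //.
  - by move=> t _; rewrite lee_fin ltW.
  - exact: measurable_funTS.
  - by move=> t Wt; rewrite lee_fin; apply: VF; exact: WV.
have VC n : (\int[mu]_(t in V n) (normc (m t) `^ q)%:E <= (C `^ q)%:E)%E.
  apply/lee_addgt0Pr => e e0.
  have k0 : 0 < B `^ q + 1 by rewrite ltr_wpDl// powR_ge0.
  have [W [rW WV] We] := rc_approx hausG lcG rad (oV n) (Voo n) (divr_gt0 e0 k0).
  have mW := rc_borel rW.
  have mD : measurable (V n `\` W : set (borel G)) by exact: measurableD.
  rewrite -{1}(setDUK WV) ge0_integral_setU//; last 2 first.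
  - exact: measurable_funTS.
  - by rewrite disj_set2E setDIK.
  apply: leeD; first exact: integral_cut.
  apply: (@le_trans _ _ ((B `^ q + 1)%:E * mu (V n `\` W))%E).
    rewrite -integral_cst//; apply: ge0_le_integral => //.
    - exact: measurable_funTS.
    - move=> t _; rewrite lee_fin (@le_trans _ _ (B `^ q))// ?lerDl//.
      by rewrite ge0_ler_powR ?nnegrE ?normc_ge0// ltW.
  by rewrite -lee_pdivlMl// -EFinM mulrC ltW.
have ndV : nondecreasing_seq V.
  move=> i j ij; apply/subsetPset => t [h|h]; [left|right]; rewrite /=.
    by apply: le_lt_trans h; rewrite lef_pV2 ?posrE// ler_nat.
  by apply: le_lt_trans h; rewrite lef_pV2 ?posrE// ler_nat.
have -> : (\int[mu]_t (normc (m t) `^ q)%:E = \int[mu]_(t in \bigcup_n V n) (normc (m t) `^ q)%:E)%E.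
  rewrite [RHS]integral_mkcond; apply: eq_integral => t _; rewrite patchE.
  case: ifPn => // /negP; rewrite inE => nV.
  have z (x : R) : ~ (exists n : nat, n.+1%:R^-1 < `|x|) -> x = 0.
    move=> nx; apply/eqP; apply/negPn/negP => x0; apply: nx.
    have xp : 0 < `|x| by rewrite normr_gt0.
    exists (Num.truncn `|x|^-1).
    by rewrite -[ltRHS]invrK ltf_pV2 ?posrE ?invr_gt0 ?truncnS_gt ?ltr0n.
  have -> : m t = 0.
    have r0 := z _ (fun h => nV (let: ex_intro n hn := h in ex_intro2 _ _ n I (or_introl hn))).
    have i0 := z _ (fun h => nV (let: ex_intro n hn := h in ex_intro2 _ _ n I (or_intror hn))).
    by case: (m t) r0 i0 => a b /= -> ->.
  by rewrite Normc.normc0 powR0// gt_eqF.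
have c : (\int[mu]_(t in V n) (normc (m t) `^ q)%:E)%E @[n --> \oo] -->
    (\int[mu]_(t in \bigcup_n V n) (normc (m t) `^ q)%:E)%E.
  apply: (@ge0_nondecreasing_set_cvg_integral _ _ _ V (fun t => (normc (m t) `^ q)%:E) mu) => //.
  by move=> n; exact: measurable_funTS.
rewrite -(cvg_lim _ c)//; apply: lime_le; first by apply: cvgP c.
exact: nearW.
Qed.

End converse_hoelder.

Section representation.
Context {R : realType} {G : topologicalGroupType}.
Variables (mu : {measure set (borel G) -> \bar R}).
Hypotheses (hausG : hausdorff_space G) (lcG : locally_compact [set: G]).
Hypothesis haar : left_haar mu.
Variables (p q : R) (p1 : 1 <= p) (q1 : 1 <= q).
Hypothesis pq : p^-1 + q^-1 = 1.
Variables (m : borel G -> R[i]) (B C : R) (L : Lp mu p1 -> R).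
Hypotheses (cre : continuous (fun t => complex.Re (m t) : R))
  (cim : continuous (fun t => complex.Im (m t) : R)).
Hypothesis mB : forall t, normc (m t) <= B.
Hypotheses (C0 : 0 <= C) (LD : forall u v, L (u + v) = L u + L v)
  (LC : forall u, `|L u| <= C * Lp_norm u).
Hypothesis mL : forall c (X : set (borel G)), rc X ->
  \int[mu]_(t in X) rprod c (m t) = L (ind mu p1 c X).

Let rad : radon mu. Proof. by case: haar. Qed.

Let step_test y : step_fun y -> mu.-integrable setT (EFin \o (fun t => rprod (y t) (m t))) /\
  \int[mu]_t rprod (y t) (m t) = L (toLp mu p1 y).
Proof.
have mm := cmeasurable_continuous cre cim.
elim=> [c X rX|f g sf [i1 e1] sg [i2 e2]].
  have mX := rc_borel rX.
  have E1 : EFin \o (fun t => rprod (cindic c X t) (m t)) = (EFin \o (fun t => rprod c (m t))) \_ X.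
    apply/funext => t; rewrite patchE /= /cindic indicE; case: (t \in X); first by rewrite mulr1.
    by rewrite mulr0 /rprod mul0r.
  split; last first.
    rewrite -[toLp _ _ _]/(ind mu p1 c X) -mL// /Rintegral [in RHS]integral_mkcond.
    by congr fine; apply: eq_integral => t _; rewrite -E1.
  rewrite E1 -integrable_mkcond//; apply: measurable_bounded_integrable => //.
  - exact: (rc_finite hausG rad rX).
  - by apply/measurable_funTS/cmeasurable_rprod => //; split; exact: measurable_cst.
  - exists (normc c * B); split; first exact: num_real.
    move=> x Bx t _; rewrite /= (le_trans (rprod_le _ _))// (le_trans _ (ltW Bx))//.
    by rewrite ler_wpM2l// normc_ge0.
have E1 : (fun t => rprod (f t + g t) (m t)) = (fun t => rprod (f t) (m t) + rprod (g t) (m t)).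
  by apply/funext => t; rewrite rprodDl.
split.
  rewrite E1; have := @integrableD _ _ _ mu setT measurableT _ _ i1 i2.
  by apply: eq_integrable.
rewrite E1 (RintegralD measurableT i1 i2) e1 e2 toLpD ?LD//; exact: (step_in hausG haar).
Qed.

(** The integrals of [m] against step functions, on which [converse_hoelder] rests,
    are values of [L]; by density the pairing with [m] then agrees with [L]. *)
Theorem representation : m \in Lp_pred mu q1 /\ forall u, pairing (toLp mu q1 m) u = L u.
Proof.
suff mC y : step_fun y -> `|\int[mu]_t rprod (y t) (m t)| <= C * Lp_norm (toLp mu p1 y).
  have [hm _] := converse_hoelder hausG lcG haar q1 pq cre cim mB C0 mC; split=> // u.
  apply/eqP; rewrite -subr_eq0; apply/eqP; move: u.
  apply: (@functional_eq0 _ _ _ hausG lcG haar _ _ _ (Lp_norm (toLp mu q1 m) + C)).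
  - by move=> u v; rewrite LD (pairingDr pq) opprD addrACA.
  - by move=> u; rewrite (le_trans (ler_normB _ _))// mulrDl lerD// (pairing_le pq).
  - move=> c X rX; have [_ <-] := step_test (step_cindic c rX).
    rewrite (pairing_toLp pq hm (rc_cindic_in hausG haar p1 c rX)); apply/eqP.
    by rewrite subr_eq0; apply/eqP; apply: eq_Rintegral => t _; rewrite /rprod mulrC.
by move=> sy; have [_ ->] := step_test sy.
Qed.

End representation.

(** * Real-valued integrals of sections *)

Section real_integrals.
Context {R : realType} {G : topologicalGroupType}.
Variables (mu : {measure set (borel G) -> \bar R}).
Hypotheses (hausG : hausdorff_space G) (rad : radon mu).
Implicit Types (Z E X : set G).

Lemma le_Rintegral_cst X (h : G -> R) (M : R) : rc X ->
  mu.-integrable (X : set (borel G)) (EFin \o h) -> (forall t, X t -> `|h t| <= M) ->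
  `|\int[mu]_(t in (X : set (borel G))) h t| <= M * fine (mu X).
Proof.
move=> rX ih hM; have mX := rc_borel rX.
apply: le_trans (le_normr_Rintegral mX ih) _.
rewrite -Rintegral_cst//; apply: le_Rintegral => //.
- exact: integrable_norm.
- by apply: integrable_cst_fin => //; exact: (rc_finite hausG rad rX).
Qed.

Lemma section_integrable Z E (O : set (G * G)) : rc Z -> rc E -> open O ->
  mu.-integrable (Z : set (borel G)) (EFin \o (fun t => fine (mu (E `&` [set u | O (t, u)])))).
Proof.
move=> rZ rE oO; have mZ := rc_borel rZ; have mE := rc_borel rE.
have mEO t : measurable (E `&` [set u | O (t, u)] : set (borel G)).
  by apply: measurableI => //; exact: (open_borel (open_fst_section t oO)).
have fE := rc_finite hausG rad rE.
have le t : (mu (E `&` [set u | O (t, u)]) <= mu E)%E by apply: borel_le => // u [].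
have fin t : mu (E `&` [set u | O (t, u)]) \is a fin_num.
  by rewrite ge0_fin_numE// (le_lt_trans (le t)).
apply: measurable_bounded_integrable => //; first exact: (rc_finite hausG rad rZ).
  apply: superlevel_measurable => r; apply: measurableI => //; apply: open_borel.
  pose O' := O `&` (setT `*` E).
  have oO' : open O' by apply: openI => //; apply: open_setX; [exact: openT|exact: rc_open].
  have OE t : [set u | O' (t, u)] = E `&` [set u | O (t, u)].
    by apply/seteqP; split=> [u [h [_ /= Eu]]|u [Eu h]].
  have -> : [set t | r < fine (mu (E `&` [set u | O (t, u)]))] =
      [set t | (r%:E < mu [set u | O' (t, u)])%E].
    by apply/seteqP; split=> t /=; rewrite OE -lte_fin fineK.
  exact: (section_lsc hausG rad).
exists (fine (mu E)); split; first exact: num_real.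
move=> x Mx t _; rewrite /= ger0_norm ?fine_ge0// (le_trans _ (ltW Mx))//.
by rewrite fine_le// ge0_fin_numE.
Qed.

(** The form in which [open_tonelli] is used for pairings of indicators. *)
Lemma open_tonelliR (k : R) Z E (O : set (G * G)) : rc Z -> rc E -> open O ->
  \int[mu]_(t in (Z : set (borel G))) (k * fine (mu (E `&` [set u | O (t, u)]))) =
  \int[mu]_(u in (E : set (borel G))) (k * fine (mu (Z `&` [set t | O (t, u)]))).
Proof.
move=> rZ rE oO; have mZ := rc_borel rZ; have mE := rc_borel rE.
pose O' := [set x : G * G | O (x.2, x.1)].
have oO' : open O' by exact: open_swap.
rewrite RintegralZl//; last exact: section_integrable.
rewrite RintegralZl//; last exact: (section_integrable rE rZ oO').
have fin X (Q : set (G * G)) t : rc X -> open Q -> mu (X `&` [set u | Q (t, u)]) \is a fin_num.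
  move=> rX oQ; have mX := rc_borel rX; rewrite ge0_fin_numE// (le_lt_trans _ (rc_finite hausG rad rX))//.
  have mQ := open_borel (open_fst_section t oQ).
  exact: (borel_le mu (measurableI _ _ mX mQ) mX (@subIsetl _ _ _)).
congr (_ * fine _); transitivity (\int[mu]_(t in (Z : set (borel G))) mu (E `&` [set u | O (t, u)]))%E.
  by apply: eq_integral => t _; rewrite /= fineK// fin.
rewrite (open_tonelli hausG rad rZ rE oO).
by apply: eq_integral => t _; rewrite /= fineK// (fin _ O').
Qed.

End real_integrals.

(** * Right translations of L^p *)

Section rtrans.
Context {R : realType} {G : topologicalGroupType}.
Variables (mu : {measure set (borel G) -> \bar R}) (Delta : G -> R).
Hypotheses (hausG : hausdorff_space G) (lcG : locally_compact [set: G]).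
Hypotheses (haar : left_haar mu) (modular : modular_function mu Delta).
Variables (p : R) (p1 : 1 < p).
Implicit Types (s t : G) (f : borel G -> R[i]).
Local Notation LpG := (Lp mu (ltW p1)).
Implicit Types u v : LpG.

Let rad : radon mu. Proof. by case: haar. Qed.
Let D0 := Delta_gt0 modular.

(** Without the factor of [rho] that makes it isometric, right translation turns
    indicators into indicators and convolutions into integrals without weight. *)
Definition rtrans s : bop LpG := (Delta s `^ (- p^-1))%:C%C *: rho modular p1 s.

Lemma rtransE s u : rtrans s u = (Delta s `^ (- p^-1))%:C%C *: rho modular p1 s u.
Proof. by []. Qed.

Lemma rtrans_toLp s f : f \in Lp_pred mu (ltW p1) ->
  rtrans s (toLp mu (ltW p1) f) = toLp mu (ltW p1) (fun t => f (t * s)%g).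
Proof.
move=> hf; rewrite rtransE rho_toLp// -toLpZ; last exact: rho_in.
congr toLp; apply/funext => t; rewrite mulrA -rmorphM/= -powRD; last by rewrite (lt0r_neq0 (D0 s)) implybT.
by rewrite addNr powRr0 mul1r.
Qed.

Lemma rtrans_ind s c W : rc W ->
  rtrans s (ind mu (ltW p1) c W) = ind mu (ltW p1) c [set t | W (t * s)%g].
Proof. by move=> rW; rewrite rtrans_toLp//; exact: (rc_cindic_in hausG haar). Qed.

Lemma powR_Delta_continuous (a : R) : continuous (fun s : G => Delta s `^ a).
Proof.
move=> s.
have -> : (fun s : G => Delta s `^ a) = (fun s => expR (a * ln (Delta s))).
  by apply/funext => t; rewrite /powR gt_eqF.
apply: (@continuous_comp _ _ _ (fun s => a * ln (Delta s)) (@expR R)); last exact: continuous_expR.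
apply: (@continuousM _ _ (fun=> a) (fun s => ln (Delta s))); first exact: cvg_cst.
apply: (@continuous_comp _ _ _ (Delta : G -> R) (@ln R)).
  exact: (Delta_continuous hausG lcG haar modular).
exact: continuous_ln.
Qed.

Lemma rho_norm s u : Lp_norm (rho modular p1 s u) = Lp_norm u.
Proof.
rewrite (rho_flip_lambda hausG lcG haar modular).
change (Lp_norm (flip_bop hausG lcG haar modular p1 (ltrans haar (ltW p1) s (flip_bop hausG lcG haar modular p1 u))) = Lp_norm u).
by rewrite flip_bop_norm ltrans_norm flip_bop_norm.
Qed.

Lemma rtrans_norm s u : Lp_norm (rtrans s u) = Delta s `^ (- p^-1) * Lp_norm u.
Proof. by rewrite rtransE Lp_normZ normc_real ger0_norm ?powR_ge0// rho_norm. Qed.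

Lemma rtrans_continuous u : continuous_Lp (rtrans^~ u).
Proof.
move=> s e e0; set a := fun t => Delta t `^ (- p^-1).
have N1 : 0 < Lp_norm u + 1 by rewrite ltr_wpDl ?Lp_norm_ge0.
have a1 : 0 < a s + 1 by rewrite ltr_wpDl ?powR_ge0.
have e2 : 0 < e / 2 by rewrite divr_gt0.
have n1 := rho_continuous hausG lcG haar modular u s (divr_gt0 e2 a1).
have /cvgrPdist_lt/(_ _ (divr_gt0 e2 N1)) n2 := @powR_Delta_continuous (- p^-1) s.
apply: filterS2 n1 n2 => t h1 h2.
have -> : rtrans t u - rtrans s u = (a t - a s)%:C%C *: rho modular p1 t u +
    (a s)%:C%C *: (rho modular p1 t u - rho modular p1 s u).
  by rewrite !rtransE (rmorphB (real_complex R)) scalerBl scalerBr addrA subrK.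
rewrite (le_lt_trans (Lp_normD _ _))// !Lp_normZ !normc_real rho_norm [e]splitr.
rewrite ler_ltD//.
  apply: (@le_trans _ _ (`|a t - a s| * (Lp_norm u + 1))); first by rewrite ler_wpM2l// lerDl.
  by rewrite -ler_pdivlMr// distrC ltW.
rewrite ger0_norm ?powR_ge0//.
apply: (@le_lt_trans _ _ ((a s + 1) * Lp_norm (rho modular p1 t u - rho modular p1 s u))).
  by rewrite ler_wpM2r ?Lp_norm_ge0// lerDl.
by rewrite mulrC -ltr_pdivlMr.
Qed.

Lemma rtrans_bounded E : rc E -> exists2 M : R, 0 <= M &
  forall s u, E s -> Lp_norm (rtrans s u) <= M * Lp_norm u.
Proof.
move=> [_ [K cK EK]].
have cf : {within K, continuous (fun s : G => Delta s `^ (- p^-1))}.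
  by apply: continuous_subspaceT; exact: powR_Delta_continuous.
have [->|K0] := eqVneq E set0; first by exists 0.
have K0' : K !=set0 by move/set0P: K0 => [x Ex]; exists x; exact: EK.
have [c Kc cmax] := compact_EVT_max K0' cK cf.
exists (Delta c `^ (- p^-1)); first exact: powR_ge0.
move=> s u Es; rewrite rtrans_norm ler_wpM2r ?Lp_norm_ge0//; apply: cmax; rewrite inE; exact: EK.
Qed.

Lemma rtrans_ltrans s t u : rtrans s (ltrans haar (ltW p1) t u) = ltrans haar (ltW p1) t (rtrans s u).
Proof.
have hu := Lp_repr_in u; rewrite -(toLpK u) ltrans_toLp// !rtrans_toLp//; last exact: (in_Lp_ltrans haar).
rewrite ltrans_toLp; first by congr toLp; apply/funext => x; rewrite mulgA.
have := in_LpZ (Delta s `^ (- p^-1))%:C%C (rho_in modular s hu).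
set f := (fun x => _ * _); set g := (fun x => _ (x * s)%g); suff -> : f = g by [].
apply/funext => x; rewrite /f mulrA -rmorphM/= -powRD; last by rewrite (lt0r_neq0 (D0 s)) implybT.
by rewrite addNr powRr0 mul1r.
Qed.

End rtrans.

(** * Right convolution with an indicator *)

Section convolution.
Context {R : realType} {G : topologicalGroupType}.
Variables (mu : {measure set (borel G) -> \bar R}) (Delta : G -> R).
Hypotheses (hausG : hausdorff_space G) (lcG : locally_compact [set: G]).
Hypotheses (haar : left_haar mu) (modular : modular_function mu Delta).
Variables (p q : R) (p1 : 1 < p) (q1 : 1 <= q).
Hypothesis pq : p^-1 + q^-1 = 1.
Implicit Types (s t : G) (E F Z X W : set G) (c d : R[i]).
Local Notation LpG := (Lp mu (ltW p1)).
Local Notation LqG := (Lp mu q1).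
Local Notation L := (ltrans haar (ltW p1)).
Local Notation r := (rtrans modular p1).
Local Notation ip := (ind mu (ltW p1)).
Local Notation iq := (ind mu q1).
Implicit Types u v : LpG.

Let rad : radon mu. Proof. by case: haar. Qed.
Let qp : q^-1 + p^-1 = 1. Proof. by rewrite addrC. Qed.

Lemma pairing_ind c d E X : rc E -> rc X ->
  pairing (iq c E) (ip d X) = rprod c d * fine (mu (E `&` X)).
Proof.
move=> rE rX; have mE := rc_borel rE; have mX := rc_borel rX.
have mEX : measurable (E `&` X : set (borel G)) by exact: measurableI.
rewrite pairing_toLp; [|exact: pq|exact: (rc_cindic_in hausG haar)..].
rewrite -(Rintegral_cst _ mEX) [RHS]Rintegral_mkcond; apply: eq_Rintegral => t _.
rewrite patchE /cindic !indicE in_setI.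
by case: (t \in E); case: (t \in X); rewrite /rprod ?mulr1 ?mulr0 ?mul0r ?mulr0.
Qed.

Lemma ltransV_continuous u : continuous_Lp (fun t => L t^-1%g u).
Proof.
move=> s e e0.
exact: (@invg_continuous G s _ (ltrans_continuous hausG lcG haar u (s^-1)%g e0)).
Qed.

(** The convolution of [u] with the indicator of [E^-1]: its value at [t] is the
    integral over [E] of [u (t * s)], whose real and imaginary parts are the two
    pairings. *)
Definition convol E u : borel G -> R[i] := fun t =>
  Complex (pairing (iq 1 E) (L t^-1%g u)) (pairing (iq (Complex 0 (-1)) E) (L t^-1%g u)).

Lemma pairing_indM c d E u : rc E -> pairing (iq (c * d) E) u = pairing (iq d E) (c *: u).
Proof. by move=> rE; rewrite (indZ hausG haar)// (pairingZ pq). Qed.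

Lemma rprod_convol c E u t : rc E -> rprod c (convol E u t) = pairing (iq c E) (L t^-1%g u).
Proof.
move=> rE; rewrite /convol; move: (L _ u) => w; rewrite -[c in RHS]mulr1 pairing_indM// {2}[c]complex_combination.
rewrite scalerDl (pairingDr pq) -scalerA !(pairing_realZ pq) rprodE /=; congr (_ + _).
have i1 : (-1) * Complex 0 (-1) = Complex 0 1 * 1 :> R[i].
  by rewrite mulN1r mulr1; congr Complex; rewrite ?oppr0 ?opprK.
by rewrite -mulrN -(pairingNr pq) -(scaleN1r w) -(pairing_indM (-1) _ w rE)
  -(pairing_indM (Complex 0 1) _ w rE) i1.
Qed.

Lemma convolD a E u v t : rc E -> convol E (a *: u + v) t = a * convol E u t + convol E v t.
Proof.
move=> rE; apply: rprod_ext => c.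
rewrite rprodDr -rprodZ !rprod_convol// bopD bopZ (pairingDr pq); congr (_ + _).
by rewrite [a * c]mulrC [c * a]mulrC pairing_indM.
Qed.

Lemma convol_bounded E u : exists B : R, forall t, normc (convol E u t) <= B.
Proof.
exists (Lp_norm (iq 1 E) * Lp_norm u + Lp_norm (iq (Complex 0 (-1)) E) * Lp_norm u) => t.
have h c : `|pairing (iq c E) (L t^-1%g u)| <= Lp_norm (iq c E) * Lp_norm u.
  by rewrite -(ltrans_norm haar t^-1%g u); exact: (pairing_le pq).
exact: normc_le_parts (h 1) (h (Complex 0 (-1))).
Qed.

Lemma convol_Re_continuous E u : continuous (fun t => complex.Re (convol E u t) : R).
Proof.
exact: (functional_continuous (Lp_norm_ge0 _) (pairing_functional _ pq (iq 1 E)) (@ltransV_continuous u)).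
Qed.

Lemma convol_Im_continuous E u : continuous (fun t => complex.Im (convol E u t) : R).
Proof.
exact: (functional_continuous (Lp_norm_ge0 _) (pairing_functional _ pq (iq (Complex 0 (-1)) E))
  (@ltransV_continuous u)).
Qed.

Lemma pairing_integrable (xi : LqG) (Fn : G -> LpG) Z : continuous_Lp Fn -> rc Z ->
  mu.-integrable (Z : set (borel G)) (EFin \o (fun t => pairing xi (Fn t))).
Proof.
move=> cF rZ; exact: (functional_integrable hausG haar (Lp_norm_ge0 _) (pairing_functional _ pq xi)
  cF rZ (rc_borel rZ) (@subset_refl _ Z)).
Qed.

Lemma pairing_integral_bound (xi : LqG) (Fn : G -> LpG) Z (M : R) : continuous_Lp Fn -> rc Z ->
  (forall t, Z t -> Lp_norm (Fn t) <= M) ->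
  `|\int[mu]_(t in (Z : set (borel G))) pairing xi (Fn t)| <= Lp_norm xi * M * fine (mu Z).
Proof.
move=> cF rZ FM; apply: (le_Rintegral_cst hausG rad rZ); first exact: pairing_integrable.
by move=> t Zt; rewrite (le_trans (pairing_le pq _ _))// ler_wpM2l ?Lp_norm_ge0// FM.
Qed.

(** Both sides are the integral of [c * u (t * s)] over [t] in [Z] and [s] in
    [E]; for an indicator [u], this is [open_tonelli]. *)
Lemma convol_fubini c E Z u : rc E -> rc Z ->
  \int[mu]_(t in (Z : set (borel G))) pairing (iq c E) (L t^-1%g u) =
  \int[mu]_(s in (E : set (borel G))) pairing (iq c Z) (r s u).
Proof.
move=> rE rZ; have [M M0 rM] := rtrans_bounded hausG lcG haar modular p1 rE.
have mE := rc_borel rE; have mZ := rc_borel rZ.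
have cL := @ltransV_continuous; have cr := rtrans_continuous hausG lcG haar modular (p1 := p1).
apply/eqP; rewrite -subr_eq0; apply/eqP; move: u.
apply: (@functional_eq0 _ _ _ hausG lcG haar _ _ _
  (Lp_norm (iq c E) * fine (mu Z) + Lp_norm (iq c Z) * M * fine (mu E))).
- move=> u v.
  under eq_Rintegral do rewrite bopD (pairingDr pq).
  rewrite RintegralD//; [|exact: pairing_integrable..].
  under [X in _ - X]eq_Rintegral do rewrite bopD (pairingDr pq).
  rewrite RintegralD//; [|exact: pairing_integrable..].
  by rewrite opprD addrACA.
- move=> u; rewrite (le_trans (ler_normB _ _))// mulrDl lerD//.
    rewrite mulrAC; apply: pairing_integral_bound => // t _.
    by rewrite ltrans_norm.
  rewrite mulrAC -[_ * M * Lp_norm u]mulrA.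
  by apply: pairing_integral_bound => // t; exact: rM.
- move=> d W rW; apply/eqP; rewrite subr_eq0; apply/eqP.
  transitivity (\int[mu]_(t in (Z : set (borel G)))
      (rprod c d * fine (mu (E `&` [set s | W (t * s)%g])))).
    apply: eq_Rintegral => t _; rewrite (ltrans_ind hausG haar)// pairing_ind//; last exact: rc_mulgl.
    by rewrite invgK.
  rewrite (@open_tonelliR _ _ _ hausG rad _ Z E [set x | W (x.1 * x.2)%g])//; last first.
    by apply: (@open_comp _ _ (fun x : G * G => (x.1 * x.2)%g : G)) (rc_open rW) => x _; exact: mulg_continuous.
  apply: eq_Rintegral => s _; rewrite rtrans_ind// pairing_ind//; exact: rc_mulgr.
Qed.

(** Integration of [convol E u] over [Z] is, by [convol_fubini], the pairing of the
    indicator of [Z] with the right translates of [u], integrated over [E]. *)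
Let convol_representation E u : rc E -> convol E u \in Lp_pred mu (ltW p1) /\
  forall xi, pairing (toLp mu (ltW p1) (convol E u)) xi =
    \int[mu]_(s in (E : set (borel G))) pairing (xi : LqG) (r s u).
Proof.
move=> rE; have [M M0 rM] := rtrans_bounded hausG lcG haar modular p1 rE.
have [B mB] := convol_bounded E u; have mE := rc_borel rE.
have cr := rtrans_continuous hausG lcG haar modular u.
have C0 : 0 <= M * Lp_norm u * fine (mu E).
  by rewrite mulr_ge0 ?fine_ge0// mulr_ge0// Lp_norm_ge0.
apply: (representation hausG lcG haar (ltW p1) qp (@convol_Re_continuous E u)
  (@convol_Im_continuous E u) mB C0).
- move=> xi eta; under eq_Rintegral do rewrite (pairingDl pq).
  by rewrite RintegralD//; exact: pairing_integrable.
- move=> xi; rewrite mulrC mulrA; apply: pairing_integral_bound => // s; exact: rM.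
- move=> c Z rZ; rewrite -convol_fubini//.
  by apply: eq_Rintegral => t _; rewrite rprod_convol.
Qed.

Lemma convol_in E u : rc E -> convol E u \in Lp_pred mu (ltW p1).
Proof. by move=> rE; have [] := convol_representation u rE. Qed.

Definition convolLp E u : LpG := toLp mu (ltW p1) (convol E u).

Lemma convolLp_weak_integral E u : rc E -> weak_integral q1 E (r^~ u) (convolLp E u).
Proof. by move=> rE xi; rewrite pairingC; have [_ ->] := convol_representation u rE. Qed.

Lemma pairing_convolLp c E F u : rc E -> rc F ->
  pairing (iq c F) (convolLp E u) = \int[mu]_(t in (F : set (borel G))) pairing (iq c E) (L t^-1%g u).
Proof. by move=> rE rF; rewrite (convol_fubini c u rE rF); exact: convolLp_weak_integral. Qed.

Lemma weak_integral_ind X (Fn : G -> LpG) u : continuous_Lp Fn -> rc X ->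
  (forall c F, rc F -> pairing (iq c F) u =
     \int[mu]_(s in (X : set (borel G))) pairing (iq c F) (Fn s)) ->
  weak_integral q1 X Fn u.
Proof.
move=> cF rX hi xi; have [M M0 XM] := continuous_Lp_bounded cF rX.
have mX := rc_borel rX; apply/eqP; rewrite -subr_eq0; apply/eqP; move: xi.
apply: (@functional_eq0 _ _ _ hausG lcG haar _ _ _ (Lp_norm u + M * fine (mu X))).
- move=> xi eta; rewrite (pairingDl pq).
  under [X in _ - X]eq_Rintegral do rewrite (pairingDl pq).
  rewrite RintegralD//; [|exact: pairing_integrable..].
  by rewrite opprD addrACA.
- move=> xi; rewrite (le_trans (ler_normB _ _))// mulrDl lerD//.
    by rewrite mulrC; exact: (pairing_le pq).
  by rewrite [_ * Lp_norm xi]mulrC mulrA; exact: pairing_integral_bound.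
- by move=> c F rF; rewrite hi// subrr.
Qed.

Lemma convolLp_ltrans E s u : rc E -> convolLp E (L s u) = L s (convolLp E u).
Proof.
move=> rE; apply: (weak_integral_unique pq (convolLp_weak_integral (L s u) rE)).
have cr := rtrans_continuous hausG lcG haar modular u.
move=> xi; rewrite (weak_integral_bop hausG haar pq (L s) cr rE (convolLp_weak_integral u rE) xi).
by apply: eq_Rintegral => t _; rewrite /comp rtrans_ltrans.
Qed.

(** Being an integral of right translations, right convolution commutes with all
    the operators that commute with these. *)
Lemma convolLp_comm E (S : bop LpG) u : rc E ->
  (forall s v, S (rho modular p1 s v) = rho modular p1 s (S v)) ->
  convolLp E (S u) = S (convolLp E u).
Proof.
move=> rE hS; apply: (weak_integral_unique pq (convolLp_weak_integral (S u) rE)).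
have cr := rtrans_continuous hausG lcG haar modular u.
move=> xi; rewrite (weak_integral_bop hausG haar pq S cr rE (convolLp_weak_integral u rE) xi).
by apply: eq_Rintegral => t _; rewrite /comp (rtransE modular t u) (bopZ S) hS.
Qed.

Lemma convolLpD E u v : rc E -> convolLp E (u + v) = convolLp E u + convolLp E v.
Proof.
move=> rE; rewrite -toLpD; [|exact: convol_in..].
by congr toLp; apply/funext => t; have := convolD 1 u v t rE; rewrite scale1r mul1r.
Qed.

Lemma convolLpZ E a u : rc E -> convolLp E (a *: u) = a *: convolLp E u.
Proof.
move=> rE; have m0 t : convol E 0 t = 0.
  by apply: rprod_ext => c; rewrite rprod_convol// bop0 (pairing0r (ltW p1) pq) /rprod mulr0.
rewrite -toLpZ; last exact: convol_in.
by congr toLp; apply/funext => t; have := convolD a u 0 t rE; rewrite m0 !addr0.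
Qed.

Lemma convolLp_bounded E : rc E -> exists2 C : R, 0 <= C & forall u, Lp_norm (convolLp E u) <= C * Lp_norm u.
Proof.
move=> rE; have [M M0 rM] := rtrans_bounded hausG lcG haar modular p1 rE.
exists (M * fine (mu E)); first by rewrite mulr_ge0// fine_ge0.
move=> u; rewrite mulrAC; apply: (weak_integral_norm hausG haar pq _ rE (convolLp_weak_integral u rE)).
- exact: (rtrans_continuous hausG lcG haar modular).
- by rewrite mulr_ge0// Lp_norm_ge0.
- by move=> t; exact: rM.
Qed.

Lemma convolLp_bop E : rc E -> convolLp E \in bop_pred.
Proof.
move=> rE; apply/bop_predP; split; first by move=> a u v; rewrite convolLpD// convolLpZ.
have [C C0 EC] := convolLp_bounded rE.
by exists C%:C%C => u; rewrite !Lp_normE -(rmorphM (real_complex R)) lecR.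
Qed.

Definition convol_bop E (rE : rc E) : bop LpG := MkBop (convolLp_bop rE).

(** [E] is a neighbourhood of the unit on which the right translates of [u] stay
    [e]-close to [u]. *)
Lemma convolLp_approx u (e : R) : 0 < e -> exists2 E, rc E &
  0 < fine (mu E) /\ Lp_norm (convolLp E u - (fine (mu E))%:C%C *: u) <= e * fine (mu E).
Proof.
move=> e0; have cr := rtrans_continuous hausG lcG haar modular u.
have r1 : r 1%g u = u.
  by rewrite -{1}(toLpK u) rtrans_toLp ?Lp_repr_in//; under eq_fun do rewrite mulg1; exact: toLpK.
have := cr 1%g e e0; cbv beta; rewrite r1 => n1.
have [E rE [E1 En]] := rc_nbhs lcG n1.
have mE := rc_borel rE; have Eoo := rc_finite hausG rad rE.
have E0 : (0 < mu E)%E by apply: (open_gt0 hausG haar); [exact: rc_open|exists 1%g].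
exists E => //; split; first by rewrite fine_gt0// E0.
have cc : continuous_Lp (fun=> - u : LpG).
  by move=> s e' e'0; apply: nearW => t; rewrite subrr Lp_norm0.
apply: (weak_integral_norm hausG haar pq (F := fun s => r s u + - u) _ rE).
- by move=> s e' e'0; apply: filterS (cr s e' e'0) => t; rewrite opprB addrA subrK.
- apply: (weak_integralD hausG haar pq cr cc rE (convolLp_weak_integral u rE)).
  move=> xi; rewrite (pairingNr pq) (pairing_realZ pq) Rintegral_cst// (pairingNr pq).
  by rewrite mulrC mulNr.
- exact: ltW.
- by move=> t Et; exact/ltW/En.
Qed.

(** [u] is a limit of multiples of the [convolLp E u]. *)
Lemma convolLp_eq0 (A : bop LpG) u : (forall E, rc E -> A (convolLp E u) = 0) -> A u = 0.
Proof.
move=> A0; apply: Lp_norm_eq0; apply/eqP; rewrite eq_le Lp_norm_ge0 andbT.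
have [C C0 AC] := bop_Lp_bound A.
apply/ler_addgt0Pr => e e0; rewrite add0r.
have C1 : 0 < C + 1 by rewrite ltr_wpDl.
have [E rE [E0 Ee]] := convolLp_approx u (divr_gt0 e0 C1).
set m := fine (mu E) in E0 Ee; set w := convolLp E u - _ in Ee.
have Aw : A w = - (m%:C%C *: A u) by rewrite bopB A0// sub0r bopZ.
rewrite -(ler_pM2l E0) -[m in leLHS]ger0_norm ?(ltW E0)// -normc_real -Lp_normZ -Lp_normN -Aw.
rewrite (le_trans (AC w))// (@le_trans _ _ ((C + 1) * Lp_norm w))//.
  by rewrite ler_wpM2r ?Lp_norm_ge0// lerDl.
by rewrite [leRHS]mulrC -ler_pdivlMl// mulrA [_^-1 * _]mulrC.
Qed.

End convolution.

(** * Operators commuting with the left and the right translations *)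

Section commutation.
Context {R : realType} {G : topologicalGroupType}.
Variables (mu : {measure set (borel G) -> \bar R}) (Delta : G -> R).
Hypotheses (hausG : hausdorff_space G) (lcG : locally_compact [set: G]).
Hypotheses (haar : left_haar mu) (modular : modular_function mu Delta).
Variables (p q : R) (p1 : 1 < p) (q1 : 1 <= q).
Hypothesis pq : p^-1 + q^-1 = 1.
Implicit Types (s t : G) (B E F Z X W : set G) (c d : R[i]).
Local Notation LpG := (Lp mu (ltW p1)).
Local Notation LqG := (Lp mu q1).
Local Notation L := (ltrans haar (ltW p1)).
Local Notation ip := (ind mu (ltW p1)).
Local Notation iq := (ind mu q1).
Local Notation M := (convolLp haar (p1 := p1) q1).
Local Notation inv B := [set t : G | B (t^-1)%g].
Implicit Types u v : LpG.

Let rad : radon mu. Proof. by case: haar. Qed.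
Let qp : q^-1 + p^-1 = 1. Proof. by rewrite addrC. Qed.

Lemma invK B : inv (inv B) = B.
Proof. by apply/seteqP; split=> t; rewrite /= invgK. Qed.

(** The convolution of two indicators is an integral of right translates of the
    first one by definition, and an integral of left translates of the second one
    by the exchange of the integrals. *)
Lemma convol_ind_weak_integral c B X : rc B -> rc X ->
  weak_integral q1 X (fun s => L s (ip c B)) (M (inv B) (ip c X)).
Proof.
move=> rB rX; have rB' := rc_invg rB; have mX := rc_borel rX.
apply: (weak_integral_ind hausG lcG haar pq (ltrans_continuous hausG lcG haar (ip c B)) rX) => d F rF.
have oO : open [set x : G * G | B (x.2^-1 * x.1)%g].
  by apply: open_comp (rc_open rB) => x _; exact: continuous_mulVg.
rewrite (pairing_convolLp hausG lcG haar modular q1 pq d (ip c X) rB' rF).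
transitivity (\int[mu]_(t in (F : set (borel G)))
    (rprod d c * fine (mu (X `&` [set s | B (s^-1 * t)%g])))).
  apply: eq_Rintegral => t _; rewrite (ltrans_ind hausG haar)//.
  rewrite (pairing_ind hausG haar)//; last exact: rc_mulgl.
  have mA : measurable (X `&` [set s | B (s^-1 * t)%g] : set (borel G)).
    by apply: measurableI => //; exact: (open_borel (open_fst_section t oO)).
  congr (_ * fine _); rewrite -[RHS](mu_mulgl haar t mA); congr (mu _).
  apply/seteqP; split=> s /= [].
    by rewrite invgK invgM => Bs Xs; rewrite -mulgA mulVg mulg1.
  by rewrite invgK invgM -mulgA mulVg mulg1.
rewrite (open_tonelliR hausG rad _ rF rX oO); apply: eq_Rintegral => s _.
by rewrite (ltrans_ind hausG haar)// (pairing_ind hausG haar)//; exact: rc_mulgl.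
Qed.

Lemma cLnorm_inv (f : borel G -> R[i]) : cmeasurable f ->
  cLnorm (inv_measure mu) q f = cLnorm mu q (fun t => f (t^-1)%g).
Proof.
move=> mf; rewrite !cLnormE.
have -> // := @integral_inv_measure _ _ mu _ (measurable_normc_powR q mf) _.
by move=> t; rewrite lee_fin powR_ge0.
Qed.

Lemma step_inv (y : G -> R[i]) : step_fun y -> step_fun (fun t => y (t^-1)%g).
Proof.
elim=> [c W rW|f g _ sf _ sg]; last exact: step_add.
exact: (step_cindic c (rc_invg rW)).
Qed.

Lemma toLp_dist_lt (r : R) (r1 : 1 <= r) (f y : borel G -> R[i]) (e : R) :
  f \in Lp_pred mu r1 -> y \in Lp_pred mu r1 ->
  (cLnorm mu r (fun t => f t - y t)%R < e%:E)%E -> Lp_norm (toLp mu r1 f - toLp mu r1 y) < e.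
Proof.
move=> hf hy; have hN : (fun t => -1 * y t) \in Lp_pred mu r1 by exact: in_LpZ.
have hD := in_LpD hf hN.
rewrite (_ : (fun t => f t - y t) = (fun t => f t + -1 * y t)); last first.
  by apply/funext => t; rewrite mulN1r.
rewrite -[- toLp mu r1 y]scaleN1r -(toLpZ (-1) hy) -(toLpD hf hN) toLp_norm// -lte_fin fineK//.
by rewrite ge0_fin_numE ?cLnorm_ge0//; have [] := Lp_predP mu r1 _ hD.
Qed.

Section one_sided.
Variables (T : bop LpG) (B E : set G).
Hypotheses (rB : rc B) (rE : rc E).
Hypothesis hT : forall s u, T (L s u) = L s (T u).

(* [h * 1_(E^-1)], composed with the inversion. *)
Let h := T (ip 1 B).
Let g : borel G -> R[i] := fun s => convol haar q1 E h (s^-1)%g.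
Let rB' : rc (inv B) := rc_invg rB.

Let T_ind c s : T (L s (ip c B)) = L s (c *: h).
Proof. by rewrite hT -[c in LHS]mulr1 (indZ hausG haar)// bopZ. Qed.

Let test_ind c X : rc X -> \int[mu]_(s in (X : set (borel G))) rprod c (g s) =
  pairing (iq 1 E) (T (M (inv B) (ip c X))).
Proof.
move=> rX.
rewrite (weak_integral_bop hausG haar pq T (ltrans_continuous hausG lcG haar (ip c B)) rX
  (convol_ind_weak_integral c rB rX) (iq 1 E)).
apply: eq_Rintegral => s _.
rewrite /g (rprod_convol hausG haar q1 pq c h (s^-1)%g rE) invgK.
by rewrite -[c in LHS]mulr1 (pairing_indM hausG haar q1 pq c 1 _ rE) -bopZ /comp T_ind.
Qed.

Let g_Re : continuous (fun t => complex.Re (g t) : R).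
Proof.
move=> t; apply: (@continuous_comp _ _ _ (fun t : G => (t^-1)%g : G)
  (fun t => complex.Re (convol haar q1 E h t) : R)); first exact: invg_continuous.
exact: (@convol_Re_continuous _ _ mu hausG lcG haar p q p1 q1 pq E h (t^-1)%g).
Qed.

Let g_Im : continuous (fun t => complex.Im (g t) : R).
Proof.
move=> t; apply: (@continuous_comp _ _ _ (fun t : G => (t^-1)%g : G)
  (fun t => complex.Im (convol haar q1 E h t) : R)); first exact: invg_continuous.
exact: (@convol_Im_continuous _ _ mu hausG lcG haar p q p1 q1 pq E h (t^-1)%g).
Qed.

(* Through the pairing with [1_E], the functional that [g] represents. *)
Let TM : bop LpG := bop_comp T (convol_bop hausG lcG haar modular p1 q1 pq rB').

(* Since [T] commutes with the left translations, testing [g] against [k] gives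
   [<1_E, T (k * 1_B)>], which is a bounded functional of [k]. *)
Let g_representation : g \in Lp_pred mu q1 /\
  forall k, pairing (toLp mu q1 g) k = pairing (iq 1 E) (T (M (inv B) k)).
Proof.
have [C C0 TC] := bop_Lp_bound TM; have [N gN] := convol_bounded haar q1 pq E h.
apply: (representation hausG lcG haar q1 pq g_Re g_Im (fun t => gN (t^-1)%g)
  (mulr_ge0 (Lp_norm_ge0 (iq 1 E)) C0)).
- by move=> u v; rewrite (convolLpD hausG lcG haar modular q1 pq _ _ rB') bopD (pairingDr pq).
- move=> u; rewrite (le_trans (pairing_le pq _ _))// -mulrA ler_wpM2l ?Lp_norm_ge0//; exact: TC.
- by move=> c X; exact: test_ind.
Qed.

Lemma convol_inv_in : g \in Lp_pred mu q1.
Proof. by have [] := g_representation. Qed.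

Let ghat : LqG := toLp mu q1 g.

Let pairing_ghat k : pairing ghat k = pairing (iq 1 E) (T (M (inv B) k)).
Proof. by have [_ ->] := g_representation. Qed.

(* In weak form: [k * v], for [v = T 1_B * 1_(E^-1)], is
   [T (k * 1_B) * 1_(E^-1)]. *)
Let integral_ghat F k : rc F ->
  \int[mu]_(t in (F : set (borel G))) pairing ghat (L (t^-1)%g k) =
  pairing (iq 1 F) (M E (T (M (inv B) k))).
Proof.
move=> rF; rewrite (pairing_convolLp hausG lcG haar modular q1 pq 1 _ rE rF).
apply: eq_Rintegral => t _; rewrite pairing_ghat.
by rewrite (convolLp_ltrans hausG lcG haar modular q1 pq _ _ rB') hT.
Qed.

Variables (S : bop LpG).
Hypothesis hS : forall s v, S (rho modular p1 s v) = rho modular p1 s (S v).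

(* In weak form: [S (k * y) = S k * y] for a step function [y] and [k] the
   indicator of [X]. Right convolution with an indicator commutes with [S]. *)
Let S_step c F X y : rc F -> rc X -> step_fun y ->
  \int[mu]_(s in (X : set (borel G))) pairing (iq 1 F) (S (L s (c *: toLp mu (ltW p1) y))) =
  \int[mu]_(t in (F : set (borel G))) pairing (toLp mu q1 (fun t => y (t^-1)%g)) (L (t^-1)%g (S (ip c X))).
Proof.
move=> rF rX; have mX := rc_borel rX; have mF := rc_borel rF.
have cS u : continuous_Lp (fun s => S (L s u)).
  exact: (continuous_Lp_bop S (ltrans_continuous hausG lcG haar u)).
have cL u := ltransV_continuous hausG lcG haar u.
elim=> [d W rW|f k sf e1 sk e2].
  have rW' := rc_invg rW.
  rewrite -[toLp mu (ltW p1) (cindic d W)]/(ip d W) -(indZ hausG haar (ltW p1) c d rW).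
  rewrite -[toLp mu q1 (fun t => cindic d W _)]/(iq d (inv W)).
  transitivity (pairing (iq 1 F) (S (M (inv W) (ip (c * d) X)))).
    exact/esym/(weak_integral_bop hausG haar pq S (ltrans_continuous hausG lcG haar _) rX
      (convol_ind_weak_integral (c * d) rW rX)).
  rewrite -(convolLp_comm hausG lcG haar q1 pq _ rW' hS) (pairing_convolLp hausG lcG haar modular q1 pq 1 _ rW' rF).
  apply: eq_Rintegral => t _; rewrite mulrC (indZ hausG haar)// !bopZ.
  by rewrite -(pairing_indM hausG haar q1 pq d 1 _ rW') mulr1.
have iF := step_in hausG haar (ltW p1).
rewrite toLpD; [|exact: iF..].
rewrite (toLpD (step_in hausG haar q1 (step_inv sf)) (step_in hausG haar q1 (step_inv sk))).
under [RHS]eq_Rintegral do rewrite (pairingDl pq).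
rewrite (RintegralD mF (pairing_integrable hausG haar pq _ (cL _) rF)
  (pairing_integrable hausG haar pq _ (cL _) rF)) -e1 -e2.
rewrite -(RintegralD mX (pairing_integrable hausG haar pq _ (cS _) rX)
  (pairing_integrable hausG haar pq _ (cS _) rX)).
by apply: eq_Rintegral => s _; rewrite scalerDr !bopD (pairingDr pq).
Qed.

(* The two sides of [S_step] are continuous in [y] for the norm of [L^p] and in
   the inverted [y] for the norm of [L^q], respectively; [step_dense] controls both. *)
Let S_convol c F X : rc F -> rc X ->
  \int[mu]_(s in (X : set (borel G))) pairing (iq 1 F) (S (L s (c *: M E h))) =
  \int[mu]_(t in (F : set (borel G))) pairing ghat (L (t^-1)%g (S (ip c X))).
Proof.
move=> rF rX; have mX := rc_borel rX; have mF := rc_borel rF.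
have cS u : continuous_Lp (fun s => S (L s u)).
  exact: (continuous_Lp_bop S (ltrans_continuous hausG lcG haar u)).
have cL u := ltransV_continuous hausG lcG haar u.
have [D D0 SD] := bop_Lp_bound S.
set k := S (ip c X); have hm := convol_in hausG lcG haar modular q1 pq h rE.
have [mm moo] := Lp_predP mu (ltW p1) _ hm.
have goo : (cLnorm (inv_measure mu) q (convol haar q1 E h) < +oo)%E.
  by rewrite (cLnorm_inv mm); have [_] := Lp_predP mu q1 _ convol_inv_in; exact.
pose N := Lp_norm (iq 1 F) * (D * normc c) * fine (mu X) + Lp_norm k * fine (mu F).
have mX0 : 0 <= fine (mu X) by rewrite fine_ge0.
have mF0 : 0 <= fine (mu F) by rewrite fine_ge0.
have NX := mulr_ge0 (mulr_ge0 (Lp_norm_ge0 (iq 1 F)) (mulr_ge0 D0 (normc_ge0 c))) mX0.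
have NF := mulr_ge0 (Lp_norm_ge0 k) mF0.
have N0 : 0 <= N := addr_ge0 NX NF.
apply/eqP; rewrite -subr_eq0 -normr_eq0 eq_le normr_ge0 andbT.
apply/ler_addgt0Pr => e e0; rewrite add0r.
have N1 : 0 < N + 1 by rewrite ltr_wpDl.
have [y sy [y1 y2]] := step_dense (ltW p1) q1 (rc_approx_borel_inv hausG lcG haar modular) mm moo goo
  (divr_gt0 e0 N1).
have hy := step_in hausG haar (ltW p1) sy.
have hyi := step_in hausG haar q1 (step_inv sy).
set ty := toLp mu (ltW p1) y; set ti := toLp mu q1 (fun t => y (t^-1)%g).
have d1 : Lp_norm (M E h - ty) < e / (N + 1).
  exact: toLp_dist_lt.
have d2 : Lp_norm (ghat - ti) < e / (N + 1).
  apply: (toLp_dist_lt convol_inv_in hyi).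
  by move: y2; rewrite (cLnorm_inv (cmeasurableB mm (cmeasurable_step sy))).
have I1 : \int[mu]_(s in (X : set (borel G))) pairing (iq 1 F) (S (L s (c *: M E h))) =
    \int[mu]_(s in (X : set (borel G))) pairing (iq 1 F) (S (L s (c *: (M E h - ty)))) +
    \int[mu]_(s in (X : set (borel G))) pairing (iq 1 F) (S (L s (c *: ty))).
  rewrite -(RintegralD mX (pairing_integrable hausG haar pq _ (cS _) rX)
    (pairing_integrable hausG haar pq _ (cS _) rX)).
  by apply: eq_Rintegral => s _; rewrite -(pairingDr pq) -!bopD -scalerDr subrK.
have I2 : \int[mu]_(t in (F : set (borel G))) pairing ghat (L (t^-1)%g k) =
    \int[mu]_(t in (F : set (borel G))) pairing (ghat - ti) (L (t^-1)%g k) +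
    \int[mu]_(t in (F : set (borel G))) pairing ti (L (t^-1)%g k).
  rewrite -(RintegralD mF (pairing_integrable hausG haar pq _ (cL _) rF)
    (pairing_integrable hausG haar pq _ (cL _) rF)).
  by apply: eq_Rintegral => t _; rewrite -(pairingDl pq) subrK.
rewrite I1 I2 (S_step c rF rX sy) [X in _ - X]addrC opprD addrA addrK.
rewrite (le_trans (ler_normB _ _))//.
have B1 : `|\int[mu]_(s in (X : set (borel G))) pairing (iq 1 F) (S (L s (c *: (M E h - ty))))| <=
    Lp_norm (iq 1 F) * (D * (normc c * Lp_norm (M E h - ty))) * fine (mu X).
  apply: (pairing_integral_bound hausG haar pq _ (cS _) rX) => s _.
  by rewrite (le_trans (SD _))// ltrans_norm Lp_normZ.
have B2 : `|\int[mu]_(t in (F : set (borel G))) pairing (ghat - ti) (L (t^-1)%g k)| <=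
    Lp_norm (ghat - ti) * Lp_norm k * fine (mu F).
  by apply: (pairing_integral_bound hausG haar pq _ (cL _) rF) => s _; rewrite ltrans_norm.
apply: le_trans (lerD B1 B2) _.
apply: (@le_trans _ _ (N * (e / (N + 1)))); last first.
  by rewrite mulrCA ler_piMr ?(ltW e0)// ler_pdivrMr// mul1r lerDl.
rewrite /N mulrDl; move: NX NF d1 d2 {B1 B2 I1 I2}.
move: (Lp_norm _) (Lp_norm _) (Lp_norm _) (Lp_norm _) (fine _) (fine _) (normc _) (e / _).
move=> b a x1 x2 x3 x4 x5 x6 NX NF d1 d2.
have -> : x2 * (D * (x5 * a)) * x4 + b * x1 * x3 = x2 * (D * x5) * x4 * a + x1 * x3 * b by ring.
by apply: lerD; apply: ler_wpM2l => //; exact: ltW.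
Qed.

(** With [k = c 1_X] and [v = T 1_B * 1_(E^-1)], both sides are weak forms of
    [S k * v]. *)
Lemma sandwich c F X : rc F -> rc X ->
  pairing (iq 1 F) (S (M E (T (M (inv B) (ip c X))))) =
  pairing (iq 1 F) (M E (T (M (inv B) (S (ip c X))))).
Proof.
move=> rF rX; rewrite -integral_ghat// -S_convol//.
pose A := bop_comp S (bop_comp (convol_bop hausG lcG haar modular p1 q1 pq rE) T).
transitivity (pairing (iq 1 F) (A (M (inv B) (ip c X)))); first by [].
rewrite (weak_integral_bop hausG haar pq A (ltrans_continuous hausG lcG haar (ip c B)) rX
  (convol_ind_weak_integral c rB rX) (iq 1 F)).
apply: eq_Rintegral => s _; congr (pairing _ (S _)).
rewrite -[LHS]/(M E (T (L s (ip c B)))) T_ind (convolLp_ltrans hausG lcG haar modular q1 pq _ _ rE).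
by rewrite (convolLpZ hausG lcG haar modular q1 pq _ _ rE).
Qed.

End one_sided.

(** By [sandwich], [S T - T S] vanishes after right convolutions with indicators
    on both sides, and these are removed by the approximate identities. *)
Theorem left_right_commute (S T : bop LpG) :
  (forall s v, S (rho modular p1 s v) = rho modular p1 s (S v)) ->
  (forall s u, T (L s u) = L s (T u)) -> bop_comp S T = bop_comp T S.
Proof.
move=> hS hT; pose A : bop LpG := bop_comp S T - bop_comp T S.
have AE u : A u = S (T u) - T (S u) by [].
have A1 c B E F X : rc B -> rc E -> rc F -> rc X ->
    pairing (iq 1 F) (M E (A (M (inv B) (ip c X)))) = 0.
  move=> rB rE rF rX; rewrite AE.
  have -> u v : M E (u - v) = M E u - M E v.
    exact: (bopB (convol_bop hausG lcG haar modular p1 q1 pq rE)).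
  rewrite (pairingBr pq).
  rewrite (convolLp_comm hausG lcG haar q1 pq _ rE hS) (sandwich rB rE hT hS c rF rX).
  by rewrite (convolLp_comm hausG lcG haar q1 pq _ (rc_invg rB) hS) subrr.
have A2 c B E X : rc B -> rc E -> rc X -> M E (A (M (inv B) (ip c X))) = 0.
  move=> rB rE rX; apply: (pairing_eq0 pq) => xi; move: xi.
  apply: (@functional_eq0 _ _ _ hausG lcG haar _ _ _ (Lp_norm (M E (A (M (inv B) (ip c X)))))).
  - by move=> xi eta; rewrite (pairingDl pq).
  - by move=> xi; rewrite mulrC; exact: (pairing_le pq).
  - move=> d F rF; rewrite -[d]mulr1 (pairing_indM hausG haar q1 pq d 1 _ rF).
    rewrite -(convolLpZ hausG lcG haar modular q1 pq _ _ rE) -bopZ.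
    rewrite -(convolLpZ hausG lcG haar modular q1 pq _ _ (rc_invg rB)) -(indZ hausG haar)//.
    exact: A1.
have A3 c X E : rc E -> rc X -> A (M E (ip c X)) = 0.
  move=> rE rX; rewrite -(invK E) -[A _](ltrans1 haar).
  apply: (convolLp_eq0 hausG lcG modular pq (A := L 1%g)) => F rF.
  by rewrite (A2 c (inv E) F X)// ?bop0//; exact: rc_invg.
have A4 c X : rc X -> A (ip c X) = 0.
  by move=> rX; apply: (convolLp_eq0 hausG lcG modular pq) => E rE; exact: A3.
have [C C0 AC] := bop_Lp_bound A.
apply: bop_ext => u; apply/eqP; rewrite -subr_eq0 -[X in X == 0]/(A u); apply/eqP.
apply: (pairing_eq0 pq) => xi; move: u.
apply: (@functional_eq0 _ _ _ hausG lcG haar _ _ _ (Lp_norm xi * C)).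
- by move=> u v; rewrite bopD (pairingDr pq).
- by move=> u; rewrite (le_trans (pairing_le pq _ _))// -mulrA ler_wpM2l ?Lp_norm_ge0.
- by move=> c X rX; rewrite A4// (pairing0r (ltW p1) pq).
Qed.

End commutation.

(** * Weak* limits of combinations of left translations *)

Section weak_star.
Context d (T : measurableType d) (R : realType).
Variables (mu : {measure set T -> \bar R}) (p : R) (p1 : 1 < p).
Local Notation E := (Lp mu (ltW p1)).
Local Notation E' := (Lp mu (conjugate_ge1 p1)).
Implicit Types (xi : E') (u : E).
Local Notation pq := (@conjugateE R p).

Lemma Lp_pairingE xi u :
  Lp_pairing xi u = Complex (pairing xi u) (pairing xi (Complex 0 (-1) *: u)).
Proof.
have hx := Lp_repr_in xi; have hu := Lp_repr_in u.
rewrite (eq_pairing pq hx (in_LpZ (Complex 0 (-1)) hu) _ (Lp_reprZ _ u)); last exact: aeW.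
congr Complex; apply: eq_Rintegral => t _; rewrite /rprod.
by case: (Lp_repr xi t) => a b; case: (Lp_repr u t) => c e /=; ring.
Qed.

Let left1 xi (n : nat) : E' := if n is 0 then xi else 0.
Let right1 u (n : nat) : E := if n is 0 then u else 0.

Let cvg_elementary (V : topologicalType) (f : nat -> V) : (forall n, f n.+1 = f 1%N) ->
  f n @[n --> \oo] --> f 1%N.
Proof. by move=> h; apply: cvg_near_cst; near=> n; rewrite -[n]prednK ?h//; near: n; exact: nbhs_infty_gt. Unshelve. all: by end_near. Qed.

Let summable1 xi u : cvgn (series (fun n => Lp_norm (left1 xi n) * Lp_norm (right1 u n))).
Proof.
apply: (cvgP _ (@cvg_elementary _ (series _) _)) => n.
rewrite /series/= !big_mkord big_ord_recl [in RHS]big_ord1 big1 ?addr0// => i _.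
by rewrite /= !Lp_norm0 mulr0.
Qed.

(** The elementary tensor [xi (x) u]. *)
Definition tensor1 xi u : projective_tensor mu p1 := ProjectiveTensor (@summable1 xi u).

Lemma tensor_pairing1 (A : bop E) xi u : tensor_pairing A (tensor1 xi u) = Lp_pairing xi (A u).
Proof.
rewrite /tensor_pairing.
set f := series _.
have -> : Lp_pairing xi (A u) = f 1%N by rewrite /f /series/= big_mkord big_ord1.
apply: (cvg_lim (@norm_hausdorff _ _)); apply: cvg_elementary => n.
rewrite /f /series/= !big_mkord big_ord_recl [in RHS]big_ord1 big1 ?addr0// => i _.
by rewrite /= bop0 Lp_pairingE scaler0 !(pairing0r (ltW p1) pq).
Qed.

Lemma tensor_pairing_continuous (om : projective_tensor mu p1) :
  continuous ((fun A => tensor_pairing A om) : weak_star mu p1 -> R[i]^o).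
Proof.
pose P := {ptws projective_tensor mu p1 -> R[i]^o}.
have c1 : continuous (@tensor_pairing _ _ _ mu p p1 : weak_star mu p1 -> P) by exact: initial_continuous.
have c2 : continuous ((fun f => f om) : P -> R[i]^o) by exact: (@proj_continuous _ (fun=> R[i]^o) om).
by move=> A; exact: (cvg_comp _ _ (c1 A) (c2 (tensor_pairing (A : bop E)))).
Qed.

Lemma weak_star_closure_eq (X : set (bop E)) om om' :
  (forall A, X A -> tensor_pairing A om = tensor_pairing A om') ->
  forall A, weak_star_closure X A -> tensor_pairing A om = tensor_pairing A om'.
Proof.
move=> h A cA; apply: (@norm_hausdorff _ (R[i]^o)) => U V nU nV.
have n1 : nbhs (A : weak_star mu p1) [set B | U (tensor_pairing B om)].
  exact: (@tensor_pairing_continuous om A _ nU).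
have n2 : nbhs (A : weak_star mu p1) [set B | V (tensor_pairing B om')].
  exact: (@tensor_pairing_continuous om' A _ nV).
have [B [XB [BU BV]]] := cA _ (filterI n1 n2).
exists (tensor_pairing B om); split; first exact: BU.
by rewrite (h B XB); exact: BV.
Qed.

End weak_star.

Section pseudomeasures.
Context {R : realType} {G : topologicalGroupType}.
Variables (mu : {measure set (borel G) -> \bar R}) (Delta : G -> R).
Hypotheses (hausG : hausdorff_space G) (lcG : locally_compact [set: G]).
Hypotheses (haar : left_haar mu) (modular : modular_function mu Delta).
Variables (p : R) (p1 : 1 < p).
Local Notation LpG := (Lp mu (ltW p1)).
Local Notation q1 := (conjugate_ge1 p1).
Local Notation LqG := (Lp mu q1).
Local Notation pq := (@conjugateE R p).
Local Notation ip := (ind mu (ltW p1)).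
Local Notation iq := (ind mu q1).
Local Notation rho s := (rho modular p1 s).
Local Notation lambda s := (lambda haar p1 s).
Implicit Types (s t : G) (u v : LpG) (F X : set G) (c d : R[i]).

Let D0 := Delta_gt0 modular.

Lemma rho_rtrans s u : rho s u = (Delta s `^ p^-1)%:C%C *: rtrans modular p1 s u.
Proof.
rewrite rtransE scalerA -rmorphM/= -powRD; last by rewrite (lt0r_neq0 (D0 s)) implybT.
by rewrite subrr powRr0 scale1r.
Qed.

(** The transpose of a right translation maps the indicator of [F] to a multiple
    of the indicator of a right translate of [F]. *)
Lemma rho_transpose c F s : rc F -> exists xi : LqG, forall u, pairing (iq c F) (rho s u) = pairing xi u.
Proof.
move=> rF; pose Fs : set G := [set t | F (t * s^-1)%g].
have rFs : rc Fs by exact: rc_mulgr.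
pose k := Delta s `^ p^-1 * (Delta s)^-1.
exists (k%:C%C *: iq c Fs) => u; apply/eqP; rewrite -subr_eq0; apply/eqP; move: u.
apply: (@functional_eq0 _ _ _ hausG lcG haar _ _ _
  (Lp_norm (iq c F) + Lp_norm (k%:C%C *: iq c Fs))).
- by move=> u v; rewrite bopD !(pairingDr pq) opprD addrACA.
- move=> u; rewrite (le_trans (ler_normB _ _))// mulrDl lerD//; last exact: (pairing_le pq).
  by rewrite -(rho_norm hausG lcG haar modular s u); exact: (pairing_le pq).
- move=> d X rX; have rXs : rc [set t | X (t * s)%g] by exact: rc_mulgr.
  rewrite rho_rtrans (rtrans_ind hausG haar modular p1 s d rX) (pairingZ pq) !(pairing_realZ pq).
  rewrite (pairing_ind hausG haar p1 q1 pq c d rF rXs) (pairing_ind hausG haar p1 q1 pq c d rFs rX).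
  have mA : measurable (Fs `&` X : set (borel G)).
    by apply: measurableI; exact: rc_borel.
  have -> : F `&` [set t | X (t * s)%g] = [set t | (Fs `&` X) (t * s)%g].
    by apply/seteqP; split=> t; rewrite /Fs /= mulgK.
  rewrite (mu_mulgr modular s mA) fineM//; last first.
    have [rad _ _] := haar; rewrite ge0_fin_numE//; apply: le_lt_trans (rc_finite hausG rad rX).
    exact: (borel_le mu mA (rc_borel rX) (@subIsetr _ _ _)).
  by apply/eqP; rewrite subr_eq0 /k; apply/eqP => /=; ring.
Qed.

Lemma span_lambda_rho A s : linear_span (range (fun t => lambda t)) A ->
  forall u, A (rho s u) = rho s (A u).
Proof.
move=> [n [c [S [hS ->]]]] u.
have sumE (w : LpG) : (\sum_i c i *: S i : bop LpG) w = \sum_i c i *: S i w.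
  elim/big_ind2: _ => // [A1 w1 A2 w2 <- <-] //.
rewrite !sumE -[RHS]/(rho s (\sum_i _)).
transitivity (\sum_i c i *: rho s (S i u)).
  apply: eq_bigr => i _; have [t _ <-] := hS i; congr (_ *: _).
  exact: (congr1 (fun A : bop LpG => A u) (lambda_rho_comm haar modular p1 t s)).
elim/big_ind2: _ => [|w1 w2 w3 w4 -> ->|i _]; rewrite ?bop0 ?bopD ?bopZ//.
Qed.

(** Given [xi] and [u], commutation with [rho s] is expressed by the equality of
    two weak* continuous functionals of [A], the tensors [xi (x) rho s u] and
    [eta (x) u] with [eta] from [rho_transpose]. *)
Lemma PM_rho A : PM haar p1 A -> forall s u, A (rho s u) = rho s (A u).
Proof.
move=> hA s u; apply/eqP; rewrite -subr_eq0; apply/eqP; apply: (pairing_eq0 (q1 := q1) pq) => xi; move: xi.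
apply: (@functional_eq0 _ _ _ hausG lcG haar _ _ _ (Lp_norm (A (rho s u) - rho s (A u)))).
- by move=> xi eta; rewrite (pairingDl pq).
- by move=> xi; rewrite mulrC; exact: (pairing_le pq).
move=> c F rF; have [eta etaP] := rho_transpose c s rF.
rewrite (pairingBr pq) etaP; apply/eqP; rewrite subr_eq0; apply/eqP.
have tr v : Lp_pairing (iq c F) (rho s v) = Lp_pairing eta v.
  by rewrite !Lp_pairingE -bopZ !etaP.
have := weak_star_closure_eq (om := tensor1 (iq c F) (rho s u)) (om' := tensor1 eta u) _ hA.
rewrite !tensor_pairing1 !Lp_pairingE => H.
suff /H[] : forall B, linear_span (range (fun t => lambda t)) B ->
  tensor_pairing B (tensor1 (iq c F) (rho s u)) = tensor_pairing B (tensor1 eta u) by [].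
by move=> B hB; rewrite !tensor_pairing1 (span_lambda_rho s hB) tr.
Qed.

End pseudomeasures.

(** * The commutants *)

Theorem theorem1p2 (R : realType) (G : topologicalGroupType)
    (hausG : hausdorff_space G) (lcG : locally_compact [set: G])
    (mu : {measure set (borel G) -> \bar R}) (haar : left_haar mu)
    (Delta : G -> R) (modular : modular_function mu Delta)
    (p : R) (p1 : 1 < p) :
  exists U : bop (Lp mu (ltW p1)),
    [/\ forall f : Lp mu (ltW p1), (Lp_repr (U f) : G -> R[i]) =
          (fun t => (Delta (t^-1)%g `^ p^-1)%:C%C * Lp_repr f (t^-1)%g) %[ae mu],
        forall f : Lp mu (ltW p1), U (U f) = f
      & forall f : Lp mu (ltW p1), `|U f| = `|f|] /\
    [/\ commutant (PM haar p1) =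
          [set bop_comp U (bop_comp T U) | T in CV modular p1],
        commutant [set bop_comp U (bop_comp T U) | T in CV modular p1] =
          CV modular p1
      & commutant (commutant (PM haar p1)) = CV modular p1].
Proof.
pose V := flip_bop hausG lcG haar modular p1; exists V.
have VV u : V (V u) = u by exact: flip_bopK.
split; first split.
- exact: flip_bopE.
- exact: VV.
- by move=> u; rewrite !Lp_normE; congr (_%:C%C); exact: flip_bop_norm.
pose lam := lambda haar p1 : G -> bop (Lp mu (ltW p1)).
pose rh := rho modular p1 : G -> bop (Lp mu (ltW p1)).
have rhoE s u : rh s u = V (lam s (V u)).
  exact: (congr1 (fun A : bop _ => A u) (rho_flip_lambda hausG lcG haar modular p1 s)).
have lamE s u : lam s u = V (rh s (V u)) by rewrite rhoE !VV.
have CVP (A : bop _) : CV modular p1 A <-> forall s u, A (rh s u) = rh s (A u).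
  split=> [hA s u|hA _ [s _ <-]]; last by apply: bop_ext => u; exact: hA.
  exact: (congr1 (fun A : bop _ => A u) (hA (rh s) (ex_intro2 _ _ s I erefl))).
have PM_CV A : PM haar p1 A -> CV modular p1 A.
  by move=> hA; apply/CVP; exact: (PM_rho hausG lcG modular hA).
have lam_PM s : PM haar p1 (lam s).
  apply: subset_closure; exists 1%N, (fun=> 1), (fun=> lam s); split=> [_|]; first by exists s.
  by rewrite big_ord1 scale1r.
have lam_CV s : CV modular p1 (lam s) by exact: PM_CV.
(* The conjugate of [T] by the flip commutes with the left translations. *)
have CV_U S T : CV modular p1 S -> CV modular p1 T ->
    bop_comp S (bop_comp V (bop_comp T V)) = bop_comp (bop_comp V (bop_comp T V)) S.
  move=> /CVP hS /CVP hT; apply: (left_right_commute hausG lcG (haar := haar) (conjugate_ge1 p1)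
    (@conjugateE R p) hS) => s u.
  change (V (T (V (lam s u))) = lam s (V (T (V u)))).
  by rewrite !lamE !VV hT.
have E1 : commutant (PM haar p1) = [set bop_comp V (bop_comp T V) | T in CV modular p1].
  apply/seteqP; split=> [A hA|_ [T hT <-] S hS]; last first.
    by rewrite CV_U//; exact: PM_CV.
  exists (bop_comp V (bop_comp A V)); last first.
    by apply: bop_ext => u; rewrite -[LHS]/(V (V (A (V (V u))))) !VV.
  apply/CVP => s u; change (V (A (V (rh s u))) = rh s (V (A (V u)))).
  rewrite !rhoE !VV; congr (V _).
  exact: (congr1 (fun B : bop _ => B (V u)) (hA _ (lam_PM s))).
have E2 : commutant [set bop_comp V (bop_comp T V) | T in CV modular p1] = CV modular p1.
  apply/seteqP; split=> [A hA|S hS _ [T hT <-]]; last exact: CV_U.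
  apply/CVP => s u; rewrite !rhoE.
  exact: (congr1 (fun B : bop _ => B u) (hA _ (ex_intro2 _ _ (lam s) (lam_CV s) erefl))).
by split; [exact: E1|exact: E2|rewrite E1 E2].
Qed.
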